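(* Let $(X,\mu)$ be a non-atomic probability space and let $T:X\to X$ be an ergodic automorphism of $(X,\mu)$ (an invertible measure-preserving map). Let $L^\infty(X,\mathrm{SL}(2,\mathbb{R}))$ be the space of measurable essentially bounded maps $A:X\to\mathrm{SL}(2,\mathbb{R})$ with the metric $\|A-B\|_\infty=\operatorname{ess\,sup}_x\|A(x)-B(x)\|$. Then there is a residual set $\mathcal{R}\subset L^\infty(X,\mathrm{SL}(2,\mathbb{R}))$ such that every $A\in\mathcal{R}$ either is uniformly hyperbolic or satisfies $\mathrm{LE}(A)=0$.
   Context: For a cocycle $A$ write $A^n(x)=A(T^{n-1}x)\cdots A(x)$ for $n>0$, $A^0=I$, and $A^n(x)=[A(T^nx)]^{-1}\cdots[A(T^{-1}x)]^{-1}$ for $n<0$. The limit $\lambda^+(x)=\lim_{n\to\infty}\frac1n\log\|A^n(x)\|\ge0$ exists $\mu$-a.e., and $\mathrm{LE}(A)=\int_X\lambda^+\,d\mu$. The cocycle $A$ (over $T$) is uniformly hyperbolic if for $\mu$-a.e. $x$ there is a splitting $\mathbb{R}^2=E^u(x)\oplus E^s(x)$, measurable in $x$, with $A(x)E^u(x)=E^u(Tx)$, $A(x)E^s(x)=E^s(Tx)$ a.e., and constants $C>0$, $0<\tau<1$ such that $\|A^n(x)v^s\|\le C\tau^n\|v^s\|$ and $\|A^{-n}(x)v^u\|\le C\tau^n\|v^u\|$ for a.e. $x$, all $v^s\in E^s(x)$, $v^u\in E^u(x)$ and $n\ge0$. *)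

(* Defs.v *)
From HB Require Import structures.
From mathcomp Require Import all_boot all_order all_algebra.
From mathcomp Require Import all_classical all_reals all_analysis ess_sup_inf.
Set Implicit Arguments. Unset Strict Implicit. Unset Printing Implicit Defensive.
Import Order.TTheory GRing.Theory Num.Theory.
Import numFieldNormedType.Exports.
Local Open Scope classical_set_scope.
Local Open Scope ring_scope.

Section Defs.
Context {R : realType}.

Definition vnorm (v : 'cV[R]_2) : R := Num.sqrt (\sum_(i < 2) v i 0 ^+ 2).

Definition opnorm (M : 'M[R]_2) : R :=
  sup [set vnorm (M *m v) | v in [set v : 'cV[R]_2 | vnorm v = 1]].

Definition subspace (E : set 'cV[R]_2) : Prop :=
  E 0 /\ (forall v w, E v -> E w -> E (v + w)) /\
  (forall (a : R) v, E v -> E (a *: v)).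

Definition splitting (Eu Es : set 'cV[R]_2) : Prop :=
  subspace Eu /\ subspace Es /\ (Eu `&` Es = [set 0]) /\
  (forall v : 'cV[R]_2, exists2 u, Eu u & exists2 s, Es s & v = u + s).

End Defs.

Section Dyn.
Context {d : measure_display} {X : measurableType d} {R : realType}.

(** Measurability of a (closed-)subspace-valued map, in the sense of
    Effros/Wijsman: x |-> dist(v, E x) is measurable for every v. *)
Definition dist_to (E : set 'cV[R]_2) (v : 'cV[R]_2) : R :=
  inf [set vnorm (v - w) | w in E].

Definition measurable_subspace_map (E : X -> set 'cV[R]_2) : Prop :=
  forall v : 'cV[R]_2, measurable_fun setT (fun x => dist_to (E x) v).

Variables (T Tinv : X -> X).

Fixpoint cocycle (A : X -> 'M[R]_2) (n : nat) (x : X) : 'M[R]_2 :=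
  match n with
  | 0 => 1%:M
  | n'.+1 => A (iter n' T x) *m cocycle A n' x
  end.

Fixpoint cocycle_neg (A : X -> 'M[R]_2) (n : nat) (x : X) : 'M[R]_2 :=
  match n with
  | 0 => 1%:M
  | n'.+1 => invmx (A (iter n'.+1 Tinv x)) *m cocycle_neg A n' x
  end.

Variable mu : probability X R.

(** lambda^+(x) : upper limit of (1/n) log ||A^n(x)|| (equal to the limit
    wherever the limit exists, i.e. mu-a.e.). *)
Definition lyap_top (A : X -> 'M[R]_2) (x : X) : \bar R :=
  limn_esup (fun n => ((n%:R)^-1 * ln (opnorm (cocycle A n x)))%:E).

Definition LE (A : X -> 'M[R]_2) : \bar R := (\int[mu]_x lyap_top A x)%E.

Definition uniformly_hyperbolic (A : X -> 'M[R]_2) : Prop :=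
  exists Eu Es : X -> set 'cV[R]_2,
    measurable_subspace_map Eu /\ measurable_subspace_map Es /\
    exists C tau : R, 0 < C /\ 0 < tau < 1 /\
    \forall x \ae mu,
      splitting (Eu x) (Es x) /\
      [set A x *m v | v in Eu x] = Eu (T x) /\
      [set A x *m v | v in Es x] = Es (T x) /\
      (forall n (v : 'cV[R]_2), Es x v ->
         vnorm (cocycle A n x *m v) <= C * tau ^+ n * vnorm v) /\
      (forall n (v : 'cV[R]_2), Eu x v ->
         vnorm (cocycle_neg A n x *m v) <= C * tau ^+ n * vnorm v).

Definition Linf_SL2 (A : X -> 'M[R]_2) : Prop :=
  (forall i j, measurable_fun setT (fun x => A x i j)) /\
  (forall x, \det (A x) = 1) /\
  exists M : R, \forall x \ae mu, opnorm (A x) <= M.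

Definition Linf_dist (A B : X -> 'M[R]_2) : \bar R :=
  ess_sup mu (fun x => (opnorm (A x - B x))%:E).

Definition Linf_open (U : set (X -> 'M[R]_2)) : Prop :=
  U `<=` Linf_SL2 /\
  forall A, U A -> exists2 e : R, 0 < e &
    forall B, Linf_SL2 B -> (Linf_dist A B < e%:E)%E -> U B.

Definition Linf_dense (U : set (X -> 'M[R]_2)) : Prop :=
  forall A, Linf_SL2 A -> forall e : R, 0 < e ->
    exists2 B, U B & (Linf_dist A B < e%:E)%E.

Definition Linf_residual (Rs : set (X -> 'M[R]_2)) : Prop :=
  Rs `<=` Linf_SL2 /\
  exists U : nat -> set (X -> 'M[R]_2),
    (forall n, Linf_open (U n) /\ Linf_dense (U n)) /\
    \bigcap_n U n `<=` Rs.

End Dyn.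

Definition nonatomic {d : measure_display} {X : measurableType d} {R : realType}
  (mu : probability X R) : Prop :=
  forall A : set X, measurable A -> (0 < mu A)%E ->
    exists B : set X, [/\ measurable B, B `<=` A & (0 < mu B < mu A)%E].

Definition invertible_mp {d : measure_display} {X : measurableType d} {R : realType}
  (mu : probability X R) (T Tinv : X -> X) : Prop :=
  [/\ measurable_fun setT T, measurable_fun setT Tinv,
      cancel T Tinv, cancel Tinv T &
      forall A : set X, measurable A -> mu (T @^-1` A) = mu A].

Definition ergodic {d : measure_display} {X : measurableType d} {R : realType}
  (mu : probability X R) (T : X -> X) : Prop :=
  forall A : set X, measurable A -> T @^-1` A = A -> mu A = 0%E \/ mu A = 1%E.

(* Main.v *)
Require Import Defs.
From HB Require Import structures.
From mathcomp Require Import all_boot all_order all_algebra.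
From mathcomp Require Import all_classical all_reals all_analysis ess_sup_inf.
From mathcomp Require Import measurable_realfun.
From mathcomp Require Import ring lra zify.
Set Implicit Arguments. Unset Strict Implicit. Unset Printing Implicit Defensive.
Import Order.TTheory GRing.Theory Num.Theory.
Import numFieldNormedType.Exports.
Local Open Scope classical_set_scope.
Local Open Scope ring_scope.

(** Let Z_delta be the set of A such that the integral of log |A^n| is below n delta for some n.
    It is open, so its union with its exterior is open and dense; intersect over delta = 1/k.
    If A lies in every Z_delta, one half of Birkhoff's theorem gives LE(A) = 0. It remains to see
    that A is uniformly hyperbolic when it is in the exterior of some Z_delta.

    Start from a line and let it be turned at each step by a rotation of size at most rho: the
    reachable lines form a growing cone. If the points where all these cones fill the projective
    line within m steps form a null set for every m, then the unfilled cones carry quadratic forms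
    that increase uniformly along almost every orbit, which forces uniform hyperbolicity.
    Otherwise a set of positive measure is visited where any line can be turned into any other; on
    long Rokhlin blocks one such turn, made when the growth of the past balances that of the
    future, cancels the growth of the whole block, and the perturbed cocycle is in Z_delta. *)

(** * Two by two matrices and rational rotations *)

(** The obstacle is measurability: a cone that stays open is found separately for each point and
    each window length, and nothing makes it depend measurably on the point. It is never chosen.
    Only the constants of the forms are uniform, and forms on every finite window, unrelated to each
    other, already show that an orbit either contracts or eventually grows exponentially. Stable and
    unstable lines are then defined without cones, by bounded forward or backward orbits, and the
    distance to such a line is a limit of measurable functions. Where a choice is unavoidable it is
    made countable: cones start at integer vectors and perturbations have rational parameters, so
    that the first successful one can be taken. The forms increase because the rotations widen the
    cone on both sides by a fixed angle, while the matrices only transport the forms. The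
    cancellation on a block costs an amount that depends on the waiting time for a turn, not on the
    length of the block, so it is negligible on long blocks. Half of Birkhoff's theorem is enough
    because determinant one makes every logarithm of a norm nonnegative. *)

Section TwoByTwo.
Context {R : realType}.
Implicit Types (A B : 'M[R]_2) (u v w : 'cV[R]_2).

Lemma sum2E (V : nmodType) (F : 'I_2 -> V) : \sum_(i < 2) F i = F 0 + F 1.
Proof.
rewrite big_ord_recl big_ord1; congr (F _ + F _); exact: val_inj.
Qed.

Lemma mulmx2E A B i j : (A *m B) i j = A i 0 * B 0 j + A i 1 * B 1 j.
Proof. by rewrite mxE sum2E. Qed.

Lemma mulmx2vE A v i j : (A *m v) i j = A i 0 * v 0 j + A i 1 * v 1 j.
Proof. by rewrite mxE sum2E. Qed.

Lemma det2E A : \det A = A 0 0 * A 1 1 - A 0 1 * A 1 0.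
Proof.
rewrite (expand_det_row _ 0) sum2E /cofactor !det_mx11 !mxE /=.
have -> : lift (0 : 'I_2) 0 = 1 by exact: val_inj.
have -> : lift (1 : 'I_2) 0 = 0 by exact: val_inj.
rewrite /= /bump /= expr0 expr1; ring.
Qed.

Lemma ord2P (P : 'I_2 -> Prop) : P 0 -> P 1 -> forall i, P i.
Proof.
move=> P0 P1 [[|[|//]] i2].
- by have -> : Ordinal i2 = 0 by exact: val_inj.
- by have -> : Ordinal i2 = 1 by exact: val_inj.
Qed.

Lemma col2P v w : v 0 0 = w 0 0 -> v 1 0 = w 1 0 -> v = w.
Proof.
by move=> e0 e1; apply/matrixP => i j; rewrite ord1; elim/ord2P: i.
Qed.

Lemma mat2P A B : A 0 0 = B 0 0 -> A 0 1 = B 0 1 -> A 1 0 = B 1 0 ->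
  A 1 1 = B 1 1 -> A = B.
Proof.
by move=> *; apply/matrixP => i j; elim/ord2P: i; elim/ord2P: j.
Qed.

Definition mx2 (a b c d : R) : 'M[R]_2 := \matrix_(i, j)
  if i == 0 then if j == 0 then a else b else if j == 0 then c else d.

Definition cv2 (x y : R) : 'cV[R]_2 := \col_i if i == 0 then x else y.

Lemma mx2E a b c d : (mx2 a b c d 0 0 = a) * (mx2 a b c d 0 1 = b) *
  (mx2 a b c d 1 0 = c) * (mx2 a b c d 1 1 = d).
Proof. by rewrite !mxE. Qed.

Lemma cv2E x y : (cv2 x y 0 0 = x) * (cv2 x y 1 0 = y).
Proof. by rewrite !mxE. Qed.

(** The determinant of the pair, zero exactly for parallel vectors and multiplied by [\det A] under
    [A]. Directions are compared through its sign, so no angle function is needed. *)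
Definition d2 v w : R := v 0 0 * w 1 0 - v 1 0 * w 0 0.
Definition n2 v : R := v 0 0 ^+ 2 + v 1 0 ^+ 2.
(** The squared Hilbert-Schmidt norm: polynomial in the entries, invariant under inversion in
    determinant one, and comparable to [opnorm A ^+ 2] up to a factor 2. *)
Definition hs A : R := A 0 0 ^+ 2 + A 0 1 ^+ 2 + A 1 0 ^+ 2 + A 1 1 ^+ 2.
Definition fro A : R := Num.sqrt (hs A).

Lemma vnormE v : vnorm v = Num.sqrt (n2 v).
Proof. by rewrite /vnorm sum2E. Qed.

Lemma n2_ge0 v : 0 <= n2 v. Proof. by rewrite addr_ge0 ?sqr_ge0. Qed.
Lemma hs_ge0 A : 0 <= hs A. Proof. by rewrite !addr_ge0 ?sqr_ge0. Qed.
Lemma fro_ge0 A : 0 <= fro A. Proof. exact: sqrtr_ge0. Qed.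
Lemma sqr_fro A : fro A ^+ 2 = hs A. Proof. by rewrite sqr_sqrtr ?hs_ge0. Qed.
Lemma sqr_vnorm v : vnorm v ^+ 2 = n2 v.
Proof. by rewrite vnormE sqr_sqrtr ?n2_ge0. Qed.
Lemma vnorm_ge0 v : 0 <= vnorm v. Proof. exact: sqrtr_ge0. Qed.

Lemma n2_eq0 v : (n2 v == 0) = (v == 0).
Proof.
apply/idP/eqP => [|->]; last by rewrite /n2 !mxE expr0n addr0.
rewrite paddr_eq0 ?sqr_ge0 // !sqrf_eq0 => /andP[/eqP e0 /eqP e1].
by apply: col2P; rewrite mxE.
Qed.

Lemma n2_gt0 v : (0 < n2 v) = (v != 0).
Proof. by rewrite lt_neqAle n2_ge0 andbT eq_sym n2_eq0. Qed.

Lemma n2Z (a : R) v : n2 (a *: v) = a ^+ 2 * n2 v.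
Proof. rewrite /n2 !mxE; ring. Qed.

Lemma d2_mul A v w : d2 (A *m v) (A *m w) = \det A * d2 v w.
Proof. rewrite /d2 det2E !mulmx2vE; ring. Qed.

Lemma d2_sqr_le v w : d2 v w ^+ 2 <= n2 v * n2 w.
Proof.
rewrite -subr_ge0; apply: (@le_trans _ _ ((v 0 0 * w 0 0 + v 1 0 * w 1 0) ^+ 2)).
  exact: sqr_ge0.
by rewrite /d2 /n2 le_eqVlt; apply/orP; left; apply/eqP; ring.
Qed.

Lemma n2_mul_le A v : n2 (A *m v) <= hs A * n2 v.
Proof.
rewrite /n2 /hs !mulmx2vE -subr_ge0.
have -> : (A 0 0 ^+ 2 + A 0 1 ^+ 2 + A 1 0 ^+ 2 + A 1 1 ^+ 2) *
    (v 0 0 ^+ 2 + v 1 0 ^+ 2) - ((A 0 0 * v 0 0 + A 0 1 * v 1 0) ^+ 2 +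
    (A 1 0 * v 0 0 + A 1 1 * v 1 0) ^+ 2) =
  (A 0 0 * v 1 0 - A 0 1 * v 0 0) ^+ 2 + (A 1 0 * v 1 0 - A 1 1 * v 0 0) ^+ 2.
  by ring.
by rewrite addr_ge0 ?sqr_ge0.
Qed.

Lemma hs_cols A : hs A = n2 (A *m cv2 1 0) + n2 (A *m cv2 0 1).
Proof. rewrite /hs /n2 !mulmx2vE !cv2E; ring. Qed.

Lemma hs_mul A B : hs (A *m B) <= hs A * hs B.
Proof.
rewrite [hs (_ *m _)]hs_cols [hs B]hs_cols -!mulmxA mulrDr.
by rewrite lerD ?n2_mul_le.
Qed.

Lemma fro_mul A B : fro (A *m B) <= fro A * fro B.
Proof. by rewrite -sqrtrM ?hs_ge0 // ler_wsqrtr ?hs_mul. Qed.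

Lemma vnorm_mul_le A v : vnorm (A *m v) <= fro A * vnorm v.
Proof. by rewrite !vnormE -sqrtrM ?hs_ge0 // ler_wsqrtr ?n2_mul_le. Qed.

(** [hs A - 2 * \det A] equals [(A 0 0 - A 1 1) ^+ 2 + (A 0 1 + A 1 0) ^+ 2]. *)
Lemma hs_det1 A : \det A = 1 -> 2 <= hs A.
Proof.
rewrite det2E /hs => dA.
have h1 := sqr_ge0 (A 0 0 - A 1 1); have h2 := sqr_ge0 (A 0 1 + A 1 0).
by nra.
Qed.

Lemma fro_ge1 A : \det A = 1 -> 1 <= fro A.
Proof.
by move=> /hs_det1 h; rewrite -sqrtr1 ler_wsqrtr //; apply: le_trans h; rewrite ler1n.
Qed.

Lemma fro_triangle A B : fro (A + B) <= fro A + fro B.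
Proof.
rewrite -(ler_pXn2r (_ : 0 < 2)%N) ?nnegrE ?addr_ge0 ?fro_ge0 //.
rewrite sqrrD !sqr_fro.
pose p := A 0 0 * B 0 0 + A 0 1 * B 0 1 + A 1 0 * B 1 0 + A 1 1 * B 1 1.
have -> : hs (A + B) = hs A + p *+ 2 + hs B by rewrite /hs /p !mxE; ring.
rewrite lerD2r lerD2l lerMn2r /=.
apply: le_trans (ler_norm p) _; rewrite -sqrtr_sqr -sqrtrM ?hs_ge0 // ler_wsqrtr //.
rewrite -subr_ge0 /hs /p.
set a := A 0 0; set b := A 0 1; set c := A 1 0; set d := A 1 1.
set e := B 0 0; set f := B 0 1; set g := B 1 0; set h := B 1 1.
have -> : (a ^+ 2 + b ^+ 2 + c ^+ 2 + d ^+ 2) * (e ^+ 2 + f ^+ 2 + g ^+ 2 + h ^+ 2)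
  - (a * e + b * f + c * g + d * h) ^+ 2 =
  (a * f - b * e) ^+ 2 + (a * g - c * e) ^+ 2 + (a * h - d * e) ^+ 2 +
  (b * g - c * f) ^+ 2 + (b * h - d * f) ^+ 2 + (c * h - d * g) ^+ 2 by ring.
by rewrite !addr_ge0 ?sqr_ge0.
Qed.

Lemma froN A : fro (- A) = fro A.
Proof. by rewrite /fro /hs !mxE !sqrrN. Qed.

Lemma fro_distC A B : fro (A - B) = fro (B - A).
Proof. by rewrite -froN opprB. Qed.

Lemma opnorm_has_sup A :
  has_sup [set vnorm (A *m v) | v in [set v : 'cV[R]_2 | vnorm v = 1]].
Proof.
split.
  exists (vnorm (A *m cv2 1 0)), (cv2 1 0) => //=.
  by rewrite vnormE /n2 !cv2E expr1n expr0n addr0 sqrtr1.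
exists (fro A) => _ [v /= v1 <-].
by rewrite -[leRHS]mulr1 -v1 vnorm_mul_le.
Qed.

Lemma opnorm_le_fro A : opnorm A <= fro A.
Proof.
apply: ge_sup; first by have [] := opnorm_has_sup A.
by move=> _ [v /= v1 <-]; rewrite -[leRHS]mulr1 -v1 vnorm_mul_le.
Qed.

Lemma hs_le_opnorm A : hs A <= 2 * opnorm A ^+ 2.
Proof.
have H v : vnorm v = 1 -> n2 (A *m v) <= opnorm A ^+ 2.
  move=> v1; rewrite -sqr_vnorm ler_sqr ?nnegrE ?vnorm_ge0 //.
    by apply: ub_le_sup; [have [] := opnorm_has_sup A|exists v].
  apply: (le_trans (vnorm_ge0 (A *m v))).
  by apply: ub_le_sup; [have [] := opnorm_has_sup A|exists v].
rewrite hs_cols mulrDl !mul1r; apply: lerD; apply: H;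
 by rewrite vnormE /n2 !cv2E expr1n expr0n ?addr0 ?add0r sqrtr1.
Qed.

Lemma opnorm_ge0 A : 0 <= opnorm A.
Proof.
apply: (le_trans (vnorm_ge0 (A *m cv2 1 0))).
apply: ub_le_sup; first by have [] := opnorm_has_sup A.
by exists (cv2 1 0) => //=; rewrite vnormE /n2 !cv2E expr1n expr0n addr0 sqrtr1.
Qed.

Lemma fro_le_opnorm A : fro A <= 2 * opnorm A.
Proof.
rewrite -(ler_pXn2r (_ : 0 < 2)%N) ?nnegrE ?fro_ge0 ?mulr_ge0 ?opnorm_ge0 //.
rewrite sqr_fro; apply: (le_trans (hs_le_opnorm A)).
by have := sqr_ge0 (opnorm A); nra.
Qed.

Lemma opnorm_ge1 A : \det A = 1 -> 1 <= opnorm A.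
Proof.
move=> /hs_det1 h; have := le_trans h (hs_le_opnorm A).
by have := opnorm_ge0 A; nra.
Qed.

Lemma unitmx_det1 A : \det A = 1 -> A \in unitmx.
Proof. by move=> dA; rewrite unitmxE dA unitr1. Qed.

Lemma invmx2E A : \det A = 1 ->
  invmx A = mx2 (A 1 1) (- A 0 1) (- A 1 0) (A 0 0).
Proof.
move=> dA; rewrite -[RHS]mul1mx -(mulVmx (unitmx_det1 dA)) -mulmxA.
rewrite (_ : A *m _ = 1%:M) ?mulmx1 //.
by apply: mat2P; rewrite mulmx2E !mx2E !mxE ?eqxx /= -?dA ?det2E; ring.
Qed.

Lemma hs_inv A : \det A = 1 -> hs (invmx A) = hs A.
Proof. by move=> /invmx2E ->; rewrite /hs !mx2E; ring. Qed.

Lemma det_inv1 A : \det A = 1 -> \det (invmx A) = 1.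
Proof. by move=> dA; rewrite det_inv dA invr1. Qed.

Lemma mulVmx2v A v : \det A = 1 -> invmx A *m (A *m v) = v.
Proof. by move=> dA; rewrite mulmxA mulVmx ?mul1mx ?unitmx_det1. Qed.

Lemma mulmxV2v A v : \det A = 1 -> A *m (invmx A *m v) = v.
Proof. by move=> dA; rewrite mulmxA mulmxV ?mul1mx ?unitmx_det1. Qed.

Lemma n2_mul_ge A v : \det A = 1 -> n2 v <= hs A * n2 (A *m v).
Proof. by move=> dA; rewrite -{1}(mulVmx2v v dA) -(hs_inv dA) n2_mul_le. Qed.

Lemma mul_neq0 A v : \det A = 1 -> v != 0 -> A *m v != 0.
Proof.
move=> dA; apply: contraNneq => Av; by rewrite -(mulVmx2v v dA) Av mulmx0.
Qed.

Definition rotcs (c s : R) : 'M[R]_2 := mx2 c (- s) s c.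
Definition rcos (r : R) : R := (1 - r ^+ 2) / (1 + r ^+ 2).
Definition rsin (r : R) : R := 2 * r / (1 + r ^+ 2).
(* the rotation by the angle 2 arctan r; rational parameters are dense *)
Definition rot (r : R) := rotcs (rcos r) (rsin r).

Lemma den_gt0 (r : R) : 0 < 1 + r ^+ 2.
Proof. by have := sqr_ge0 r; lra. Qed.

Lemma rcs1 r : rcos r ^+ 2 + rsin r ^+ 2 = 1.
Proof. rewrite /rcos /rsin; field; exact: lt0r_neq0 (den_gt0 r). Qed.

Lemma rcosN r : rcos (- r) = rcos r. Proof. by rewrite /rcos sqrrN. Qed.
Lemma rsinN r : rsin (- r) = - rsin r.
Proof. by rewrite /rsin sqrrN mulrN mulNr. Qed.

Lemma det_rot r : \det (rot r) = 1.
Proof. by rewrite det2E !mx2E -(rcs1 r); ring. Qed.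

Lemma rot0 : rot 0 = 1%:M.
Proof.
by apply: mat2P; rewrite mx2E !mxE /rcos /rsin ?expr0n /=; field.
Qed.

Lemma hs_rot_mul r A : hs (rot r *m A) = hs A.
Proof.
transitivity ((rcos r ^+ 2 + rsin r ^+ 2) * hs A); last by rewrite rcs1 mul1r.
rewrite /hs !mulmx2E !mx2E; ring.
Qed.

Lemma fro_rot_mul r A : fro (rot r *m A) = fro A.
Proof. by rewrite /fro hs_rot_mul. Qed.

Lemma fro_rot_sub q r : fro (rot q - rot r) <= 4 * `|q - r|.
Proof.
have -> : 4 * `|q - r| = Num.sqrt ((4 * (q - r)) ^+ 2).
  by rewrite sqrtr_sqr normrM ger0_norm.
rewrite ler_wsqrtr //.
have hq := den_gt0 q; have hr := den_gt0 r.
have -> : hs (rot q - rot r) = 8 * (q - r) ^+ 2 / ((1 + q ^+ 2) * (1 + r ^+ 2)).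
  rewrite /hs !mxE /= /rcos /rsin; field.
  by rewrite !lt0r_neq0.
rewrite ler_pdivrMr ?mulr_gt0 //.
have h1 : 1 <= (1 + q ^+ 2) * (1 + r ^+ 2).
  by have := sqr_ge0 q; have := sqr_ge0 r; nra.
by have := sqr_ge0 (q - r); nra.
Qed.

Lemma fro_rot_mul_sub r A : fro (rot r *m A - A) <= 4 * `|r| * fro A.
Proof.
have -> : rot r *m A - A = (rot r - rot 0) *m A by rewrite mulmxBl rot0 mul1mx.
apply: (le_trans (fro_mul _ _)); rewrite ler_wpM2r ?fro_ge0 //.
by apply: le_trans (fro_rot_sub _ _) _; rewrite subr0.
Qed.

End TwoByTwo.

(** * Directions reachable by small rotations *)

Section Reach.
Context {R : realType}.
Implicit Types (A B : 'M[R]_2) (a b u v w : 'cV[R]_2).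

Fixpoint mprod (S : nat -> 'M[R]_2) (n : nat) : 'M[R]_2 :=
  if n is n'.+1 then S n' *m mprod S n' else 1%:M.

Lemma mprod_ext (S S' : nat -> 'M[R]_2) n :
  (forall i, (i < n)%N -> S i = S' i) -> mprod S n = mprod S' n.
Proof.
elim: n => //= n IH H; rewrite H // IH // => i /ltnW; exact: H.
Qed.

Lemma mprodD (S : nat -> 'M[R]_2) m n :
  mprod S (m + n) = mprod (fun i => S (m + i)%N) n *m mprod S m.
Proof.
by elim: n => [|n IH]; rewrite ?addn0 ?mul1mx // addnS /= IH mulmxA.
Qed.

Lemma det_mprod (S : nat -> 'M[R]_2) n :
  (forall i, (i < n)%N -> \det (S i) = 1) -> \det (mprod S n) = 1.
Proof.
elim: n => [_|n IH H] /=; first by rewrite det1.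
by rewrite det_mulmx H // IH ?mulr1 // => i /ltnW; exact: H.
Qed.

Definition dp v w : R := v 0 0 * w 0 0 + v 1 0 * w 1 0.

Lemma d2_trans v w z : w != 0 -> d2 v w = 0 -> d2 w z = 0 -> d2 v z = 0.
Proof.
move=> w0 vw wz; apply/eqP; apply: contraNT w0 => vz.
have e0 : d2 v z * w 0 0 = d2 w z * v 0 0 + d2 v w * z 0 0 by rewrite /d2; ring.
have e1 : d2 v z * w 1 0 = d2 w z * v 1 0 + d2 v w * z 1 0 by rewrite /d2; ring.
move: e0 e1; rewrite vw wz !mul0r addr0 => /eqP + /eqP.
rewrite !mulf_eq0 (negPf vz) /= => /eqP e0 /eqP e1.
by apply/eqP/col2P; rewrite ?e0 ?e1 mxE.
Qed.

Lemma d2_rotl (c s : R) a v : d2 (rotcs c s *m a) v = c * d2 a v - s * dp a v.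
Proof. rewrite /d2 /dp !mulmx2vE !mx2E; ring. Qed.

Lemma d2_rotr (c s : R) a v : d2 v (rotcs c s *m a) = c * d2 v a + s * dp a v.
Proof. rewrite /d2 /dp !mulmx2vE !mx2E; ring. Qed.

(** The hypothesis says that the angle from [a] to [v] is at most [2 arctan rho], written without
    division through [tan (2 arctan rho) = 2 rho / (1 - rho^2)]. *)
Lemma rot_reach (rho : R) a v : 0 < rho < 1 ->
  (1 - rho ^+ 2) * `|d2 a v| <= 2 * rho * dp a v ->
  exists2 r, `|r| <= rho & d2 v (rot r *m a) = 0.
Proof.
move=> /andP[r0 r1]; set al := d2 a v; set be := dp a v => H.
have [al0|al0] := eqVneq al 0.
  exists 0; first by rewrite normr0 ltW.
  by rewrite rot0 mul1mx; move: al0; rewrite /al /d2; lra.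
set n := Num.sqrt (al ^+ 2 + be ^+ 2).
have n2E : n ^+ 2 = al ^+ 2 + be ^+ 2 by rewrite sqr_sqrtr // addr_ge0 ?sqr_ge0.
have n0 : 0 <= n by exact: sqrtr_ge0.
have al_gt0 : 0 < `|al| by rewrite normr_gt0.
have r2 : 0 < 1 - rho ^+ 2 by nra.
have be0 : 0 < be.
  have : 0 < 2 * rho * be by apply: lt_le_trans H; rewrite mulr_gt0.
  by nra.
have nb : 0 < n + be by lra.
(* As [n] is the product of the two lengths, this is [sin / (1 + cos)], the tangent of half the
   angle, which is the parameter of [rot]. *)
exists (al / (n + be)).
  rewrite normrM normfV (gtr0_norm nb) ler_pdivrMr //.
  rewrite -subr_ge0 mulrDr.
  have [h|h] := lerP `|al| (rho * be); first by have := mulr_ge0 (ltW r0) n0; lra.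
  suff : `|al| - rho * be <= rho * n by lra.
  rewrite -(ler_pXn2r (_ : 0 < 2)%N) ?nnegrE ?mulr_ge0 ?(ltW r0) ?subr_ge0 ?(ltW h) //.
  rewrite exprMn n2E sqrrB real_normK ?num_real //.
  rewrite -[al ^+ 2](@real_normK _ al) ?num_real //.
  by have := ler_wpM2l (ltW al_gt0) H; rewrite !mulrDl; nra.
rewrite /rot d2_rotr /rcos /rsin -/be.
have -> : d2 v a = - al by rewrite /al /d2; ring.
have e : (n + be) ^+ 2 - al ^+ 2 = 2 * be * (n + be) by rewrite sqrrD n2E; ring.
apply/eqP; rewrite -(mulrI_eq0 _ (lregP _ : GRing.lreg (1 + (al / (n + be)) ^+ 2))); last first.
  exact: lt0r_neq0 (den_gt0 _).
apply/eqP.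
transitivity (- al * (((n + be) ^+ 2 - al ^+ 2) - 2 * be * (n + be)) / (n + be) ^+ 2).
  field; rewrite lt0r_neq0 //= lt0r_neq0 //.
  by rewrite ltr_pwDl ?exprn_gt0 ?sqr_ge0.
by rewrite e subrr mulr0 mul0r.
Qed.

Section ReachSeq.
Variables (rho : R) (S : nat -> 'M[R]_2) (u : 'cV[R]_2).
Hypothesis rho01 : 0 < rho < 1.
Hypothesis detS : forall i, \det (S i) = 1.
Hypothesis u0 : u != 0.

Definition rots (r : nat -> R) := fun i => rot (r i) *m S i.
(* [ua] and [ub] span the cone of directions reachable from [u]; the cone has wrapped around the
   whole projective line as soon as [d2 (ua i) (ub i) <= 0] for some [i > 0]. *)
Definition ua (i : nat) := mprod (rots (fun=> - rho)) i *m u.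
Definition ub (i : nat) := mprod (rots (fun=> rho)) i *m u.
Definition reach (i : nat) v := exists2 r : nat -> R,
  (forall j, `|r j| <= rho) & d2 v (mprod (rots r) i *m u) = 0.

Lemma det_rots r i : \det (rots r i) = 1.
Proof. by rewrite det_mulmx det_rot detS mulr1. Qed.

Lemma uaS i : ua i.+1 = rot (- rho) *m (S i *m ua i).
Proof. by rewrite /ua /= !mulmxA. Qed.

Lemma ubS i : ub i.+1 = rot rho *m (S i *m ub i).
Proof. by rewrite /ub /= !mulmxA. Qed.

Lemma reachS i w v r : reach i w -> w != 0 -> `|r| <= rho ->
  d2 v (rot r *m (S i *m w)) = 0 -> reach i.+1 v.
Proof.
move=> [r' r'le r'E] w0 rle rE.
exists (fun j => if j == i then r else r' j) => [j|]; first by case: ifP.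
rewrite /= /rots eqxx.
rewrite (@mprod_ext _ (rots r')); last first.
  by move=> j ji; rewrite /rots ltn_eqF.
rewrite -!mulmxA; apply: d2_trans rE _.
  by rewrite !mul_neq0 ?det_rot ?detS.
by rewrite !d2_mul r'E !mulr0.
Qed.

Lemma reach_pull i v : reach i (invmx (S i) *m v) -> reach i.+1 v.
Proof.
move=> H; have [->|v0] := eqVneq v 0.
  by exists (fun=> 0) => [j|]; rewrite ?normr0 ?(ltW (andP rho01).1)// /d2 !mxE !mul0r subrr.
apply: (reachS H (r := 0)); first by rewrite mul_neq0 // det_inv1.
  by rewrite normr0 ltW; case/andP: rho01.
by rewrite rot0 mul1mx mulmxV2v // /d2; ring.
Qed.

Lemma rsin_gt0 : 0 < rsin rho.
Proof. by case/andP: rho01 => h _; rewrite divr_gt0 ?mulr_gt0 ?den_gt0. Qed.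

Lemma rcos_gt0 : 0 < rcos rho.
Proof.
case/andP: rho01 => h h1; rewrite divr_gt0 ?den_gt0 // subr_gt0.
by rewrite expr_lt1 // ltW.
Qed.

(** The signs put [v] in the strip between the transported edge [S i *m ua i] and the new edge
    [ua i.+1]. The second sign, multiplied by [1 + rho ^+ 2], is the hypothesis of [rot_reach], so a
    last rotation of the transported edge reaches [v]. *)
Lemma reach_rotN i v : d2 (S i *m ua i) v <= 0 -> 0 <= d2 (ua i.+1) v ->
  reach i.+1 v.
Proof.
move=> h1 h2.
have /andP[rp rl1] := rho01.
have [] := @rot_reach rho (S i *m ua i) v rho01.
  move: h2; rewrite uaS /rot d2_rotl rcosN rsinN /rcos /rsin ler0_norm //.
  set x := d2 _ _; set y := dp _ _ => h2.
  have : 0 <= (1 + rho ^+ 2) * ((1 - rho ^+ 2) / (1 + rho ^+ 2) * x - - (2 * rho / (1 + rho ^+ 2)) * y).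
    by rewrite mulr_ge0 // ltW ?den_gt0.
  suff -> : (1 + rho ^+ 2) * ((1 - rho ^+ 2) / (1 + rho ^+ 2) * x - - (2 * rho / (1 + rho ^+ 2)) * y)
    = (1 - rho ^+ 2) * x + 2 * rho * y by lra.
  by field; exact: lt0r_neq0 (den_gt0 _).
move=> r rle rE; apply: (reachS _ _ rle rE); last by rewrite mul_neq0 // det_mprod // => *; exact: det_rots.
exists (fun=> - rho) => [_|]; first by rewrite normrN ger0_norm // ltW.
by rewrite /ua /d2; ring.
Qed.

Lemma reach_rotP i v : d2 v (S i *m ub i) <= 0 -> 0 <= d2 v (ub i.+1) ->
  reach i.+1 v.
Proof.
move=> h1 h2.
have /andP[rp rl1] := rho01.
have [] := @rot_reach rho (S i *m ub i) v rho01.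
  have -> : d2 (S i *m ub i) v = - d2 v (S i *m ub i) by rewrite /d2; ring.
  rewrite normrN.
  move: h2; rewrite ubS /rot d2_rotr /rcos /rsin ler0_norm //.
  set x := d2 _ _; set y := dp _ _ => h2.
  have : 0 <= (1 + rho ^+ 2) * ((1 - rho ^+ 2) / (1 + rho ^+ 2) * x + (2 * rho / (1 + rho ^+ 2)) * y).
    by rewrite mulr_ge0 // ltW ?den_gt0.
  suff -> : (1 + rho ^+ 2) * ((1 - rho ^+ 2) / (1 + rho ^+ 2) * x + (2 * rho / (1 + rho ^+ 2)) * y)
    = (1 - rho ^+ 2) * x + 2 * rho * y by lra.
  by field; exact: lt0r_neq0 (den_gt0 _).
move=> r rle rE; apply: (reachS _ _ rle rE); last by rewrite mul_neq0 // det_mprod // => *; exact: det_rots.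
exists (fun=> rho) => [_|]; first by rewrite ger0_norm // ltW.
by rewrite /ub /d2; ring.
Qed.

Lemma d2_pull i x v : d2 x (invmx (S i) *m v) = d2 (S i *m x) v.
Proof.
by rewrite -[in RHS](mulmxV2v v (detS i)) d2_mul detS mul1r.
Qed.

Lemma d2C v w : d2 v w = - d2 w v. Proof. rewrite /d2; ring. Qed.

(** The new cone is the image of the old one plus a strip along each edge; these are handled by
    [reach_pull], [reach_rotN] and [reach_rotP]. *)
Lemma reach_cone i v : 0 <= d2 (ua i) v -> 0 <= d2 v (ub i) -> reach i v.
Proof.
elim: i v => [|i IH] v h1 h2.
  exists (fun=> 0) => [j|]; first by rewrite normr0 ltW; case/andP: rho01.
  by move: h1 h2; rewrite /ua /ub /= mul1mx [d2 u v]d2C; lra.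
have [h3|h3] := lerP 0 (d2 (S i *m ua i) v); last exact: reach_rotN (ltW h3) h1.
have [h4|h4] := lerP 0 (d2 v (S i *m ub i)); last exact: reach_rotP (ltW h4) h2.
apply: reach_pull; apply: IH; first by rewrite d2_pull.
by rewrite d2C d2_pull -d2C.
Qed.

(** Lines have no sign, so [v] may be replaced by [- v]. When the opening passes a half turn, the
    image of the old cone and the two strips, up to sign, leave no direction out. *)
Lemma reach_turn i v : 0 < d2 (ua i) (ub i) -> d2 (ua i.+1) (ub i.+1) <= 0 ->
  reach i.+1 v.
Proof.
move=> hi hi1.
have reachN w : reach i.+1 (- w) -> reach i.+1 w.
  by move=> [r rle rE]; exists r => //; move: rE; rewrite /d2 !mxE; lra.
wlog h : v / 0 <= d2 (S i *m ua i) v.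
  move=> H; have [h|h] := lerP 0 (d2 (S i *m ua i) v); first exact: H.
  by apply: reachN; apply: H; move: h; rewrite /d2 !mxE; lra.
have [h4|h4] := lerP 0 (d2 v (S i *m ub i)).
  apply: reach_pull; apply: reach_cone; first by rewrite d2_pull.
  by rewrite d2C d2_pull -d2C.
have [h5|h5] := lerP 0 (d2 v (ub i.+1)); first exact: reach_rotP (ltW h4) h5.
have [h6|h6] := lerP (d2 (ua i.+1) v) 0.
  apply: reachN; apply: reach_rotN; first by move: h; rewrite /d2 !mxE; lra.
  by move: h6; rewrite /d2 !mxE; lra.
exfalso.
set a' := S i *m ua i in h *; set b' := S i *m ub i in h4 *.
have ab' : 0 < d2 a' b' by rewrite d2_mul detS mul1r.
have aa' : 0 < d2 (ua i.+1) a'.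
  rewrite uaS -/a' /rot d2_rotl rsinN.
  have -> : d2 a' a' = 0 by rewrite /d2; ring.
  have : 0 < n2 a'.
    by rewrite n2_gt0 !mul_neq0 // det_mprod // => *; exact: det_rots.
  by have := rsin_gt0; rewrite /n2 /dp; nra.
have bb' : 0 < d2 b' (ub i.+1).
  rewrite ubS -/b' /rot d2_rotr.
  have -> : d2 b' b' = 0 by rewrite /d2; ring.
  have : 0 < n2 b'.
    by rewrite n2_gt0 !mul_neq0 // det_mprod // => *; exact: det_rots.
  by have := rsin_gt0; rewrite /n2 /dp; nra.
(* Three-term Plucker relations between four vectors of the plane. [P1] gives [0 < d2 (ua i.+1) b'],
   and then [P2] forces [0 < d2 (ua i.+1) (ub i.+1)], against [hi1]. *)
have P1 : d2 (ua i.+1) b' * d2 v a' - d2 (ua i.+1) v * d2 b' a' +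
   d2 (ua i.+1) a' * d2 b' v = 0 by rewrite /d2; ring.
have P2 : d2 (ua i.+1) (ub i.+1) * d2 v b' - d2 (ua i.+1) v * d2 (ub i.+1) b' +
   d2 (ua i.+1) b' * d2 (ub i.+1) v = 0 by rewrite /d2; ring.
rewrite (d2C v a') (d2C b' a') (d2C b' v) (d2C (ub i.+1) b') (d2C (ub i.+1) v) in P1 P2.
have ab'' : 0 < d2 (ua i.+1) b' by nra.
by nra.
Qed.

(** After one step the opening is [4 arctan rho], less than a half turn because [rho < 1]. The first
    wrap thus has index at least 2, and [reach_turn] finds an open cone before it. *)
Lemma d2_ua1 : 0 < d2 (ua 1) (ub 1).
Proof.
rewrite uaS ubS /ua /ub /= !mul1mx.
set w := S 0%N *m u.
rewrite /rot d2_rotl rsinN rcosN d2_rotr.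
have -> : d2 w w = 0 by rewrite /d2; ring.
have -> : dp w (rotcs (rcos rho) (rsin rho) *m w) = rcos rho * n2 w.
  by rewrite /dp /n2 !mulmx2vE !mx2E; ring.
have w0 : 0 < n2 w by rewrite n2_gt0 mul_neq0.
have := mulr_gt0 rsin_gt0 rcos_gt0.
by rewrite /dp -!expr2 -/(n2 w) => h; have := mulr_gt0 h w0; nra.
Qed.

Lemma reach_full n : (exists i, (0 < i <= n)%N /\ d2 (ua i) (ub i) <= 0) ->
  forall v, reach n v.
Proof.
move=> [i [/andP[i0 le_in] hi]].
have [j [jn hj]] : exists j, (j <= n)%N /\ forall v, reach j v.
  pose P j := (0 < j)%N && (d2 (ua j) (ub j) <= 0).
  have exP : exists j, P j by exists i; rewrite /P i0 hi.
  case: (ex_minnP exP) => [[|[|j]]] /andP[// _ hj] jmin.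
    by have := d2_ua1; lra.
  exists j.+2; split; first by apply: leq_trans le_in; apply: jmin; rewrite /P i0 hi.
  move=> v; apply: reach_turn hj.
  rewrite ltNge; apply/negP => h.
  by have := jmin j.+1; rewrite /P h /= ltnn => /(_ isT).
rewrite -(subnKC jn); elim: (n - j)%N => [|k IH] v; first by rewrite addn0.
by rewrite addnS; apply: reach_pull.
Qed.

End ReachSeq.

(* Positive exactly inside the cone spanned by [a] and [b]. *)
Definition qf a b w : R := d2 a w * d2 w b / d2 a b.

(** [(c, s)] is the unit bisector of the cone and [t] the tangent of half its opening: [a] and [b]
    are positive multiples of the bisector minus and plus [t] times its quarter turn. *)
Lemma cone_frame a b : 0 < d2 a b -> exists l m t c s : R,
  [/\ 0 < l, 0 < m, 0 < t, c ^+ 2 + s ^+ 2 = 1 &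
      a = cv2 (l * (c + s * t)) (l * (s - c * t)) /\
      b = cv2 (m * (c - s * t)) (m * (s + c * t))].
Proof.
move=> ab.
have a0 : a != 0 by apply: contraTneq ab => ->; rewrite /d2 !mxE !mul0r subrr ltxx.
have b0 : b != 0 by apply: contraTneq ab => ->; rewrite /d2 !mxE !mulr0 subrr ltxx.
pose na := Num.sqrt (n2 a); pose nb := Num.sqrt (n2 b).
have na0 : 0 < na by rewrite sqrtr_gt0 n2_gt0.
have nb0 : 0 < nb by rewrite sqrtr_gt0 n2_gt0.
have na2 : na ^+ 2 = n2 a by rewrite sqr_sqrtr ?n2_ge0.
have nb2 : nb ^+ 2 = n2 b by rewrite sqr_sqrtr ?n2_ge0.
pose e0 := a 0 0 / na; pose e1 := a 1 0 / na.
pose f0 := b 0 0 / nb; pose f1 := b 1 0 / nb.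
have ee : e0 ^+ 2 + e1 ^+ 2 = 1.
  by rewrite /e0 /e1 !expr_div_n -mulrDl na2 divff // n2_eq0.
have ff : f0 ^+ 2 + f1 ^+ 2 = 1.
  by rewrite /f0 /f1 !expr_div_n -mulrDl nb2 divff // n2_eq0.
pose P := e0 * f0 + e1 * f1; pose D := e0 * f1 - e1 * f0.
have D0 : 0 < D.
  have -> : D = d2 a b / (na * nb).
    by rewrite /D /d2 /e0 /e1 /f0 /f1; field; rewrite !lt0r_neq0.
  by rewrite divr_gt0 ?mulr_gt0.
have PD : P ^+ 2 + D ^+ 2 = 1.
  by transitivity ((e0 ^+ 2 + e1 ^+ 2) * (f0 ^+ 2 + f1 ^+ 2)); [rewrite /P /D; ring|rewrite ee ff mulr1].
have P1 : 0 < 1 + P.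
  have D2 : 0 < D ^+ 2 by rewrite exprn_gt0.
  by nra.
pose k := Num.sqrt (2 * (1 + P)).
have k0 : 0 < k by rewrite sqrtr_gt0 mulr_gt0.
have k2 : k ^+ 2 = 2 * (1 + P) by rewrite sqr_sqrtr // ltW // mulr_gt0.
have kn : k != 0 by rewrite lt0r_neq0.
have pn : 1 + P != 0 by rewrite lt0r_neq0.
have Ef0 : P * e0 - D * e1 = f0.
  by rewrite -[RHS]mul1r -ee /P /D; ring.
have Ef1 : P * e1 + D * e0 = f1.
  by rewrite -[RHS]mul1r -ee /P /D; ring.
have Ee0 : P * f0 + D * f1 = e0.
  by rewrite -[RHS]mul1r -ff /P /D; ring.
have Ee1 : P * f1 - D * f0 = e1.
  by rewrite -[RHS]mul1r -ff /P /D; ring.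
have fin x y : 2 * (1 + P) * x = y -> x = y / k ^+ 2.
  by move=> <-; rewrite k2; field.
have PE : P = e0 * f0 + e1 * f1 by [].
clearbody P D k.
(* [P] and [D] are the cosine and sine of the opening, [k] is the length of the sum of the unit edge
   vectors, and [D / (1 + P)] is the tangent of half the opening. *)
exists (na * (1 + P) / k), (nb * (1 + P) / k), (D / (1 + P)), ((e0 + f0) / k), ((e1 + f1) / k).
split; rewrite ?divr_gt0 ?mulr_gt0 //.
  rewrite !expr_div_n -mulrDl k2 (_ : _ ^+ 2 + _ ^+ 2 = 2 * (1 + P)) ?divff ?mulf_neq0 ?pnatr_eq0 //.
  transitivity ((e0 ^+ 2 + e1 ^+ 2) + (f0 ^+ 2 + f1 ^+ 2) + 2 * P); last by rewrite ee ff; ring.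
  by rewrite PE; ring.
split; apply: col2P; rewrite ?cv2E.
- transitivity (na * e0); first by rewrite /e0; field; rewrite lt0r_neq0.
  transitivity (na * ((1 + P) * (e0 + f0) + D * (e1 + f1)) / k ^+ 2); last by field; rewrite kn pn.
  apply: fin; transitivity (na * (e0 + P * e0 + (f0 + D * e1) + (P * f0 + D * f1))); last by ring.
  by rewrite Ee0 -Ef0; ring.
- transitivity (na * e1); first by rewrite /e1; field; rewrite lt0r_neq0.
  transitivity (na * ((1 + P) * (e1 + f1) - D * (e0 + f0)) / k ^+ 2); last by field; rewrite kn pn.
  apply: fin; transitivity (na * (e1 + P * e1 + (f1 - D * e0) + (P * f1 - D * f0))); last by ring.
  by rewrite Ee1 -Ef1; ring.
- transitivity (nb * f0); first by rewrite /f0; field; rewrite lt0r_neq0.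
  transitivity (nb * ((1 + P) * (e0 + f0) - D * (e1 + f1)) / k ^+ 2); last by field; rewrite kn pn.
  apply: fin; transitivity (nb * (f0 + P * f0 + (e0 - D * f1) + (P * e0 - D * e1))); last by ring.
  by rewrite Ef0 -Ee0; ring.
- transitivity (nb * f1); first by rewrite /f1; field; rewrite lt0r_neq0.
  transitivity (nb * ((1 + P) * (e1 + f1) + D * (e0 + f0)) / k ^+ 2); last by field; rewrite kn pn.
  apply: fin; transitivity (nb * (f1 + P * f1 + (e1 + D * f0) + (P * e1 + D * e0))); last by ring.
  by rewrite Ef1 -Ee1; ring.
Qed.

(** In the bisector frame the form is [(t x^2 - y^2 / t) / 2]. Turning each edge outwards by the
    angle with sine [S] changes [t] into [(S + C t) / (C - S t)], and both coefficients gain at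
    least [S]. The widened cone is still below a half turn, whence [t <= S^-1], and the new tangent
    is at least [S]. *)
Lemma qf_widen (C S : R) a b w : 0 < C -> 0 < S -> C ^+ 2 + S ^+ 2 = 1 ->
  0 < d2 a b -> 0 < d2 (rotcs C (- S) *m a) (rotcs C S *m b) ->
  [/\ qf a b w + S / 2 * n2 w <= qf (rotcs C (- S) *m a) (rotcs C S *m b) w,
      qf a b w <= n2 w / (2 * S) &
      - (n2 w / (2 * S)) <= qf (rotcs C (- S) *m a) (rotcs C S *m b) w].
Proof.
move=> C0 S0 CS /cone_frame[l [m [t [c [s [l0 m0 t0 cs [-> ->]]]]]]].
set a'' := rotcs C (- S) *m _; set b'' := rotcs C S *m _.
pose x := c * w 0 0 + s * w 1 0; pose y := c * w 1 0 - s * w 0 0.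
pose p := S + C * t; pose q := C - S * t.
have nw : n2 w = x ^+ 2 + y ^+ 2.
  by transitivity ((c ^+ 2 + s ^+ 2) * n2 w); [rewrite cs mul1r|rewrite /n2 /x /y; ring].
have dab'' : d2 a'' b'' = 2 * l * m * p * q.
  transitivity ((c ^+ 2 + s ^+ 2) * (2 * l * m * p * q)); last by rewrite cs mul1r.
  by rewrite /d2 /a'' /b'' !mulmx2vE !mx2E !cv2E /p /q; ring.
have p0 : 0 < p by rewrite addr_gt0 ?mulr_gt0.
rewrite dab'' => h.
have q0 : 0 < q by move: h; rewrite pmulr_rgt0 // !mulr_gt0.
have E1 : qf a'' b'' w = (p / q * x ^+ 2 - q / p * y ^+ 2) / 2.
  rewrite /qf dab''.
  have -> : d2 a'' w = l * (q * y + p * x).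
    by rewrite /d2 /a'' !mulmx2vE !mx2E !cv2E /p /q /x /y; ring.
  have -> : d2 w b'' = m * (p * x - q * y).
    by rewrite /d2 /b'' !mulmx2vE !mx2E !cv2E /p /q /x /y; ring.
  by field; rewrite !lt0r_neq0.
have E2 : qf (cv2 (l * (c + s * t)) (l * (s - c * t))) (cv2 (m * (c - s * t)) (m * (s + c * t))) w
  = (t * x ^+ 2 - y ^+ 2 / t) / 2.
  rewrite /qf.
  have -> : d2 (cv2 (l * (c + s * t)) (l * (s - c * t))) (cv2 (m * (c - s * t)) (m * (s + c * t))) = 2 * t * l * m.
    transitivity ((c ^+ 2 + s ^+ 2) * (2 * t * l * m)); last by rewrite cs mul1r.
    by rewrite /d2 !cv2E; ring.
  have -> : d2 (cv2 (l * (c + s * t)) (l * (s - c * t))) w = l * (y + t * x).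
    by rewrite /d2 !cv2E /x /y; ring.
  have -> : d2 w (cv2 (m * (c - s * t)) (m * (s + c * t))) = m * (t * x - y).
    by rewrite /d2 !cv2E /x /y; ring.
  by field; rewrite !lt0r_neq0.
have x2 := sqr_ge0 x; have y2 := sqr_ge0 y.
have C1 : C <= 1 by nra.
have S1 : S <= 1 by nra.
have St : S * t <= 1 by rewrite /q in q0; lra.
have h1 : S <= p / q - t.
  have -> : p / q - t = S * (1 + t ^+ 2) / q by rewrite /p /q; field; exact: lt0r_neq0.
  rewrite ler_pdivlMr // ler_pM2l // /q.
  by have := mulr_gt0 S0 t0; have := sqr_ge0 t; lra.
have h2 : S <= t^-1 - q / p.
  have -> : t^-1 - q / p = S * (1 + t ^+ 2) / (t * p).
    by rewrite /p /q; field; rewrite !lt0r_neq0 //= lt0r_neq0.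
  rewrite ler_pdivlMr ?mulr_gt0 // ler_pM2l // /p.
  by have t2 := sqr_ge0 t; nra.
split.
- rewrite E1 E2 nw; have := ler_wpM2r x2 h1; have := ler_wpM2r y2 h2; lra.
- rewrite E2 nw invfM mulrA.
  have ht : t <= S^-1 by rewrite -[leRHS]mul1r ler_pdivlMr // mulrC.
  have := ler_wpM2r x2 ht; have : 0 <= y ^+ 2 / t by rewrite divr_ge0 // ltW.
  have : 0 <= y ^+ 2 / S by rewrite divr_ge0 // ltW.
  by rewrite !mulrDl; lra.
- rewrite E1 nw invfM mulrA.
  have ht : q / p <= S^-1.
    rewrite ler_pdivrMr // mulrC ler_pdivlMr //.
    by rewrite /q /p; have := mulr_gt0 S0 t0; have := mulr_gt0 C0 t0; nra.
  have := ler_wpM2r y2 ht.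
  have : 0 <= p / q * x ^+ 2 by rewrite mulr_ge0 // divr_ge0 // ltW.
  have : 0 <= x ^+ 2 / S by rewrite divr_ge0 // ltW.
  by rewrite !mulrDl; lra.
Qed.

Lemma qf_mul A a b w : \det A = 1 -> qf (A *m a) (A *m b) (A *m w) = qf a b w.
Proof. by move=> dA; rewrite /qf !d2_mul dA !mul1r. Qed.

Lemma qf_self a b : qf a b a = 0.
Proof. by rewrite /qf /d2 [X in X * _](_ : _ = 0) ?mul0r //; ring. Qed.

End Reach.

(** * Cancelling the growth of a product *)

Section Balance.
Context {R : realType}.
Implicit Types (A B : 'M[R]_2) (a b u v w : 'cV[R]_2).

Lemma hs1 : hs (1%:M : 'M[R]_2) = 2.
Proof. by rewrite /hs !mxE /= !expr1n !expr0n /=; ring. Qed.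

Lemma hs_mprod (S : nat -> 'M[R]_2) (H : R) n : (forall i, (i < n)%N -> hs (S i) <= H) ->
  hs (mprod S n) <= 2 * H ^+ n.
Proof.
elim: n => [_|n IH HS] /=; first by rewrite hs1 expr0 mulr1.
have H0 : 0 <= H by apply: le_trans (HS n _); rewrite ?hs_ge0.
apply: (le_trans (hs_mul _ _)); rewrite exprS mulrCA.
by apply: ler_pM; rewrite ?hs_ge0 ?HS ?IH // => i /ltnW; exact: HS.
Qed.

Lemma fro_mprod (S : nat -> 'M[R]_2) (M : R) n : (forall i, (i < n)%N -> fro (S i) <= M) ->
  fro (mprod S n) <= 2 * M ^+ n.
Proof.
elim: n => [_|n IH HS] /=.
  rewrite expr0 mulr1 /fro hs1.
  by rewrite -(ler_pXn2r (_ : 0 < 2)%N) ?nnegrE ?sqrtr_ge0 // sqr_sqrtr //; lra.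
have H0 : 0 <= M by apply: le_trans (HS n _); rewrite ?fro_ge0.
apply: (le_trans (fro_mul _ _)); rewrite exprS mulrCA.
by apply: ler_pM; rewrite ?fro_ge0 ?HS ?IH // => i /ltnW; exact: HS.
Qed.

Lemma mprod_dist (S S' : nat -> 'M[R]_2) (M e : R) n : 1 <= M -> 0 <= e ->
  (forall i, (i < n)%N -> [/\ fro (S i) <= M, fro (S' i) <= M & fro (S i - S' i) <= e]) ->
  fro (mprod S n - mprod S' n) <= n%:R * (2 * M ^+ n) * e.
Proof.
move=> M1 e0; elim: n => [_|n IH HS] /=.
  by rewrite subrr !mul0r /fro /hs !mxE expr0n /= !addr0 sqrtr0.
have M0 : 0 <= M by lra.
have [Sn S'n Dn] := HS n (ltnSn n).
have -> : S n *m mprod S n - S' n *m mprod S' n =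
  (S n - S' n) *m mprod S n + S' n *m (mprod S n - mprod S' n).
  by rewrite mulmxBl mulmxBr addrA subrK.
apply: (le_trans (fro_triangle _ _)).
have h1 : fro ((S n - S' n) *m mprod S n) <= e * (2 * M ^+ n).
  apply: (le_trans (fro_mul _ _)); apply: ler_pM; rewrite ?fro_ge0 //.
  by apply: fro_mprod => i /ltnW /HS[].
have h2 : fro (S' n *m (mprod S n - mprod S' n)) <= M * (n%:R * (2 * M ^+ n) * e).
  apply: (le_trans (fro_mul _ _)); apply: ler_pM; rewrite ?fro_ge0 //.
  by apply: IH => i /ltnW /HS.
have h3 : e * (2 * M ^+ n) <= M * (2 * M ^+ n * e).
  rewrite mulrC -[leLHS]mul1r ler_wpM2r // mulr_ge0 // mulr_ge0 // exprn_ge0 //.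
apply: (le_trans (lerD h1 h2)); apply: (le_trans (lerD h3 (lexx _))).
by rewrite le_eqVlt; apply/orP; left; apply/eqP; rewrite exprS -[in RHS]natr1; ring.
Qed.

Lemma n2D v w : n2 (v + w) <= 2 * n2 v + 2 * n2 w.
Proof.
rewrite /n2 !mxE; have := sqr_ge0 (v 0 0 - w 0 0); have := sqr_ge0 (v 1 0 - w 1 0).
by nra.
Qed.

Lemma big_column A : exists e : 'cV[R]_2, [/\ e != 0, n2 e = 1 & hs A <= 2 * n2 (A *m e)].
Proof.
have e10 : n2 (cv2 1 0 : 'cV[R]_2) = 1 by rewrite /n2 !cv2E expr1n expr0n addr0.
have e01 : n2 (cv2 0 1 : 'cV[R]_2) = 1 by rewrite /n2 !cv2E expr1n expr0n add0r.
have [h|h] := lerP (n2 (A *m cv2 1 0)) (n2 (A *m cv2 0 1)).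
  by exists (cv2 0 1); split => //; rewrite -?n2_gt0 ?e01 // hs_cols; lra.
by exists (cv2 1 0); split => //; rewrite -?n2_gt0 ?e10 // hs_cols; lra.
Qed.

Lemma par_scale u v : u != 0 -> d2 u v = 0 -> exists k : R, v = k *: u.
Proof.
move=> u0 uv; exists (dp u v / n2 u).
have nu : n2 u != 0 by rewrite n2_eq0.
apply: col2P; rewrite mxE; apply: (mulfI nu).
- rewrite mulrA [n2 u * (dp u v / _)]mulrC divfK //.
  transitivity (dp u v * u 0 0 - d2 u v * u 1 0); first by rewrite /n2 /dp /d2; ring.
  by rewrite uv; ring.
- rewrite mulrA [n2 u * (dp u v / _)]mulrC divfK //.
  transitivity (dp u v * u 1 0 + d2 u v * u 0 0); first by rewrite /n2 /dp /d2; ring.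
  by rewrite uv; ring.
Qed.

Lemma orth_decomp u x : u != 0 ->
  x = (dp u x / n2 u) *: u + (d2 u x / n2 u) *: cv2 (- u 1 0) (u 0 0).
Proof.
rewrite -n2_gt0 => nu0; apply: col2P; rewrite !mxE /=; apply: (mulfI (lt0r_neq0 nu0)).
  transitivity (dp u x * u 0 0 - d2 u x * u 1 0); first by rewrite /n2 /dp /d2; ring.
  by field; exact: lt0r_neq0.
transitivity (dp u x * u 1 0 + d2 u x * u 0 0); first by rewrite /n2 /dp /d2; ring.
by field; exact: lt0r_neq0.
Qed.

(** Up to constants, [u] is the direction most expanded by [P1] and [s] the one most contracted by
    [P2]. The part of [P1 *m z] along [u] is sent to [s] and shrunk by [P2], which gives
    [hs P1 / hs P2]. The part orthogonal to [u] is small because [P1] preserves area, and even the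
    full expansion of [P2] leaves only [hs P2 / hs P1]. *)
Lemma swap_directions (P1 P2 : 'M[R]_2) : \det P1 = 1 -> \det P2 = 1 ->
  exists u s : 'cV[R]_2, [/\ u != 0, s != 0 & forall W : 'M[R]_2, d2 s (W *m u) = 0 ->
    hs (P2 *m W *m P1) <= 8 * hs W * (hs P1 / hs P2 + hs P2 / hs P1)].
Proof.
move=> d1 d2_; have [e [e0 e1 eP]] := big_column P1.
have [f [f0 f1 fP]] := big_column (invmx P2).
exists (P1 *m e), (invmx P2 *m f).
set u := P1 *m e in eP *; set s := invmx P2 *m f in fP *.
have u0 : u != 0 by rewrite mul_neq0.
have s0 : s != 0 by rewrite mul_neq0 // det_inv1.
split=> // W Wus.
have [nu Wu] := par_scale s0 Wus.
have H1 : 0 < hs P1 by apply: lt_le_trans (hs_det1 d1).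
have H2 : 0 < hs P2 by apply: lt_le_trans (hs_det1 d2_).
have nu0 : 0 < n2 u by rewrite n2_gt0.
have ns0 : 0 < n2 s by rewrite n2_gt0.
rewrite hs_inv // in fP.
have key z : n2 z = 1 -> n2 (P2 *m W *m P1 *m z) <= 4 * hs W * (hs P1 / hs P2 + hs P2 / hs P1).
  move=> z1; rewrite -!mulmxA; set x := P1 *m z.
  pose ju := cv2 (- u 1 0) (u 0 0).
  have xE : x = (dp u x / n2 u) *: u + (d2 u x / n2 u) *: ju.
    exact: orth_decomp.
  rewrite xE !mulmxDr -!scalemxAr.
  apply: (le_trans (n2D _ _)); rewrite !n2Z.
  have P2s : P2 *m (W *m u) = nu *: f by rewrite Wu -scalemxAr mulmxV2v.
  rewrite P2s n2Z f1 mulr1.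
  have nuE : nu ^+ 2 = n2 (W *m u) / n2 s by rewrite Wu n2Z mulfK ?lt0r_neq0.
  have Wle : n2 (W *m u) <= hs W * n2 u := n2_mul_le W u.
  have xle : n2 x <= hs P1 by rewrite -[leRHS]mulr1 -z1 n2_mul_le.
  have dple : dp u x ^+ 2 <= n2 u * hs P1.
    apply: le_trans (ler_wpM2l (ltW nu0) xle).
    have -> : n2 u * n2 x = dp u x ^+ 2 + d2 u x ^+ 2 by rewrite /n2 /dp /d2; ring.
    by rewrite lerDl sqr_ge0.
  (* Area: [d2 u x = d2 e z] because [\det P1 = 1], and [e], [z] are unit vectors. *)
  have d2le : d2 u x ^+ 2 <= 1.
    by rewrite d2_mul d1 mul1r -[leRHS]mulr1 -{1}e1 -z1 d2_sqr_le.
  have nju : n2 ju = n2 u by rewrite /n2 !cv2E sqrrN addrC.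
  have juc : n2 (P2 *m (W *m ju)) <= hs P2 * (hs W * n2 u).
    apply: (le_trans (n2_mul_le _ _)); rewrite ler_wpM2l ?hs_ge0 //.
    by rewrite -nju n2_mul_le.
  have h1 : (dp u x / n2 u) ^+ 2 * nu ^+ 2 <= 2 * hs W * (hs P1 / hs P2).
    rewrite nuE expr_div_n.
    apply: (@le_trans _ _ ((n2 u * hs P1) / n2 u ^+ 2 * (hs W * n2 u / n2 s))).
      apply: ler_pM; rewrite ?divr_ge0 ?sqr_ge0 ?n2_ge0 //.
        by rewrite ler_wpM2r // invr_ge0 sqr_ge0.
      by rewrite ler_wpM2r // invr_ge0 n2_ge0.
    have -> : n2 u * hs P1 / n2 u ^+ 2 * (hs W * n2 u / n2 s) = hs W * (hs P1 / n2 s).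
      by field; rewrite !lt0r_neq0.
    rewrite [2 * _]mulrC -mulrA ler_wpM2l ?hs_ge0 // mulrCA ler_pM2l //.
    by rewrite -[leLHS]mul1r ler_pdivrMr // mulrAC ler_pdivlMr // mul1r.
  have h2 : (d2 u x / n2 u) ^+ 2 * n2 (P2 *m (W *m ju)) <= 2 * hs W * (hs P2 / hs P1).
    apply: (@le_trans _ _ (1 / n2 u ^+ 2 * (hs P2 * (hs W * n2 u)))).
      apply: ler_pM; rewrite ?sqr_ge0 ?n2_ge0 // expr_div_n.
      by rewrite ler_wpM2r // invr_ge0 sqr_ge0.
    have -> : 1 / n2 u ^+ 2 * (hs P2 * (hs W * n2 u)) = hs W * (hs P2 / n2 u).
      by field; rewrite !lt0r_neq0.
    rewrite [2 * _]mulrC -mulrA ler_wpM2l ?hs_ge0 // mulrCA ler_pM2l //.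
    by rewrite -[leLHS]mul1r ler_pdivrMr // mulrAC ler_pdivlMr // mul1r.
  by lra.
rewrite hs_cols.
have e10 : n2 (cv2 1 0 : 'cV[R]_2) = 1 by rewrite /n2 !cv2E expr1n expr0n addr0.
have e01 : n2 (cv2 0 1 : 'cV[R]_2) = 1 by rewrite /n2 !cv2E expr1n expr0n add0r.
by have := key _ e10; have := key _ e01; lra.
Qed.

Definition shift (k : nat) (S : nat -> 'M[R]_2) := fun i => S (k + i)%N.

(** The initial rotation [r0] lets [u] be moved first to a vector of the countable net. Inside a
    longer product it is absorbed by the matrix just before the block. *)
Definition flexible (rho : R) (m : nat) (S : nat -> 'M[R]_2) :=
  forall u s : 'cV[R]_2, u != 0 -> s != 0 -> exists2 r : nat -> R,
    (forall j, `|r j| <= rho) & exists2 r0 : R, `|r0| <= rho &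
    d2 s (mprod (rots S r) m *m rot r0 *m u) = 0.

Lemma rots0 (S : nat -> 'M[R]_2) n : mprod (rots S (fun=> 0)) n = mprod S n.
Proof. by apply: mprod_ext => i _; rewrite /rots rot0 mul1mx. Qed.

Lemma hs_le_mull A B : \det B = 1 -> hs A <= hs (A *m B) * hs B.
Proof.
move=> dB; rewrite -{1}[A]mulmx1 -(mulmxV (unitmx_det1 dB)) mulmxA -(hs_inv dB).
exact: hs_mul.
Qed.

Lemma hs_le_mulr A B : \det A = 1 -> hs B <= hs A * hs (A *m B).
Proof.
move=> dA; rewrite -{1}[B]mul1mx -(mulVmx (unitmx_det1 dA)) -mulmxA -(hs_inv dA).
exact: hs_mul.
Qed.

(* At the first time [k] where the past growth overtakes the future one the two are comparable;
   turning the direction most expanded by the past into the one most contracted by the future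
   makes them cancel, up to the cost of waiting for a flexible time. *)
Lemma balanced_perturbation (rho H : R) (S : nat -> 'M[R]_2) (N L m : nat) :
  0 <= rho -> 2 <= H -> (forall i, \det (S i) = 1) -> (forall i, hs (S i) <= H) ->
  (forall k, (k + L <= N)%N -> exists k', (k <= k' < k + L)%N /\ flexible rho m (shift k' S)) ->
  exists2 r : nat -> R, (forall j, `|r j| <= rho) &
    hs (mprod (rots S r) N) <= 256 * H ^+ (2 + 2 * L + 2 * m).
Proof.
move=> rho0 H2 dS HS flex.
have H0 : 0 <= H by lra.
have H1 : 1 <= H by lra.
have dmp k n : \det (mprod (shift k S) n) = 1 by apply: det_mprod => *; exact: dS.
have dmp0 n : \det (mprod S n) = 1 by apply: det_mprod => *; exact: dS.
pose f k := hs (mprod S k); pose g k := hs (mprod (shift k S) (N - k)).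
have bigH e c : (c <= 256)%N -> (e <= 2 + 2 * L + 2 * m)%N ->
    c%:R * H ^+ e <= 256 * H ^+ (2 + 2 * L + 2 * m).
  by move=> c1 ee; apply: ler_pM; rewrite ?exprn_ge0 ?ler_nat ?ler_weXn2l.
have exk : exists k, (k <= N)%N && (g k <= f k).
  by exists N; rewrite leqnn /g subnn /= hs1 hs_det1.
(* If the minimum is 0, the whole product has [hs] at most [f 0 = 2] and nothing is perturbed. *)
case: (ex_minnP exk) => -[|k1] /andP[kN gf] kmin.
  exists (fun=> 0); first by move=> j; rewrite normr0.
  rewrite rots0; move: gf; rewrite /g /f subn0 /= hs1 => gf.
  apply: (@le_trans _ _ (2 * H ^+ 0)); last exact: (bigH 0%N 2%N).
  by rewrite expr0 mulr1.
set k := k1.+1 in gf kN kmin *.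
have fg1 : f k1 < g k1.
  rewrite ltNge; apply/negP => h; have := kmin k1; rewrite h (ltnW kN) /= => /(_ isT).
  by rewrite ltnn.
have g_k1 : g k1 <= g k * H.
  rewrite /g (_ : N - k1 = 1 + (N - k))%N; last by rewrite /k; lia.
  rewrite mprodD; apply: (le_trans (hs_mul _ _)); apply: ler_pM; rewrite ?hs_ge0 //.
    rewrite (@mprod_ext _ _ (shift k S)) // => i _; rewrite /shift /k; congr (S _); lia.
  by rewrite /= mulmx1; exact: HS.
have f_k : f k <= H * f k1.
  by apply: (le_trans (hs_mul _ _)); rewrite ler_wpM2r ?hs_ge0.
(* One step before [k] the past was still smaller than the future, and one step costs at most a
   factor [H] on each side. Together with [gf], this makes [f k] and [g k] comparable. *)
have fgk : f k <= H ^+ 2 * g k.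
  have h : H * f k1 <= H * (g k * H) by rewrite ler_wpM2l //; lra.
  by rewrite expr2; lra.
(* Without room for waiting and turning, at most [L + m] matrices remain after [k]: the future is
   bounded, hence so are the past and the whole product. *)
have [kLm|kLm] := leqP (k + 1 + L + m) N; last first.
  exists (fun=> 0); first by move=> j; rewrite normr0.
  rewrite rots0.
  have -> : mprod S N = mprod (shift k S) (N - k) *m mprod S k.
    by rewrite -mprodD subnKC.
  apply: (le_trans (hs_mul _ _)); rewrite -/(g k) -/(f k).
  have gk : g k <= 2 * H ^+ (L + m).
    apply: (le_trans (hs_mprod (H := H) _)); first by move=> *; exact: HS.
    by rewrite ler_pM2l // ler_weXn2l //; lia.
  have g0 : 0 <= g k := hs_ge0 _.
  apply: (@le_trans _ _ (4 * H ^+ (2 + 2 * L + 2 * m))); last exact: (bigH _ 4%N).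
  apply: (@le_trans _ _ ((2 * H ^+ (L + m)) * (H ^+ 2 * (2 * H ^+ (L + m))))).
    apply: ler_pM; rewrite ?hs_ge0 //; apply: (le_trans fgk).
    by rewrite ler_wpM2l ?exprn_ge0.
  rewrite le_eqVlt; apply/orP; left; apply/eqP.
  rewrite (_ : 2 + 2 * L + 2 * m = 2 + (L + m) + (L + m))%N; last by lia.
  by rewrite !exprD; ring.
have [k' [/andP[kk' k'L] flexk']] := flex k.+1 ltac:(lia).
have k'N : (k' + m <= N)%N by lia.
have neq1 i : (k' + m + i == k'.-1)%N = false by clear -kk'; lia.
have neq2 i : (k' + i == k'.-1)%N = false by clear -kk'; lia.
have neq3 i : (k' <= k' + m + i < k' + m)%N = false by clear; lia.
have neq4 i : (i < k'.-1)%N -> (k' <= i < k' + m)%N = false by clear; lia.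
have lt5 i : (i < m)%N -> (k' <= k' + i < k' + m)%N by clear; lia.
have k'0 : (0 < k')%N by apply: leq_ltn_trans kk'.
have lt6 : (k' - k <= L)%N by clear -k'L; lia.
have lt7 : (k' + m - k <= L + m)%N by clear -k'L; lia.
have le8 : (k <= k')%N by exact: ltnW.
have eq9 : (N - k = (k' + m - k) + (N - (k' + m)))%N by clear -kk' k'N; lia.
have eq10 i : (k + (k' + m - k + i) = k' + m + i)%N by clear -kk'; lia.
pose P1 := mprod S k'; pose P2 := mprod (shift (k' + m) S) (N - (k' + m)).
have [u [s [u0 s0 swap]]] := swap_directions (dmp0 k') (dmp (k' + m)%N (N - (k' + m))%N).
have [r rle [r0 r0le rE]] := flexk' u s u0 s0.
pose W := mprod (rots (shift k' S) r) m *m rot r0.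
(* [r0] acts at time [k'.-1], just before the [m] turning steps; all other factors are left
   alone. *)
pose rr j := if j == k'.-1 then r0 else if (k' <= j < k' + m)%N then r (j - k')%N else 0.
exists rr => [j|].
  by rewrite /rr; case: ifP => // _; case: ifP => // _; rewrite normr0.
have -> : mprod (rots S rr) N = P2 *m W *m P1.
  rewrite -(subnKC k'N) mprodD [in LHS]mprodD /W /P2 -!mulmxA.
  congr (_ *m _).
    apply: mprod_ext => i _; rewrite /rots /shift /rr.
    by rewrite neq1 neq3 rot0 mul1mx.
  congr (_ *m _).
    apply: mprod_ext => i im; rewrite /rots /shift /rr.
    by rewrite neq2 lt5 // addKn.
  rewrite /P1 -(prednK k'0).
  rewrite /= {1}/rots {1}/rr eqxx -!mulmxA; congr (_ *m (_ *m _)).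
  apply: mprod_ext => i ik; rewrite /rots /rr.
  by rewrite (ltn_eqF ik) neq4 // rot0 mul1mx.
apply: (le_trans (swap W _)); first by rewrite -mulmxA in rE *.
have hsW : hs W <= 4 * H ^+ m.
  apply: (le_trans (hs_mul _ _)).
  have -> : hs (rot r0) = 2 by rewrite -[rot r0]mulmx1 hs_rot_mul hs1.
  have : hs (mprod (rots (shift k' S) r) m) <= 2 * H ^+ m.
    by apply: hs_mprod => i _; rewrite hs_rot_mul; exact: HS.
  by lra.
pose h1 := hs P1; pose h2 := hs P2.
have h1p : 0 < h1 by apply: lt_le_trans (hs_det1 (dmp0 _)).
have h2p : 0 < h2 by apply: lt_le_trans (hs_det1 (dmp _ _)).
have mid : hs (mprod (shift k S) (k' - k)) <= 2 * H ^+ L.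
  apply: (le_trans (hs_mprod (H := H) _)); first by move=> *; exact: HS.
  by rewrite ler_pM2l // ler_weXn2l.
have midm : hs (mprod (shift k S) (k' + m - k)) <= 2 * H ^+ (L + m).
  apply: (le_trans (hs_mprod (H := H) _)); first by move=> *; exact: HS.
  by rewrite ler_pM2l // ler_weXn2l.
have P1E : P1 = mprod (shift k S) (k' - k) *m mprod S k.
  by rewrite /P1 -mprodD subnKC.
have gE : mprod (shift k S) (N - k) = P2 *m mprod (shift k S) (k' + m - k).
  rewrite eq9 mprodD; congr (_ *m _).
  by apply: mprod_ext => i _; rewrite /shift eq10.
have f0 : 0 <= f k := hs_ge0 _.
have g0 : 0 <= g k := hs_ge0 _.
have A1 : h1 <= 2 * H ^+ L * f k.
  by rewrite /h1 P1E; apply: (le_trans (hs_mul _ _)); rewrite ler_wpM2r.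
have A2 : f k <= 2 * H ^+ L * h1.
  rewrite /h1 P1E; apply: (le_trans (hs_le_mulr _ (dmp k (k' - k)%N))).
  by rewrite ler_wpM2r ?hs_ge0.
have A3 : g k <= h2 * (2 * H ^+ (L + m)).
  by rewrite /g gE; apply: (le_trans (hs_mul _ _)); rewrite ler_wpM2l ?hs_ge0.
have A4 : h2 <= g k * (2 * H ^+ (L + m)).
  rewrite /g gE; apply: (le_trans (hs_le_mull _ (dmp k (k' + m - k)%N))).
  by rewrite ler_wpM2l ?hs_ge0.
pose E := H ^+ (2 + 2 * L + m).
have HL : 0 <= H ^+ L by rewrite exprn_ge0.
have HLm : 0 <= H ^+ (L + m) by rewrite exprn_ge0.
have B1 : h1 / h2 <= 4 * E.
  rewrite ler_pdivrMr //.
  apply: (le_trans A1).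
  apply: (@le_trans _ _ (2 * H ^+ L * (H ^+ 2 * (h2 * (2 * H ^+ (L + m)))))).
    rewrite ler_wpM2l ?mulr_ge0 //; apply: (le_trans fgk).
    by rewrite ler_wpM2l ?exprn_ge0.
  rewrite le_eqVlt; apply/orP; left; apply/eqP; rewrite /E.
  rewrite (_ : 2 + 2 * L + m = 2 + L + (L + m))%N; last by clear; lia.
  by rewrite !exprD; ring.
have B2 : h2 / h1 <= 4 * E.
  rewrite ler_pdivrMr //.
  apply: (le_trans A4).
  apply: (@le_trans _ _ ((2 * H ^+ L * h1) * (2 * H ^+ (L + m)))).
    by rewrite ler_wpM2r ?mulr_ge0 //; apply: (le_trans gf).
  apply: (@le_trans _ _ (4 * (H ^+ L * H ^+ (L + m)) * h1)).
    by rewrite le_eqVlt; apply/orP; left; apply/eqP; ring.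
  rewrite ler_pM2r // ler_pM2l // -exprD /E ler_weXn2l //; clear; lia.
(* The factor 8 is that of [swap_directions], [4 * H ^+ m] bounds [hs W], and [B1], [B2] bound the
   two ratios: [8 * 4 * 8 = 256]. *)
apply: (@le_trans _ _ (8 * (4 * H ^+ m) * (4 * E + 4 * E))).
  apply: ler_pM; rewrite ?mulr_ge0 ?hs_ge0 ?addr_ge0 ?divr_ge0 ?hs_ge0 //.
    by rewrite ler_pM2l.
  exact: lerD.
rewrite le_eqVlt; apply/orP; left; apply/eqP; rewrite /E.
rewrite (_ : 2 + 2 * L + 2 * m = 2 + 2 * L + m + m)%N; last by clear; lia.
by rewrite [in RHS]exprD; ring.
Qed.

(* A countable net of directions, which keeps the conditions below measurable. *)
Definition netv (pq : int * int) : 'cV[R]_2 := cv2 pq.1%:~R pq.2%:~R.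

(** Round [K u / |u|] to an integer vector, with [K = 2 + rho^-1]. The error is at most 1 in each
    coordinate, so, up to the length of [u], the sine part is at most 2 and the cosine part at least
    [K - 2 = rho^-1]; their quotient [2 rho] fits [rot_reach]. *)
Lemma netv_close (rho : R) u : 0 < rho < 1 -> u != 0 -> exists pq,
  netv pq != 0 /\ exists2 r, `|r| <= rho & d2 (netv pq) (rot r *m u) = 0.
Proof.
move=> rho01 u0; have /andP[rp r1] := rho01.
pose n := Num.sqrt (n2 u).
have n0 : 0 < n by rewrite sqrtr_gt0 n2_gt0.
have nn : n ^+ 2 = u 0 0 ^+ 2 + u 1 0 ^+ 2 by rewrite sqr_sqrtr ?n2_ge0.
pose K := 2 + rho^-1.
have rK : rho * (K - 2) = 1 by rewrite /K addrAC subrr add0r divff ?lt0r_neq0.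
have rV : 0 < rho^-1 by rewrite invr_gt0.
pose x := K * u 0 0 / n; pose y := K * u 1 0 / n.
pose p := Num.floor x; pose q := Num.floor y.
have := floor_itv x; rewrite -/p intrD => /andP[p1 p2].
have := floor_itv y; rewrite -/q intrD => /andP[q1 q2].
have xE : x * n = K * u 0 0 by rewrite /x divfK ?lt0r_neq0.
have yE : y * n = K * u 1 0 by rewrite /y divfK ?lt0r_neq0.
have un i : `|u i 0| <= n.
  rewrite -sqrtr_sqr ler_wsqrtr // /n2; elim/ord2P: i; rewrite ?lerDl ?lerDr sqr_ge0 //.
have xy : x * u 0 0 + y * u 1 0 = K * n.
  apply: (mulIf (lt0r_neq0 n0)); rewrite mulrDl.
  rewrite [_ * _ * n]mulrAC xE [_ * _ * n]mulrAC yE -[RHS]mulrA -expr2 nn; ring.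
have xy' : x * u 1 0 = y * u 0 0.
  by apply: (mulIf (lt0r_neq0 n0)); rewrite mulrAC xE [RHS]mulrAC yE; ring.
have ex : `|x - p%:~R| <= 1 by rewrite ger0_norm; lra.
have ey : `|y - q%:~R| <= 1 by rewrite ger0_norm; lra.
have bnd (a b : R) i : `|a - b| <= 1 -> `|(a - b) * u i 0| <= n.
  by move=> h; rewrite normrM -[n]mul1r ler_pM.
have dpE : (K - 2) * n <= dp u (netv (p, q)).
  rewrite /dp !cv2E /=.
  have := bnd x p%:~R 0 ex; have := bnd y q%:~R 1 ey.
  by rewrite !ler_norml => /andP[_ h1] /andP[_ h2]; lra.
have d2E : `|d2 u (netv (p, q))| <= 2 * n.
  rewrite /d2 !cv2E /=.
  have := bnd x p%:~R 1 ex; have := bnd y q%:~R 0 ey.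
  by rewrite !ler_norml => /andP[g1 h1] /andP[g2 h2]; apply/andP; split; lra.
have dp0 : 0 < dp u (netv (p, q)) by apply: lt_le_trans dpE; rewrite mulr_gt0 // /K; lra.
exists (p, q); split.
  by apply: contraTneq dp0 => ->; rewrite /dp !mxE !mulr0 addr0 ltxx.
apply: rot_reach => //.
apply: (@le_trans _ _ (1 * (2 * n))).
  apply: ler_pM => //; first by nra.
  by have := sqr_ge0 rho; lra.
have := ler_wpM2l (ltW rp) dpE; rewrite [rho * (_ * _)]mulrA rK; lra.
Qed.

Definition full (rho : R) (m : nat) (S : nat -> 'M[R]_2) (u : 'cV[R]_2) :=
  exists i, (0 < i <= m)%N /\ d2 (ua rho S u i) (ub rho S u i) <= 0.

Lemma full_flexible (rho : R) (m : nat) (S : nat -> 'M[R]_2) : 0 < rho < 1 ->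
  (forall i, \det (S i) = 1) ->
  (forall pq, netv pq != 0 -> full rho m S (netv pq)) -> flexible rho m S.
Proof.
move=> rho01 dS fullS u s u0 s0.
have [pq [d0 [r0 r0le r0E]]] := netv_close rho01 u0.
have [r rle rE] := reach_full rho01 dS d0 (fullS pq d0) s.
exists r => //; exists r0 => //.
rewrite -mulmxA; apply: d2_trans rE _; last by rewrite d2_mul r0E mulr0.
by rewrite mul_neq0 // det_mprod // => i _; exact: det_rots.
Qed.

End Balance.

(** * Hyperbolicity from monotone forms *)

Section Windows.
Context {R : realType}.
Implicit Types (A B : 'M[R]_2) (u v w : 'cV[R]_2) (S : nat -> 'M[R]_2).

(* Indefinite forms, uniformly bounded and uniformly increasing along the sequence; they need not
   be quadratic for what follows. *)
Definition lyapforms (c C : R) S (n : nat) := exists q : nat -> 'cV[R]_2 -> R,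
  [/\ forall i v, (i <= n)%N -> `|q i v| <= C * n2 v,
      forall i v, (i < n)%N -> q i v + c * n2 v <= q i.+1 (S i *m v) &
      forall i, (i <= n)%N -> exists2 v, v != 0 & q i v = 0].

Lemma eq_lyapforms c C S S' n : (forall i, (i < n)%N -> S i = S' i) ->
  lyapforms c C S n -> lyapforms c C S' n.
Proof.
by move=> SS' [q [q1 q2 q3]]; exists q; split=> // i v ni; rewrite -SS' // q2.
Qed.

(** The form [qf] of the growing cone is transported unchanged by [S i] ([qf_mul]) and increased by
    the rotation of the edges ([qf_widen]). Its lower bound comes from the widening that produced
    it, its upper bound from the one that follows, hence a spare step at the end. Indices start at 2
    because the cone at 0 is degenerate and the one at 1 is not the widening of an open cone. *)
Lemma notfull_lyapforms (rho H : R) S (u : 'cV[R]_2) n : 0 < rho < 1 -> 1 <= H ->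
  (forall i, \det (S i) = 1) -> (forall i, hs (S i) <= H) -> u != 0 ->
  ~ full rho (n + 3) S u ->
  lyapforms (rsin rho / 2 / H) (H / (2 * rsin rho)) (shift 2 S) n.
Proof.
move=> rho01 H1 dS HS u0 nf.
have s0 := rsin_gt0 rho01; have c0 := rcos_gt0 rho01; have cs := rcs1 rho.
have H0 : 0 < H by lra.
have i0 : 0 <= (2 * rsin rho)^-1 by rewrite invr_ge0 mulr_ge0 // ltW.
have s2 : 0 <= rsin rho / 2 by rewrite ltW // divr_gt0.
have pos i : (0 < i <= n + 3)%N -> 0 < d2 (ua rho S u i) (ub rho S u i).
  by move=> hi; rewrite ltNge; apply/negP => h; apply: nf; exists i.
have rN : rot (- rho) = rotcs (rcos rho) (- rsin rho) by rewrite /rot rcosN rsinN.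
have step i w : (0 < i)%N -> (i < n + 3)%N ->
  [/\ qf (S i *m ua rho S u i) (S i *m ub rho S u i) w + rsin rho / 2 * n2 w <=
        qf (ua rho S u i.+1) (ub rho S u i.+1) w,
      qf (S i *m ua rho S u i) (S i *m ub rho S u i) w <= n2 w / (2 * rsin rho) &
      - (n2 w / (2 * rsin rho)) <= qf (ua rho S u i.+1) (ub rho S u i.+1) w].
  move=> ip i3; rewrite uaS ubS rN; apply: qf_widen => //.
    by rewrite d2_mul dS mul1r pos // ip ltnW.
  by rewrite -rN -uaS -/(rot rho) -ubS pos // i3.
exists (fun i => qf (ua rho S u (2 + i)%N) (ub rho S u (2 + i)%N)); split.
- move=> i v ni; rewrite ler_norml; apply/andP; split.
    have [_ _ h] := step i.+1 v isT ltac:(lia).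
    rewrite (_ : (2 + i)%N = i.+2) //; apply: le_trans h.
    rewrite lerN2 mulrAC ler_wpM2r //.
    by rewrite ler_peMl ?n2_ge0.
  have [_ h _] := step (2 + i)%N (S (2 + i)%N *m v) isT ltac:(lia).
  rewrite qf_mul // in h; apply: (le_trans h).
  rewrite [leRHS]mulrAC ler_wpM2r //.
  by apply: (le_trans (n2_mul_le _ _)); rewrite ler_wpM2r ?n2_ge0.
- move=> i v ni; rewrite /shift addnS.
  have [h _ _] := step (2 + i)%N (S (2 + i)%N *m v) isT ltac:(lia).
  rewrite qf_mul // in h; apply: le_trans h; rewrite lerD2l -[leLHS]mulrA.
  rewrite ler_wpM2l // ler_pdivrMl //.
  by apply: (le_trans (n2_mul_ge v (dS (2 + i)%N))); rewrite ler_wpM2r ?n2_ge0.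
- move=> i ni; exists (ua rho S u (2 + i)%N); last exact: qf_self.
  by rewrite mul_neq0 // det_mprod // => j _; exact: det_rots.
Qed.

(** Backwards in time the opposite forms increase. The gain was measured at the start of the forward
    step, which is now the end point, whence the loss of a factor [H]. *)
Lemma lyapforms_rev c C (H : R) S n : 0 <= c -> 1 <= H ->
  (forall i, \det (S i) = 1) -> (forall i, hs (S i) <= H) ->
  lyapforms c C S n -> lyapforms (c / H) C (fun i => invmx (S (n - i.+1)%N)) n.
Proof.
move=> c0 H1 dS HS [q [q1 q2 q3]].
have H0 : 0 < H by lra.
exists (fun i v => - q (n - i)%N v); split=> [i v ni|i v ni|i ni].
- by rewrite normrN q1 // leq_subr.
- set w := invmx _ *m v.
  have := q2 (n - i.+1)%N w ltac:(lia).
  rewrite mulmxV2v // (_ : (n - i.+1).+1 = (n - i)%N); last by lia.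
  suff : c / H * n2 v <= c * n2 w by lra.
  rewrite -mulrA ler_wpM2l // ler_pdivrMl //.
  apply: le_trans (_ : hs (S (n - i.+1)%N) * n2 w <= _).
    by rewrite -{1}(mulmxV2v v (dS (n - i.+1)%N)) n2_mul_le.
  by rewrite ler_wpM2r ?n2_ge0.
- have [v v0 vq] := q3 (n - i)%N (leq_subr _ _).
  by exists v => //; rewrite vq oppr0.
Qed.

Lemma exists_nat_gt (a : R) : exists n : nat, a < n%:R.
Proof.
exists (Num.truncn `|a|).+1; apply: (le_lt_trans (ler_norm _)); exact: truncnS_gt.
Qed.

Lemma pow_big (k a K : R) : 0 < k -> 0 < a -> exists n0, forall n, (n0 <= n)%N ->
  K < a * (1 + k) ^+ n.
Proof.
move=> k0 a0.
have bern n : 1 + n%:R * k <= (1 + k) ^+ n.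
  elim: n => [|n IH]; first by rewrite mul0r addr0 expr0.
  rewrite exprS -natr1; have := ler_wpM2l (_ : 0 <= 1 + k) IH; move=> /(_ ltac:(lra)).
  have : 0 <= n%:R * k ^+ 2 by rewrite mulr_ge0 ?sqr_ge0.
  by nra.
have [n0 Hn0] := exists_nat_gt (K / a / k).
exists n0 => n nn.
rewrite -ltr_pdivrMl //; apply: lt_le_trans (bern n).
rewrite ltr_pdivrMr // in Hn0.
rewrite mulrC; apply: (lt_trans Hn0).
apply: (@le_lt_trans _ _ (n%:R * k)); last by rewrite ltrDr.
by rewrite ler_pM2r // ler_nat.
Qed.

Lemma pow_small (t a K : R) : 0 < t < 1 -> 0 < a -> exists n0, forall n, (n0 <= n)%N ->
  K * t ^+ n < a.
Proof.
move=> /andP[t0 t1] a0.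
have [n0 Hn0] := @pow_big (t^-1 - 1) a K ltac:(by rewrite subr_gt0 invf_gt1) a0.
exists n0 => n /Hn0; rewrite addrC subrK exprVn ltr_pdivlMr ?exprn_gt0 //.
Qed.

(** The stable line, defined by boundedness alone: it is then visibly a subspace and involves no
    choice of forms. Exponential contraction is recovered in [bdd_contract]. *)
Definition bddorbit (S : nat -> 'M[R]_2) : set 'cV[R]_2 :=
  [set v | exists K : R, forall n, n2 (mprod S n *m v) <= K].

Lemma n20 : n2 (0 : 'cV[R]_2) = 0.
Proof. by rewrite /n2 !mxE expr0n addr0. Qed.

Lemma bddorbit_subspace S : Defs.subspace (bddorbit S).
Proof.
split; last split.
- by exists (0 : R) => n; rewrite mulmx0 n20.
- move=> v w [K vK] [L wL]; exists (2 * K + 2 * L) => n.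
  rewrite mulmxDr; apply: (le_trans (n2D _ _)).
  by rewrite lerD // ler_pM2l.
- move=> a v [K vK]; exists (a ^+ 2 * K) => n.
  by rewrite -scalemxAr n2Z ler_wpM2l ?sqr_ge0.
Qed.

Section Forward.
Variables (c C : R) (S : nat -> 'M[R]_2).
Hypothesis (cC : 0 < c < C).
Hypothesis dS : forall i, \det (S i) = 1.

Let ck : R := c / C.
Let t2 : R := 1 - c / C.

Lemma cpos : 0 < c. Proof. by case/andP: cC. Qed.
Lemma Cpos : 0 < C. Proof. by case/andP: cC => h1 h2; apply: lt_trans h2. Qed.
Lemma ck_gt0 : 0 < ck. Proof. by rewrite divr_gt0 ?cpos ?Cpos. Qed.
Lemma t2_01 : 0 < t2 < 1.
Proof.
rewrite /t2 subr_gt0 ltr_pdivrMr ?Cpos // mul1r (andP cC).2 /=.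
by have := ck_gt0; rewrite /ck; lra.
Qed.

(** The forms increase, so [q <= 0] at time [j.+1] gives it at all earlier times. There [- q] is at
    most [C * n2], so each gain [c * n2] shrinks it by the factor [1 - c / C]. The increment from
    [j] to [j.+1] turns the bound on [- q] into one on the norm. *)
Lemma window_contract n v j (q : nat -> 'cV[R]_2 -> R) : (j < n)%N ->
  (forall i v, (i <= n)%N -> `|q i v| <= C * n2 v) ->
  (forall i v, (i < n)%N -> q i v + c * n2 v <= q i.+1 (S i *m v)) ->
  q j.+1 (mprod S j.+1 *m v) <= 0 ->
  n2 (mprod S j *m v) <= C / c * t2 ^+ j * n2 v.
Proof.
move=> jn q1 q2 qj.
pose f i := q i (mprod S i *m v).
have fS i : (i < n)%N -> f i + c * n2 (mprod S i *m v) <= f i.+1.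
  by move=> ni; rewrite /f /= -mulmxA; exact: q2.
have fle i : (i <= j.+1)%N -> f i <= 0.
  move=> ij; rewrite -(subKn ij); elim: (j.+1 - i)%N (leq_subr i j.+1) => [|k IH] kj.
    by rewrite subn0.
  have := fS (j.+1 - k.+1)%N ltac:(lia).
  rewrite (_ : (j.+1 - k.+1).+1 = j.+1 - k)%N; last by lia.
  have := IH ltac:(lia); have := mulr_ge0 (ltW cpos) (n2_ge0 (mprod S (j.+1 - k.+1) *m v)).
  by lra.
have fC i : (i <= n)%N -> - f i <= C * n2 (mprod S i *m v).
  by move=> ni; have := q1 i (mprod S i *m v) ni; rewrite ler_norml => /andP[]; rewrite -/(f i); lra.
have fdec i : (i <= j)%N -> - f i <= t2 ^+ i * (C * n2 v).
  elim: i => [_|i IH ij]; first by rewrite expr0 mul1r; have := fC 0%N isT; rewrite /= mul1mx.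
  have h0 := IH (ltnW ij); have h1 := fS i ltac:(lia); have h2 := fC i ltac:(lia).
  have h3 : ck * - f i <= c * n2 (mprod S i *m v).
    apply: (le_trans (ler_wpM2l (ltW ck_gt0) h2)).
    by rewrite mulrA /ck divfK ?lt0r_neq0 ?Cpos.
  have h4 : t2 * - f i <= t2 * (t2 ^+ i * (C * n2 v)).
    by rewrite ler_wpM2l // ltW //; case/andP: t2_01.
  rewrite exprS -mulrA; apply: le_trans h4; rewrite /t2 mulrBl mul1r -/ck; lra.
have h1 := fS j jn; have h2 := fdec j (leqnn _); have h3 := fle j.+1 (leqnn _).
rewrite -[leRHS]mulrA mulrAC ler_pdivlMr ?cpos //.
by move: h2; rewrite mulrCA; lra.
Qed.

(** A nonnegative form is at least [c * n2] one step later, and from then on [q <= C * n2] makes it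
    grow by the factor [1 + c / C] at each step. *)
Lemma window_expand n v i k (q : nat -> 'cV[R]_2 -> R) :
  (forall i v, (i <= n)%N -> `|q i v| <= C * n2 v) ->
  (forall i v, (i < n)%N -> q i v + c * n2 v <= q i.+1 (S i *m v)) ->
  (i + k.+1 <= n)%N -> 0 <= q i (mprod S i *m v) ->
  c * n2 (mprod S i *m v) * (1 + ck) ^+ k <= C * n2 (mprod S (i + k.+1) *m v).
Proof.
move=> q1 q2 ikn qi.
pose f i := q i (mprod S i *m v).
have fS i' : (i' < n)%N -> f i' + c * n2 (mprod S i' *m v) <= f i'.+1.
  by move=> ni; rewrite /f /= -mulmxA; exact: q2.
have fC i' : (i' <= n)%N -> f i' <= C * n2 (mprod S i' *m v).
  by move=> ni; have := q1 i' (mprod S i' *m v) ni; rewrite ler_norml => /andP[]; rewrite -/(f i'); lra.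
apply: le_trans (fC _ ikn).
elim: k ikn => [|k IH] ikn.
  rewrite expr0 mulr1 addn1; have := fS i ltac:(lia); rewrite -/(f i) in qi; lra.
have h0 := IH ltac:(lia).
have h1 := fS (i + k.+1)%N ltac:(lia); have h2 := fC (i + k.+1)%N ltac:(lia).
rewrite (addnS i k.+1); apply: le_trans h1.
have h3 : ck * f (i + k.+1)%N <= c * n2 (mprod S (i + k.+1) *m v).
  apply: (le_trans (ler_wpM2l (ltW ck_gt0) h2)).
  by rewrite mulrA /ck divfK ?lt0r_neq0 ?Cpos.
have h4 : (1 + ck) * (c * n2 (mprod S i *m v) * (1 + ck) ^+ k) <= (1 + ck) * f (i + k.+1)%N.
  by rewrite ler_wpM2l //; have := ck_gt0; lra.
rewrite exprS mulrCA; apply: (le_trans h4); rewrite mulrDl mul1r; lra.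
Qed.

Hypothesis forms : forall n, lyapforms c C S n.

(** On a long enough window, a positive form at time [j.+1] would push the orbit beyond its bound,
    by [window_expand]. So the form is nonpositive there and [window_contract] applies; the window
    depends on [v] and [j]. *)
Lemma bdd_contract v : bddorbit S v -> forall j, n2 (mprod S j *m v) <= C / c * t2 ^+ j * n2 v.
Proof.
move=> [K vK] j.
have [->|v0] := eqVneq v 0.
  by rewrite mulmx0 n20 mulr0.
pose a := c * n2 (mprod S j.+1 *m v).
have a0 : 0 < a by rewrite mulr_gt0 ?cpos // n2_gt0 mul_neq0 // det_mprod.
have [k0 Hk0] := @pow_big ck a (C * K) ck_gt0 a0.
pose n := (j.+1 + k0.+1)%N.
have [q [q1 q2 q3]] := forms n.
have [h|h] := lerP (q j.+1 (mprod S j.+1 *m v)) 0.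
  by apply: (window_contract _ q1 q2 h); rewrite /n; lia.
have := @window_expand n v j.+1 k0 q q1 q2 (leqnn _) (ltW h).
have := Hk0 k0 (leqnn _); rewrite -/a => h1 h2.
have := ler_wpM2l (ltW Cpos) (vK n); rewrite -/n in h2; lra.
Qed.

(** Once the orbit exceeds [C / c * n2 v] at time [j], contraction is excluded, so the forms of
    every longer window are positive at [j.+1]. Thus [a] and the starting time serve all [n]. *)
Lemma not_bdd_grow v : ~ bddorbit S v -> exists2 a : R, 0 < a &
  exists j, forall n, a * (1 + ck) ^+ n <= n2 (mprod S (j + n) *m v).
Proof.
move=> nb.
have [j Hj] : exists j, C / c * n2 v < n2 (mprod S j *m v).
  apply: contrapT => h; apply: nb; exists (C / c * n2 v) => n.
  by rewrite leNgt; apply/negP => h2; apply: h; exists n.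
have v0 : v != 0.
  apply: contraPneq nb => -> h; apply: h; exists 0 => n.
  by rewrite mulmx0 n20.
exists (c / C * n2 (mprod S j.+1 *m v)).
  by rewrite mulr_gt0 ?ck_gt0 // n2_gt0 mul_neq0 // det_mprod.
exists j.+2 => n.
have [q [q1 q2 q3]] := forms (j.+2 + n).
have [h|h] := lerP (q j.+1 (mprod S j.+1 *m v)) 0.
  have := window_contract (ltac:(lia) : (j < j.+2 + n)%N) q1 q2 h.
  suff : C / c * t2 ^+ j * n2 v <= C / c * n2 v by lra.
  rewrite ler_wpM2r ?n2_ge0 // ler_piMr ?divr_ge0 ?(ltW Cpos) ?(ltW cpos) //.
  by case/andP: t2_01 => t0 t1; rewrite exprn_ile1 ?ltW.
have := @window_expand _ v j.+1 n q q1 q2 ltac:(lia) (ltW h).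
rewrite (_ : j.+1 + n.+1 = j.+2 + n)%N; last by lia.
move=> h2; rewrite -(ler_pM2l Cpos); move: h2.
set X := n2 (mprod S j.+1 *m v); set Y := (1 + ck) ^+ n.
by have -> : C * (c / C * X * Y) = c * X * Y by field; exact: lt0r_neq0 Cpos.
Qed.

(** Two charts which, for [|x| <= 1], cover the projective line by two compact intervals. *)
Let slopev (b : bool) (x : R) : 'cV[R]_2 := if b then cv2 1 x else cv2 x 1.

Lemma n2_slope_continuous b A : continuous (fun x => n2 (A *m slopev b x)).
Proof.
have E : (fun x => n2 (A *m slopev b x)) = fun x =>
  if b then hs A - (A 0 1 ^+ 2 + A 1 1 ^+ 2) + x * (2 * (A 0 0 * A 0 1 + A 1 0 * A 1 1) + x * (A 0 1 ^+ 2 + A 1 1 ^+ 2))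
  else hs A - (A 0 0 ^+ 2 + A 1 0 ^+ 2) + x * (2 * (A 0 0 * A 0 1 + A 1 0 * A 1 1) + x * (A 0 0 ^+ 2 + A 1 0 ^+ 2)).
  apply/funext => x; case: (b); rewrite /n2 /hs !mulmx2vE /slopev !cv2E; ring.
rewrite E => x; case: b {E}.
all: apply: cvgD; first exact: cvg_cst.
all: apply: cvgM; first exact: cvg_id.
all: apply: cvgD; first exact: cvg_cst.
all: apply: cvgM; [exact: cvg_id|exact: cvg_cst].
Qed.

(** In a window of length [n], pull back to time 0 a zero of the last form: the forms are
    nonpositive along its orbit, so it contracts up to time [n]. The contraction inequality is
    closed and directions form a compact set, so a cluster point contracts at all times. *)
Lemma exists_bdd : exists2 v, v != 0 & bddorbit S v.
Proof.
pose good n v := forall j, (j < n)%N -> n2 (mprod S j *m v) <= C / c * t2 ^+ j * n2 v.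
have ex1 n : exists2 v, v != 0 & good n v.
  have [q [q1 q2 q3]] := forms n.
  have [z z0 qz] := q3 n (leqnn _).
  have dn : \det (mprod S n) = 1 by exact: det_mprod.
  pose v := invmx (mprod S n) *m z.
  have v0 : v != 0 by rewrite mul_neq0 // det_inv1.
  exists v => // j jn.
  have fmon i : (i <= n)%N -> q i (mprod S i *m v) <= 0.
    move=> ni; rewrite -(subKn ni); elim: (n - i)%N (leq_subr i n) => [|k IH] kj.
      by rewrite subn0 mulmxV2v // qz.
    have := q2 (n - k.+1)%N (mprod S (n - k.+1) *m v) ltac:(lia).
    rewrite mulmxA -/(mprod S (n - k.+1).+1) (_ : (n - k.+1).+1 = n - k)%N; last by lia.
    have := IH ltac:(lia); have := mulr_ge0 (ltW cpos) (n2_ge0 (mprod S (n - k.+1) *m v)).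
    by lra.
  by apply: (window_contract jn q1 q2); apply: fmon.
have goodZ n v (k : R) : k != 0 -> good n (k *: v) -> good n v.
  move=> k0 g j jn; have := g j jn; rewrite -scalemxAr !n2Z [leRHS]mulrCA.
  by rewrite ler_pM2l // lt_neqAle sqr_ge0 andbT eq_sym sqrf_eq0.
have ex2 n : exists b x, `|x| <= 1 /\ good n (slopev b x).
  have [v v0 gv] := ex1 n.
  have [h|h] := lerP `|v 1 0| `|v 0 0|.
    have v00 : v 0 0 != 0.
      apply: contraNneq v0 => e; apply/eqP/col2P; rewrite mxE //.
      by apply/eqP; rewrite -normr_le0; apply: (le_trans h); rewrite e normr0.
    exists true, (v 1 0 / v 0 0); split.
      by rewrite normrM normfV ler_pdivrMr ?normr_gt0 // mul1r.
    apply: (goodZ n _ (v 0 0)) => //; suff -> : v 0 0 *: slopev true (v 1 0 / v 0 0) = v by [].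
    by apply: col2P; rewrite mxE cv2E ?mulr1 // mulrC divfK.
  have v10 : v 1 0 != 0 by rewrite -normr_gt0; apply: le_lt_trans h.
  exists false, (v 0 0 / v 1 0); split.
    by rewrite normrM normfV ler_pdivrMr ?normr_gt0 // mul1r ltW.
  apply: (goodZ n _ (v 1 0)) => //; suff -> : v 1 0 *: slopev false (v 0 0 / v 1 0) = v by [].
  by apply: col2P; rewrite mxE cv2E ?mulr1 // mulrC divfK.
have goodW m n v : (m <= n)%N -> good n v -> good m v.
  by move=> mn g j jm; apply: g; apply: leq_trans mn.
(* The condition weakens as [n] decreases, so one of the two charts serves every [n]. *)
have [b Hb] : exists b, forall n, exists x, `|x| <= 1 /\ good n (slopev b x).
  apply: contrapT => H.
  have H' b : exists n, ~ exists x, `|x| <= 1 /\ good n (slopev b x).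
    by apply: contrapT => h; apply: H; exists b => n; apply: contrapT => h2; apply: h; exists n.
  have [n1 Hn1] := H' true; have [n2_ Hn2] := H' false.
  have [b [x [x1 g]]] := ex2 (maxn n1 n2_).
  case: b g => g; [apply: Hn1|apply: Hn2]; exists x; split=> //; apply: goodW g.
    exact: leq_maxl.
  exact: leq_maxr.
have [x Hx] := choice Hb.
have xin : (x @ \oo) (`[-1, 1]%classic : set R).
  by exists 0%N => // n _ /=; rewrite in_itv /= -ler_norml; case: (Hx n).
have [p [_ clp]] := @segment_compact R (-1) 1 (x @ \oo) _ xin.
exists (slopev b p).
  by apply/eqP => /matrixP e; case: b {Hb Hx clp} e => e;
     [have := e 0 0|have := e 1 0]; rewrite !mxE /= => /eqP; rewrite oner_eq0.
exists (C / c * n2 (slopev b p)) => j.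
suff : n2 (mprod S j *m slopev b p) <= C / c * t2 ^+ j * n2 (slopev b p).
  move/le_trans; apply; rewrite ler_wpM2r ?n2_ge0 // ler_piMr ?divr_ge0 ?(ltW Cpos) ?(ltW cpos) //.
  by case/andP: t2_01 => t0 t1; rewrite exprn_ile1 ?ltW.
rewrite leNgt; apply/negP => lt.
pose g y := n2 (mprod S j *m slopev b y) - C / c * t2 ^+ j * n2 (1%:M *m slopev b y).
have gc : {for p, continuous g}.
  apply: cvgB; first exact: n2_slope_continuous.
  by apply: cvgM; [exact: cvg_cst|exact: n2_slope_continuous].
have gp : 0 < g p by rewrite /g mul1mx subr_gt0.
have nb : nbhs p [set y | 0 < g y].
  exact: (@cvgr_gt R _ _ _ g (g p) gc 0 gp).
have tail : (x @ \oo) [set x n | n in [set n | (j < n)%N]].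
  by exists j.+1 => // n /= jn; exists n.
have [y [[n /= jn <-] gy]] := clp _ _ tail nb.
have [_ /(_ j jn)] := Hx n; move: gy; rewrite /g mul1mx /=; lra.
Qed.

End Forward.

Lemma dist_line (E : set 'cV[R]_2) s v : s != 0 -> E = [set w | d2 s w = 0] ->
  dist_to E v = Num.sqrt (d2 s v ^+ 2 / n2 s).
Proof.
move=> s0 ->; have ns : 0 < n2 s by rewrite n2_gt0.
have lb w : d2 s w = 0 -> Num.sqrt (d2 s v ^+ 2 / n2 s) <= vnorm (v - w).
  move=> sw; rewrite vnormE ler_wsqrtr // ler_pdivrMr // mulrC.
  apply: le_trans (d2_sqr_le s (v - w)).
  suff -> : d2 s (v - w) = d2 s v by [].
  by rewrite -[RHS]subr0 -sw /d2 !mxE; ring.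
apply/eqP; rewrite eq_le; apply/andP; split; last first.
  apply: lb_le_inf; first by exists (vnorm (v - 0)), 0 => //=; rewrite /d2 !mxE !mulr0 subrr.
  by move=> _ [w /= sw <-]; exact: lb.
apply: ge_inf; first by exists 0 => _ [w _ <-]; exact: vnorm_ge0.
exists ((dp s v / n2 s) *: s) => /=; first by rewrite /d2 !mxE; ring.
rewrite {1}(orth_decomp v s0) addrAC subrr add0r vnormE n2Z.
congr Num.sqrt; rewrite /n2 !cv2E sqrrN -/(n2 s); rewrite addrC -/(n2 s).
by field; exact: lt0r_neq0.
Qed.

Lemma bdd_line c C S s w : 0 < c < C -> (forall i, \det (S i) = 1) ->
  (forall n, lyapforms c C S n) -> s != 0 -> bddorbit S s ->
  ~ bddorbit S w -> bddorbit S = [set v | d2 s v = 0].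
Proof.
move=> cC dS forms s0 bs nbw.
have [b0 [bD bZ]] := bddorbit_subspace S.
apply/seteqP; split=> v /= => [bv|]; last first.
  by move=> /(par_scale s0)[k ->]; exact: bZ.
apply: contrapT => sv; apply: nbw.
suff -> : w = (d2 s w / d2 s v) *: v + (d2 w v / d2 s v) *: s by apply: bD; apply: bZ.
by apply: col2P; rewrite !mxE /d2; field; apply/eqP => h; apply: sv; rewrite /d2; lra.
Qed.

(** Split [v] along [s] and its quarter turn. The orbit of [s] is bounded and that of [w] grows, so
    the image of [s] is negligible against the norm of the product. Only the orthogonal part
    survives, and it yields the squared distance from [v] to the line of [s]. *)
Lemma dist_bdd_cvg c C S s w v : 0 < c < C -> (forall i, \det (S i) = 1) ->
  (forall n, lyapforms c C S n) -> s != 0 -> bddorbit S s -> ~ bddorbit S w ->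
  (fun n => n2 (mprod S n *m v) / hs (mprod S n)) @ \oo --> d2 s v ^+ 2 / n2 s.
Proof.
move=> cC dS forms s0 [K bs] nbw.
have ns : 0 < n2 s by rewrite n2_gt0.
have nsn := lt0r_neq0 ns.
have hs0 n : 0 < hs (mprod S n) by apply: lt_le_trans (hs_det1 (det_mprod _)).
pose y n := n2 (mprod S n *m s) / hs (mprod S n).
have y0 n : 0 <= y n by rewrite divr_ge0 ?n2_ge0 ?hs_ge0.
have ycvg : y @ \oo --> (0 : R).
  have [a a0 [j Hj]] := not_bdd_grow cC dS forms nbw.
  apply/cvgrPdist_lt => e e0.
  have w0 : 0 < n2 w.
    rewrite n2_gt0; apply: contraPneq nbw => -> h; apply: h; exists 0 => n.
    by rewrite mulmx0 n20.
  have K0 : 0 <= K by apply: le_trans (bs 0%N); rewrite n2_ge0.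
  have [n0 Hn0] := @pow_big (c / C) (a * e) (K * n2 w) (ck_gt0 cC) (mulr_gt0 a0 e0).
  exists (j + n0)%N => // n /= jn.
  rewrite sub0r normrN ger0_norm //.
  rewrite /y ltr_pdivrMr // -(ltr_pM2r w0).
  apply: le_lt_trans (ler_wpM2r (ltW w0) (bs n)) _.
  apply: lt_le_trans (Hn0 (n - j)%N ltac:(lia)) _.
  rewrite mulrAC mulrC -mulrA ler_pM2l //.
  have := Hj (n - j)%N; rewrite subnKC; last by lia.
  by move/le_trans; apply; rewrite n2_mul_le.
pose al := dp s v / n2 s; pose be := d2 s v / n2 s.
(* [b] dominates the error: its first term comes from the squared length of the image of [s], its
   second from a scalar product, bounded by Cauchy-Schwarz. *)
pose b n := `|al ^+ 2 - be ^+ 2| * y n + 2 * `|al * be| * Num.sqrt (n2 s) * Num.sqrt (y n).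
have bc : b @ \oo --> (0 : R).
  rewrite (_ : (0 : R) = `|al ^+ 2 - be ^+ 2| * 0 + 2 * `|al * be| * Num.sqrt (n2 s) * Num.sqrt 0); last first.
    by rewrite sqrtr0; ring.
  apply: cvgD; first by apply: cvgM => //; exact: cvg_cst.
  apply: cvgM; first exact: cvg_cst.
  exact: (cvg_comp _ _ ycvg (@sqrt_continuous R 0)).
apply/cvgrPdist_le => e e0.
have /cvgrPdist_le/(_ e e0) := bc.
apply: filterS => n; rewrite sub0r normrN => be_.
apply: le_trans be_; apply: le_trans (ler_norm _).
set M := mprod S n.
pose js := cv2 (- s 1 0) (s 0 0).
have vE : v = al *: s + be *: js by exact: orth_decomp.
have hsE : n2 s * hs M = n2 (M *m s) + n2 (M *m js).
  by rewrite /hs /n2 !mulmx2vE !cv2E; ring.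
have E : n2 (M *m v) = be ^+ 2 * n2 s * hs M + (al ^+ 2 - be ^+ 2) * n2 (M *m s)
   + 2 * (al * be) * dp (M *m s) (M *m js).
  rewrite -mulrA hsE vE mulmxDr -!scalemxAr.
  set p := M *m s; set q := M *m js; rewrite /n2 /dp !mxE; ring.
have E2 : n2 (M *m v) / hs M - d2 s v ^+ 2 / n2 s = (al ^+ 2 - be ^+ 2) * y n +
   2 * (al * be) * (dp (M *m s) (M *m js) / hs M).
  rewrite E /y -/M; have -> : be ^+ 2 = d2 s v ^+ 2 / n2 s ^+ 2 by rewrite /be expr_div_n.
  by field; rewrite nsn lt0r_neq0 // hs0.
rewrite distrC E2; apply: (le_trans (ler_normD _ _)); rewrite /b.
apply: lerD; first by rewrite normrM (ger0_norm (y0 n)).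
rewrite normrM [`|2 * _|]normrM (ger0_norm (_ : 0 <= 2)) // -[leRHS]mulrA ler_wpM2l ?mulr_ge0 //.
rewrite -sqrtrM ?n2_ge0 // -sqrtr_sqr ler_wsqrtr // expr_div_n.
rewrite ler_pdivrMr; last by rewrite exprn_gt0 // hs0.
have -> : n2 s * y n * hs M ^+ 2 = n2 (M *m s) * (n2 s * hs M).
  by rewrite /y -/M; field; rewrite lt0r_neq0 // hs0.
rewrite hsE.
have dple : dp (M *m s) (M *m js) ^+ 2 <= n2 (M *m s) * n2 (M *m js).
  set p := M *m s; set q := M *m js.
  have -> : n2 p * n2 q = dp p q ^+ 2 + d2 p q ^+ 2 by rewrite /n2 /dp /d2; ring.
  by rewrite lerDl sqr_ge0.
move: dple (n2_ge0 (M *m s)).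
by set p := n2 (M *m s); set q := n2 (M *m js); set r := dp _ _; clearbody p q r; nra.
Qed.

End Windows.

(** * Measurability of matrix-valued maps and of their norms *)

Section MeasurableMatrices.
Context {d : measure_display} {X : measurableType d} {R : realType}.

Definition measM (B : X -> 'M[R]_2) :=
  forall i j, measurable_fun setT (fun x => B x i j).

Lemma measurable_iter (f : X -> X) n : measurable_fun setT f ->
  measurable_fun setT (iter n f).
Proof.
move=> mf; elim: n => [|n IH]; first exact: measurable_id.
exact: (measurableT_comp mf IH).
Qed.

Lemma measM_mul B C : measM B -> measM C -> measM (fun x => B x *m C x).
Proof.
move=> mB mC i j.
rewrite (_ : (fun x => _) = (fun x => B x i 0 * C x 0 j + B x i 1 * C x 1 j)); last first.
  by apply/funext => x; rewrite mulmx2E.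
by apply: measurable_funD; apply: measurable_funM.
Qed.

Lemma measM_comp B (f : X -> X) : measM B -> measurable_fun setT f ->
  measM (fun x => B (f x)).
Proof. by move=> mB mf i j; exact: (measurableT_comp (mB i j) mf). Qed.

Lemma measM_cst (M : 'M[R]_2) : measM (fun=> M).
Proof. by move=> i j; exact: measurable_cst. Qed.

Lemma measM_mprod (S : X -> nat -> 'M[R]_2) n :
  (forall i, measM (fun x => S x i)) -> measM (fun x => mprod (S x) n).
Proof.
move=> mS; elim: n => [|n IH] /=; first exact: measM_cst.
exact: measM_mul.
Qed.

Lemma measM_inv B : (forall x, \det (B x) = 1) -> measM B -> measM (fun x => invmx (B x)).
Proof.
move=> dB mB.
have E x : invmx (B x) = mx2 (B x 1 1) (- B x 0 1) (- B x 1 0) (B x 0 0) by exact: invmx2E.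
have mN f : measurable_fun setT f -> measurable_fun setT (fun x : X => - (f x : R)).
  by move=> mf; exact: measurable_funN.
move=> i j; elim/ord2P: i; elim/ord2P: j; under eq_fun do rewrite E mx2E; try exact: mN; exact: mB.
Qed.

Lemma measurable_n2 B v : measM B -> measurable_fun setT (fun x => n2 (B x *m v)).
Proof.
move=> mB; rewrite /n2.
have m i : measurable_fun setT (fun x => (B x *m v) i 0).
  rewrite (_ : (fun x => _) = (fun x => B x i 0 * v 0 0 + B x i 1 * v 1 0)); last first.
    by apply/funext => x; rewrite mulmx2vE.
  by apply: measurable_funD; apply: measurable_funM => //; exact: measurable_cst.
by apply: measurable_funD; apply: measurable_funX.
Qed.

Lemma measurable_d2 B C v w : measM B -> measM C ->
  measurable_fun setT (fun x => d2 (B x *m v) (C x *m w)).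
Proof.
move=> mB mC; rewrite /d2.
have m (D : X -> 'M[R]_2) (z : 'cV[R]_2) i : measM D -> measurable_fun setT (fun x => (D x *m z) i 0).
  move=> mD; rewrite (_ : (fun x => _) = (fun x => D x i 0 * z 0 0 + D x i 1 * z 1 0)); last first.
    by apply/funext => x; rewrite mulmx2vE.
  by apply: measurable_funD; apply: measurable_funM => //; exact: measurable_cst.
by apply: measurable_funB; apply: measurable_funM; apply: m.
Qed.

Lemma measurable_hs B : measM B -> measurable_fun setT (fun x => hs (B x)).
Proof.
move=> mB; rewrite /hs.
by apply: measurable_funD; [apply: measurable_funD; [apply: measurable_funD|]|];
   apply: measurable_funX.
Qed.

Lemma measurable_lnhs B : measM B -> measurable_fun setT (fun x => ln (hs (B x))).
Proof.
move=> mB; exact: (measurableT_comp (@measurable_ln R) (measurable_hs mB)).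
Qed.

Lemma measurable_invhs B : (forall x, \det (B x) = 1) -> measM B ->
  measurable_fun setT (fun x => (hs (B x))^-1).
Proof.
move=> dB mB.
rewrite (_ : (fun x => _) = (fun x => expR (- ln (hs (B x))))); last first.
  apply/funext => x; rewrite expRN lnK // posrE.
  by apply: lt_le_trans (hs_det1 (dB x)).
apply: (measurableT_comp (@measurable_expR R)).
by apply: measurable_funN; exact: measurable_lnhs.
Qed.

Lemma measurable_sqrt (f : X -> R) : measurable_fun setT f ->
  measurable_fun setT (fun x => Num.sqrt (f x)).
Proof.
move=> mf; apply: (measurableT_comp _ mf).
by apply: continuous_measurable_fun; exact: sqrt_continuous.
Qed.

End MeasurableMatrices.

(** * From forms on every window to a measurable invariant splitting *)

Section UniformHyperbolicity.
Context {d : measure_display} {X : measurableType d} {R : realType}.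
Variables (T Tinv : X -> X) (mu : probability X R) (A : X -> 'M[R]_2).
Hypothesis TK : cancel T Tinv.
Hypothesis TinvK : cancel Tinv T.
Hypothesis mT : measurable_fun setT T.
Hypothesis mTinv : measurable_fun setT Tinv.

Definition fwd (x : X) (i : nat) : 'M[R]_2 := A (iter i T x).
Definition bwd (x : X) (i : nat) : 'M[R]_2 := invmx (A (iter i.+1 Tinv x)).

Lemma cocycleE n x : cocycle T A n x = mprod (fwd x) n.
Proof. by elim: n => //= n ->. Qed.

Lemma cocycle_negE n x : cocycle_neg Tinv A n x = mprod (bwd x) n.
Proof. by elim: n => //= n ->. Qed.

Lemma iter_cancel (n m : nat) x : (m <= n)%N -> iter m T (iter n Tinv x) = iter (n - m) Tinv x.
Proof.
elim: m => [|m IH] mn; first by rewrite subn0.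
by rewrite iterS IH 1?ltnW // -subSS subSn // iterS TinvK.
Qed.

Variables (H c C : R) (G : set X).
Hypothesis mA : measM A.
Hypothesis dA : forall x, \det (A x) = 1.
Hypothesis HA : forall x, hs (A x) <= H.
Hypothesis H1 : 1 <= H.
Hypothesis cC : 0 < c < C.
Hypothesis mG : measurable G.
Hypothesis aeG : \forall x \ae mu, G x.
Hypothesis GT : forall x, G x -> G (T x).
Hypothesis GTinv : forall x, G x -> G (Tinv x).
Hypothesis formsG : forall x, G x -> forall n, lyapforms c C (fwd x) n.

Lemma dfwd x i : \det (fwd x i) = 1. Proof. exact: dA. Qed.
Lemma dbwd x i : \det (bwd x i) = 1. Proof. by rewrite det_inv1. Qed.

Lemma GiterV x n : G x -> G (iter n Tinv x).
Proof. by move=> Gx; elim: n => //= n; exact: GTinv. Qed.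

(** The backward window of length [n] at [x] is the reversal of the forward one at
    [iter n Tinv x]. *)
Lemma forms_bwd x n : G x -> lyapforms (c / H) C (bwd x) n.
Proof.
move=> Gx; have /andP[c0 _] := cC.
have := lyapforms_rev (ltW c0) H1 (dfwd (iter n Tinv x)) (fun i => HA _)
  (formsG (GiterV n Gx) n).
apply: eq_lyapforms => i ni; rewrite /fwd /bwd iter_cancel; last by lia.
by rewrite (_ : n - (n - i.+1) = i.+1)%N //; lia.
Qed.

Lemma cHC : 0 < c / H < C.
Proof.
have /andP[c0 c1] := cC; have H0 : 0 < H := lt_le_trans ltr01 H1.
rewrite divr_gt0 //=; apply: le_lt_trans c1.
by rewrite ler_pdivrMr // ler_peMr // ltW.
Qed.

(** Take a window of length [n + n] centred at [x] and the sign of its middle form at [v]. If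
    nonpositive, the vector [v'] one step before [v] has been contracted from a vector bounded by
    [L], hence is too small for large [n]; if positive, the forward orbit outgrows [K]. *)
Lemma fwd_bwd_trivial x v : G x -> bddorbit (fwd x) v -> bddorbit (bwd x) v -> v = 0.
Proof.
move=> Gx [K fK] [L bL]; apply/eqP; apply: contrapT => /negP v0.
have /andP[c0 c1] := cC; have C0 := Cpos cC.
have nv : 0 < n2 v by rewrite n2_gt0.
have t01 := t2_01 cC.
pose v' := invmx (A (Tinv x)) *m v.
have nv' : 0 < n2 v' by rewrite n2_gt0 mul_neq0 // det_inv1.
have [k0 Hk0] := @pow_big R (c / C) (c * n2 v) (C * K) (ck_gt0 cC) (mulr_gt0 c0 nv).
have [k1 Hk1] := @pow_small R (1 - c / C) (n2 v') (C / c * L) t01 nv'.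
pose n := (maxn k0 k1).+1.
pose y := iter n Tinv x.
have [q [q1 q2 q3]] := formsG (GiterV n Gx) (n + n)%N.
have Pb m : (m <= n)%N -> mprod (fwd y) m *m (mprod (bwd x) n *m v) = mprod (bwd x) (n - m) *m v.
  elim: m => [|m IH] mn; first by rewrite subn0 mul1mx.
  rewrite /= -mulmxA IH 1?ltnW // -[in RHS](mulmxV2v (_ *m v) (dA (iter (n - m) Tinv x))).
  rewrite /fwd iter_cancel 1?ltnW //; congr (_ *m _).
  have -> : (n - m = (n - m.+1).+1)%N by lia.
  by rewrite /= /bwd mulmxA.
pose w := mprod (bwd x) n *m v.
have Pn : mprod (fwd y) n *m w = v by rewrite Pb // subnn mul1mx.
have Pn1 : mprod (fwd y) n.-1 *m w = v'.
  rewrite Pb ?leq_pred // (_ : n - n.-1 = 1)%N; last by rewrite /n /=; clear; lia.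
  by rewrite /= mulmx1.
have P2n : mprod (fwd y) (n + n) *m w = mprod (fwd x) n *m v.
  rewrite mprodD -mulmxA Pn; congr (_ *m _); apply: mprod_ext => i _.
  by rewrite /fwd addnC iterD iter_cancel // subnn.
have [h|h] := lerP (q n (mprod (fwd y) n *m w)) 0.
  have := window_contract cC (_ : (n.-1 < n + n)%N) q1 q2 h.
  rewrite Pn1 => /(_ ltac:(by rewrite /n; lia)) hc.
  have wL : n2 w <= L by exact: bL.
  have := Hk1 n.-1 (leq_maxr _ _).
  suff : n2 v' <= C / c * L * (1 - c / C) ^+ n.-1 by lra.
  apply: (le_trans hc); rewrite mulrAC; apply: ler_wpM2r.
    by rewrite exprn_ge0 // ltW; case/andP: t01.
  by rewrite ler_wpM2l // divr_ge0 // ltW.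
have := @window_expand R c C (fwd y) cC (n + n)%N w n n.-1 q q1 q2 _ (ltW h).
rewrite prednK // Pn P2n => /(_ (leqnn _)) he.
have := Hk0 n.-1 (leq_maxl _ _).
have := ler_wpM2l (ltW C0) (fK n); lra.
Qed.

(** Constant off [G], so that measurability is only at stake on [G], where the orbits are
    controlled. *)
Definition Es x : set 'cV[R]_2 := if `[< G x >] then bddorbit (fwd x) else set0.
Definition Eu x : set 'cV[R]_2 := if `[< G x >] then bddorbit (bwd x) else set0.

Lemma exists_fwd x : G x -> exists2 s, s != 0 & bddorbit (fwd x) s.
Proof. by move=> Gx; apply: (exists_bdd cC) => //; [exact: dfwd|exact: formsG]. Qed.

Lemma exists_bwd x : G x -> exists2 s, s != 0 & bddorbit (bwd x) s.
Proof.
by move=> Gx; apply: (exists_bdd cHC) => [|n]; [exact: dbwd|exact: forms_bwd].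
Qed.

(* The distance from [v] to the line of bounded orbits is the limit of |S_n v| / |S_n|. *)
Lemma measurable_dist_bdd (S : X -> nat -> 'M[R]_2) (c' : R) :
  0 < c' < C -> (forall x i, \det (S x i) = 1) -> (forall i, measM (S^~ i)) ->
  (forall x, G x -> forall n, lyapforms c' C (S x) n) ->
  (forall x, G x -> exists2 s, s != 0 & bddorbit (S x) s) ->
  (forall x, G x -> exists w, ~ bddorbit (S x) w) ->
  measurable_subspace_map (fun x => if `[< G x >] then bddorbit (S x) else set0).
Proof.
move=> c'C dS mS forms exs exw v.
have -> : (fun x => dist_to (if `[< G x >] then bddorbit (S x) else set0) v) =
  (fun x => if `[< G x >] then dist_to (bddorbit (S x)) v else dist_to set0 v).
  by apply/funext => x; case: ifP.
have mGb : measurable_fun setT (fun x => `[< G x >]).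
  apply: (@measurable_fun_bool _ _ _ _ true).
  rewrite setTI (_ : _ @^-1` _ = G) //.
  by apply/seteqP; split => x /=; [move=> /asboolP|move=> /asboolP ->].
apply: (measurable_fun_if measurableT mGb); last exact: measurable_cst.
rewrite setTI (_ : _ @^-1` _ = G); last first.
  by apply/seteqP; split => x /=; [move=> /asboolP|move=> /asboolP ->].
apply: (@measurable_fun_cvg _ _ _ _
  (fun n x => Num.sqrt (n2 (mprod (S x) n *m v) / hs (mprod (S x) n)))).
  move=> n; apply: (@measurable_funS _ _ _ _ setT) => //.
  apply: measurable_sqrt; apply: measurable_funM.
    by apply: measurable_n2; exact: measM_mprod.
  by apply: measurable_invhs => [x|]; [exact: det_mprod|exact: measM_mprod].
move=> x Gx.
have [s s0 bs] := exs x Gx; have [w nbw] := exw x Gx.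
rewrite (dist_line v s0 (bdd_line c'C (dS x) (forms x Gx) s0 bs nbw)).
have h := @dist_bdd_cvg R c' C (S x) s w v c'C (dS x) (forms x Gx) s0 bs nbw.
exact: (cvg_comp _ _ h (@sqrt_continuous R _)).
Qed.

Lemma fwd_shift x n : mprod (fwd x) n.+1 = mprod (fwd (T x)) n *m A x.
Proof.
rewrite -(add1n n) mprodD /= mulmx1; congr (_ *m _); apply: mprod_ext => i _.
by rewrite /fwd add1n iterSr.
Qed.

Lemma bwd_shift x n : mprod (bwd (T x)) n.+1 = mprod (bwd x) n *m invmx (A x).
Proof.
rewrite -(add1n n) mprodD /= mulmx1 /bwd /= TK; congr (_ *m _); apply: mprod_ext => i _.
by rewrite add0n -iterS iterSr TK.
Qed.

Lemma forms_uniformly_hyperbolic : uniformly_hyperbolic T Tinv mu A.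
Proof.
exists Eu, Es.
have mf i : measM (fwd^~ i) by apply: measM_comp => //; exact: measurable_iter.
have mb i : measM (bwd^~ i).
  by apply: measM_inv => //; apply: measM_comp => //; exact: measurable_iter.
split.
  apply: (measurable_dist_bdd cHC) => //; first exact: dbwd.
  - by move=> x Gx n; exact: forms_bwd.
  - exact: exists_bwd.
  (* A vector with unbounded backward orbit: any nonzero one with bounded forward orbit. *)
  - move=> x Gx; have [s s0 bs] := exists_fwd Gx; exists s => bbs.
    by move: s0; rewrite (fwd_bwd_trivial Gx bs bbs) eqxx.
split.
  apply: (measurable_dist_bdd cC) => //; first exact: dfwd.
  - exact: exists_fwd.
  - move=> x Gx; have [s s0 bs] := exists_bwd Gx; exists s => bbs.
    by move: s0; rewrite (fwd_bwd_trivial Gx bbs bs) eqxx.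
have /andP[c0 c1] := cC; have C0 := Cpos cC.
have H0 : 0 < H := lt_le_trans ltr01 H1.
have /andP[t0 t1] := t2_01 cHC; have /andP[s0 s1] := t2_01 cC.
(* Square roots, because the estimates concern squared norms. The backward constant [c / H] is the
   weaker one and serves both directions. *)
pose K := Num.sqrt (C / (c / H)); pose t := Num.sqrt (1 - c / H / C).
have K0 : 0 < K by rewrite sqrtr_gt0 !divr_gt0.
exists K, t; split => //; split.
  apply/andP; split; first by rewrite sqrtr_gt0.
  by rewrite -sqrtr1 ltr_sqrt.
have key n w v (k : R) : 0 <= k <= C / (c / H) -> n2 w <= k * (1 - c / H / C) ^+ n * n2 v ->
    vnorm w <= K * t ^+ n * vnorm v.
  move=> /andP[k0 k1] h; have -> : t ^+ n = Num.sqrt ((1 - c / H / C) ^+ n).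
    by rewrite /t; elim: n {h} => [|n IH]; rewrite ?sqrtr1 // !exprS IH sqrtrM // ltW.
  rewrite !vnormE -sqrtrM; last by rewrite !divr_ge0 // ltW.
  rewrite -sqrtrM ?ler_wsqrtr //; last by rewrite mulr_ge0 ?exprn_ge0 ?ltW // !divr_gt0.
  apply: (le_trans h); rewrite ler_wpM2r ?n2_ge0 // ler_wpM2r // exprn_ge0 // ltW //.
have cc : c / H <= c by rewrite ler_pdivrMr // ler_peMr // ltW.
apply: filterS aeG => x Gx; split; last split; last split; last split.
- rewrite /Eu /Es; case: asboolP => // _.
  split; first exact: bddorbit_subspace.
  split; first exact: bddorbit_subspace.
  have [s sn bs] := exists_fwd Gx; have [u un bu] := exists_bwd Gx.
  split.
    apply/seteqP; split=> v /=; first by move=> [h1 h2]; exact: (fwd_bwd_trivial Gx h2 h1).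
    move=> ->; split; [have [] := bddorbit_subspace (bwd x)|have [] := bddorbit_subspace (fwd x)] => //.
  have su : d2 s u != 0.
    apply/eqP => h; have [k uk] := par_scale sn h.
    have bu' : bddorbit (fwd x) u by rewrite uk; have [_ [_ ]] := bddorbit_subspace (fwd x); apply.
    by move: un; rewrite (fwd_bwd_trivial Gx bu' bu) eqxx.
  move=> v; exists ((d2 s v / d2 s u) *: u).
    by have [_ [_ ]] := bddorbit_subspace (bwd x); apply.
  exists ((d2 v u / d2 s u) *: s).
    by have [_ [_ ]] := bddorbit_subspace (fwd x); apply.
  apply: col2P; rewrite !mxE; apply: (mulfI su).
    transitivity (d2 s v * u 0 0 + d2 v u * s 0 0); first by rewrite /d2; ring.
    by field.
  transitivity (d2 s v * u 1 0 + d2 v u * s 1 0); first by rewrite /d2; ring.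
  by field.
- rewrite /Eu; have GTx := GT Gx; case: asboolP => // _; case: asboolP => // _.
  apply/seteqP; split=> w /=.
    move=> [v [L bL] <-]; exists (Num.max L (n2 (A x *m v))) => -[|n].
      by rewrite mul1mx le_max lexx orbT.
    by rewrite bwd_shift -mulmxA mulVmx2v // le_max bL.
  move=> [L bL]; exists (invmx (A x) *m w); last by rewrite mulmxV2v.
  by exists L => n; have := bL n.+1; rewrite bwd_shift -mulmxA.
- rewrite /Es; have GTx := GT Gx; case: asboolP => // _; case: asboolP => // _.
  apply/seteqP; split=> w /=.
    move=> [v [L bL] <-]; exists L => n.
    by have := bL n.+1; rewrite fwd_shift -mulmxA.
  move=> [L bL]; exists (invmx (A x) *m w); last by rewrite mulmxV2v.
  exists (Num.max L (n2 (invmx (A x) *m w))) => -[|n].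
    by rewrite mul1mx le_max lexx orbT.
  by rewrite fwd_shift -mulmxA mulmxV2v // le_max bL.
- move=> n v; rewrite /Es; case: asboolP => // _ bv; rewrite cocycleE.
  have h := bdd_contract cC (dfwd x) (formsG Gx) bv n.
  apply: (key n _ _ (C / c)).
    apply/andP; split; first by rewrite divr_ge0 // ltW.
    by rewrite ler_pM2l // lef_pV2 ?posrE // divr_gt0.
  apply: (le_trans h); rewrite ler_wpM2r ?n2_ge0 //.
  apply: ler_wpM2l; first by rewrite divr_ge0 // ltW.
  apply: lerXn2r; rewrite ?nnegrE ?(ltW s0) ?(ltW t0) //.
  by rewrite lerD2l lerN2 ler_wpM2r // invr_ge0 ltW.
- move=> n v; rewrite /Eu; case: asboolP => // _ bv; rewrite cocycle_negE.
  apply: (key n _ _ (C / (c / H))).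
    by rewrite lexx andbT !divr_ge0 // ltW.
  exact: (bdd_contract cHC (dbwd x) (fun n => forms_bwd n Gx) bv n).
Qed.

End UniformHyperbolicity.

(** * Ergodic automorphisms *)

Section Ergodic.
Context {d : measure_display} {X : measurableType d} {R : realType}.
Variables (mu : probability X R) (T Tinv : X -> X).
Hypothesis imp : invertible_mp mu T Tinv.

Let mT : measurable_fun setT T. Proof. by case: imp. Qed.
Let mTinv : measurable_fun setT Tinv. Proof. by case: imp. Qed.
Let TK : cancel T Tinv. Proof. by case: imp. Qed.
Let TinvK : cancel Tinv T. Proof. by case: imp. Qed.

Lemma measurable_preimage (f : X -> X) (A : set X) : measurable_fun setT f ->
  measurable A -> measurable (f @^-1` A).
Proof. by move=> mf mA; rewrite -[_ @^-1` _]setTI; exact: mf. Qed.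

Lemma mu_T A : measurable A -> mu (T @^-1` A) = mu A.
Proof. by case: imp => _ _ _ _; apply. Qed.

Lemma mu_Tinv A : measurable A -> mu (Tinv @^-1` A) = mu A.
Proof.
move=> mA; rewrite -(mu_T (measurable_preimage mTinv mA)); congr (mu _).
by apply/funext => x /=; rewrite /preimage /= TK.
Qed.

Lemma mu_iterT n A : measurable A -> mu (iter n T @^-1` A) = mu A.
Proof.
elim: n A => [|n IH] A mA; first by congr (mu _).
rewrite -(IH A mA) -[RHS]mu_T; last exact: measurable_preimage (measurable_iter n mT) mA.
by congr (mu _); apply/funext => x /=; rewrite /preimage /= -iterSr.
Qed.

Lemma mu_iterTinv n A : measurable A -> mu (iter n Tinv @^-1` A) = mu A.
Proof.
elim: n A => [|n IH] A mA; first by congr (mu _).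
rewrite -(IH A mA) -[RHS]mu_Tinv; last exact: measurable_preimage (measurable_iter n mTinv) mA.
by congr (mu _); apply/funext => x /=; rewrite /preimage /= -iterSr.
Qed.

Lemma ae_iterT n (P : X -> Prop) : (\forall x \ae mu, P x) -> \forall x \ae mu, P (iter n T x).
Proof.
move=> [N [mN N0 PN]]; exists (iter n T @^-1` N); split.
- exact: measurable_preimage (measurable_iter n mT) mN.
- by rewrite mu_iterT.
- by move=> x /= nP; apply: PN.
Qed.

Lemma ae_iterTinv n (P : X -> Prop) : (\forall x \ae mu, P x) -> \forall x \ae mu, P (iter n Tinv x).
Proof.
move=> [N [mN N0 PN]]; exists (iter n Tinv @^-1` N); split.
- exact: measurable_preimage (measurable_iter n mTinv) mN.
- by rewrite mu_iterTinv.
- by move=> x /= nP; apply: PN.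
Qed.

Lemma integral_iterT n (f : X -> \bar R) : measurable_fun setT f ->
  (forall x, 0 <= f x)%E -> (\int[mu]_x f (iter n T x) = \int[mu]_x f x)%E.
Proof.
move=> mf f0.
have mTn := measurable_iter n mT.
have -> : (\int[mu]_x f (iter n T x) = \int[pushforward mu (iter n T)]_(y in setT) f y)%E.
  by rewrite (ge0_integral_pushforward mTn).
apply: eq_measure_integral => // A mA _.
exact: mu_iterT.
Qed.

Lemma iterTinvK n x : iter n Tinv (iter n T x) = x.
Proof. by elim: n x => // n IH x; rewrite iterSr iterS TK IH. Qed.

Lemma iterTK n x : iter n T (iter n Tinv x) = x.
Proof. by elim: n x => // n IH x; rewrite iterSr iterS TinvK IH. Qed.

Hypothesis erg : ergodic mu T.

Lemma mu_fin A : measurable A -> exists a : R, mu A = a%:E.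
Proof. by move=> mA; exists (fine (mu A)); rewrite fineK // fin_num_measure. Qed.

Lemma integral_const (a : \bar R) : (\int[mu]_x (cst a x) = a)%E.
Proof.
rewrite (integral_cst mu measurableT).
exact: (eq_trans (congr1 (fun z => a * z)%E (probability_setT mu)) (mule1 _)).
Qed.

(** [ergodic] speaks of exactly invariant sets, whereas [Y] only contains its preimage under [T].
    The sets [F j] increase to an invariant set and all have the measure of [Y]. *)
Lemma hitting_full (Gam : set X) : measurable Gam -> (0 < mu Gam)%E ->
  mu [set x | exists k, Gam (iter k T x)] = 1%E.
Proof.
move=> mGam Gam0; set Y := [set x | _].
have mY : measurable Y.
  rewrite (_ : Y = \bigcup_k (iter k T @^-1` Gam)).
    by apply: bigcupT_measurable => k; exact: measurable_preimage (measurable_iter k mT) mGam.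
  by apply/seteqP; split => x /=; [move=> [k Hk]; exists k|move=> [k _ Hk]; exists k].
pose F j := iter j Tinv @^-1` Y.
have mF j : measurable (F j) by exact: measurable_preimage (measurable_iter j mTinv) mY.
have mZ : measurable (\bigcup_j F j) by exact: bigcupT_measurable.
have Fle j : F j `<=` F j.+1.
  by move=> x [k Hk]; exists k.+1; rewrite iterSr iterS TinvK.
have ZT : T @^-1` (\bigcup_j F j) = \bigcup_j F j.
  apply/seteqP; split => x /= [j _ Hj].
    case: j Hj => [[k Hk]|j Hj]; first by exists 0%N => //; exists k.+1; rewrite iterSr.
    by exists j => //; move: Hj; rewrite /F /preimage /= -iterS iterSr TK.
  by exists j.+1 => //; rewrite /F /preimage /= -iterS iterSr TK.
have Z1 : mu (\bigcup_j F j) = 1%E.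
  case: (erg mZ ZT) => // Z0; move: Gam0; rewrite lt_neqAle => /andP[/negP h _]; exfalso; apply: h.
  rewrite eq_le measure_ge0 /= -Z0; apply: le_measure; rewrite ?inE //.
  by move=> x Gx; exists 0%N => //; exists 0%N.
have cv := nondecreasing_cvg_mu mF mZ.
rewrite -Z1; apply/esym; apply: (@cvg_unique _ _ (mu Y @[n --> \oo])) => //=.
have -> : (fun=> mu Y) = (mu \o F) by apply/funext => n /=; rewrite mu_iterTinv.
apply: cv => m n mn; apply/subsetPset.
elim: n mn => [|n IH]; first by rewrite leqn0 => /eqP ->.
rewrite leq_eqVlt => /predU1P[-> //|/IH h]; apply: subset_trans h (Fle n).
exact: cvg_cst.
Qed.

Lemma small_compl (F : nat -> set X) (e : R) : 0 < e -> (forall n, measurable (F n)) ->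
  (forall n, F n `<=` F n.+1) -> mu (\bigcup_n F n) = 1%E ->
  exists n, (mu (~` F n) < e%:E)%E.
Proof.
move=> e0 mF Fle F1.
have mU : measurable (\bigcup_n F n) by exact: bigcupT_measurable.
have cv : mu \o F @ \oo --> (1%:E : \bar R).
  rewrite -F1; apply: nondecreasing_cvg_mu => // m n mn; apply/subsetPset.
  elim: n mn => [|n IH]; first by rewrite leqn0 => /eqP ->.
  by rewrite leq_eqVlt => /predU1P[-> //|/IH h]; apply: subset_trans h (Fle n).
have lt1 : ((1 - e)%:E < 1%:E :> \bar R)%E by rewrite lte_fin; lra.
have [n _ /(_ n (leqnn n)) /= Hn] := cv _ (open_nbhs_nbhs (conj (@open_ereal_gt_ereal _ (1 - e)%:E) lt1)).
exists n; rewrite probability_setC //.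
have [a aE] := mu_fin (mF n).
by move: Hn; rewrite aE -EFinB !lte_fin; lra.
Qed.

Lemma hitting_time (Gam : set X) (e : R) : measurable Gam -> (0 < mu Gam)%E -> 0 < e ->
  exists L, (mu (~` [set x | exists k, (k < L)%N /\ Gam (iter k T x)]) < e%:E)%E.
Proof.
move=> mGam Gam0 e0.
apply: (@small_compl (fun L => [set x | exists k, (k < L)%N /\ Gam (iter k T x)])) => //.
- move=> n; rewrite (_ : [set x | _] = \bigcup_(k in [set k | (k < n)%N]) (iter k T @^-1` Gam)).
    apply: bigcup_measurable => k _; exact: measurable_preimage (measurable_iter k mT) mGam.
  by apply/seteqP; split => x /=; [move=> [k [kn Hk]]; exists k|move=> [k kn Hk]; exists k].
- by move=> n x [k [kn Hk]]; exists k; split => //; exact: ltnW.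
- rewrite -[RHS](hitting_full mGam Gam0); congr (mu _).
  apply/seteqP; split => x /=; first by move=> [n _ [k [_ Hk]]]; exists k.
  by move=> [k Hk]; exists k.+1 => //; exists k.
Qed.

Lemma small_set : nonatomic mu -> forall e : R, 0 < e ->
  exists F, [/\ measurable F, (0 < mu F)%E & (mu F < e%:E)%E].
Proof.
move=> na.
have H k : exists F, [/\ measurable F, (0 < mu F)%E & (mu F <= (2^-1 ^+ k)%:E)%E].
  elim: k => [|k [F [mF F0 Fk]]].
    by exists setT; rewrite probability_setT expr0; split => //; rewrite lte_fin.
  have [B [mB BF /andP[B0 BltF]]] := na F mF F0.
  have [b bE] := mu_fin mB; have [a aE] := mu_fin mF.
  have DE : mu (F `\` B) = (mu F - mu B)%E.
    rewrite measureD // ?(setIidr BF) //.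
    by apply: le_lt_trans (probability_le1 _ mF) _; rewrite ltry.
  move: B0 BltF Fk DE; rewrite bE aE -EFinB.
  rewrite !lte_fin lee_fin => B0 BltF Fk DE.
  have [h|h] := lerP b (2^-1 ^+ k.+1).
    by exists B; split=> //; rewrite bE ?lte_fin ?lee_fin.
  exists (F `\` B); split; first exact: measurableD.
    by rewrite DE lte_fin; lra.
  by rewrite DE lee_fin; move: h Fk; rewrite exprS; lra.
move=> e e0.
have [k0 Hk0] := @pow_small R 2^-1 e 1 ltac:(lra) e0.
have [F [mF F0 Fk]] := H k0; exists F; split=> //.
by apply: (le_lt_trans Fk); rewrite lte_fin; have := Hk0 k0 (leqnn _); rewrite mul1r.
Qed.

Definition tower (E : set X) (N : nat) : set X :=
  [set y | exists i, (i < N)%N /\ E (iter i Tinv y)].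

Lemma measurable_tower E N : measurable E -> measurable (tower E N).
Proof.
move=> mE; rewrite (_ : tower E N = \bigcup_(i in [set i | (i < N)%N]) (iter i Tinv @^-1` E)).
  apply: bigcup_measurable => i _; exact: measurable_preimage (measurable_iter i mTinv) mE.
by apply/seteqP; split => x /=; [move=> [k [kn Hk]]; exists k|move=> [k kn Hk]; exists k].
Qed.

Lemma finite_union_bound (F : nat -> set X) (a : R) N : (forall i, measurable (F i)) ->
  (forall i, (i < N)%N -> mu (F i) <= a%:E)%E ->
  (mu (\bigcup_(i in [set i | (i < N)%N]) F i) <= (N%:R * a)%:E)%E.
Proof.
move=> mF Fa; rewrite bigcup_mkord.
apply: (@le_trans _ _ (\sum_(i < N) mu (F i))%E).
  by apply: content_subadditive => //; apply: bigsetU_measurable.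
apply: (@le_trans _ _ (\sum_(i < N) a%:E)%E).
  by apply: lee_sum => i _; exact: Fa.
by rewrite sumEFin sumr_const card_ord mulr_natl.
Qed.

(** Orbits are cut into blocks of length [N] counted back from the next visit to [F], whose measure
    is below [e / N]. A point is left uncovered only if it never meets [F], which is a null event,
    or has been in [F] during the last [N] times, a set of measure at most [N] times that of [F]. *)
Lemma rokhlin : nonatomic mu -> forall (N : nat) (e : R), (0 < N)%N -> 0 < e ->
  exists E, [/\ measurable E,
    forall x, E x -> forall j, (0 < j < N)%N -> ~ E (iter j T x) &
    (mu (~` tower E N) < e%:E)%E].
Proof.
move=> na N e N0 e0.
have NR : 0 < N%:R :> R by rewrite ltr0n.
have [F [mF F0 Fe]] := small_set na (divr_gt0 e0 NR).
pose Rn n := [set x | F (iter n T x) /\ forall k, (k < n)%N -> ~ F (iter k T x)].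
have mRn n : measurable (Rn n).
  rewrite (_ : Rn n = (iter n T @^-1` F) `&`
     \bigcap_(k in [set k | (k < n)%N]) (~` (iter k T @^-1` F))).
    apply: measurableI; first exact: measurable_preimage (measurable_iter n mT) mF.
    apply: bigcap_measurableType => k _; apply: measurableC.
    exact: measurable_preimage (measurable_iter k mT) mF.
  by apply/seteqP; split => x /= [h1 h2]; split.
have Runiq n m x : Rn n x -> Rn m x -> n = m.
  move=> [a1 a2] [b1 b2]; case: (ltngtP n m) => // h; exfalso.
    exact: (b2 n).
  exact: (a2 m).
(* The base of the tower is the set of points whose hitting time of F is -1 modulo N. *)
pose E := \bigcup_(n in [set n | (n %% N)%N = N.-1]) Rn n.
have mE : measurable E by apply: bigcup_measurable.
exists E; split => //.
  move=> x [n /= nN [Fn nF]] j /andP[j0 jN] [m /= mN Rm].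
  have jn : (j <= n)%N.
    by have := leq_mod n N; rewrite nN; move: jN N0; clear; lia.
  have Rnj : Rn (n - j)%N (iter j T x).
    split; first by rewrite -iterD subnK.
    by move=> k kn; rewrite -iterD; apply: nF; move: kn jn; clear; lia.
  have mE' := Runiq _ _ _ Rm Rnj.
  have e1 : (m + j = n)%N by rewrite mE' subnK.
  have := nN; rewrite -e1 -modnDml mN.
  have [q qE] : exists q, (N.-1 + j = q + N /\ q < N.-1)%N.
    by exists (j.-1); move: j0 jN; clear; lia.
  case: qE => -> qN; rewrite modnDr modn_small; last by move: qN; clear; lia.
  by move=> qq; move: qN; rewrite qq ltnn.
pose Y := [set x | exists k, F (iter k T x)].
have mY : measurable Y.
  rewrite (_ : Y = \bigcup_k (iter k T @^-1` F)).
    by apply: bigcupT_measurable => k; exact: measurable_preimage (measurable_iter k mT) mF.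
  by apply/seteqP; split => x /=; [move=> [k Hk]; exists k|move=> [k _ Hk]; exists k].
pose V := \bigcup_(j in [set j | (j < N)%N]) (iter j Tinv @^-1` F).
have mV : measurable V.
  by apply: bigcup_measurable => j _; exact: measurable_preimage (measurable_iter j mTinv) mF.
have cover : ~` tower E N `<=` ~` Y `|` V.
  move=> y nty; have [Yy|] := pselect (Y y); last by left.
  right; apply: contrapT => nV; apply: nty.
  have [n Rny] : exists n, Rn n y.
    have exk : exists k, `[< F (iter k T y) >] by case: Yy => k Hk; exists k; apply/asboolP.
    case: (ex_minnP exk) => n /asboolP Fn nmin; exists n; split => // k kn Fk.
    by have := nmin k; rewrite leqNgt kn => /(_ (asboolT Fk)).
  pose i := (N.-1 - n %% N)%N.
  have iN : (i < N)%N by rewrite /i; move: N0; clear; lia.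
  exists i; split => //.
  exists (n + i)%N => /=.
    have lt : (n %% N < N)%N by rewrite ltn_mod.
    have e1 : (n %% N + i = N.-1)%N.
      by rewrite /i; move: lt N0; generalize (n %% N)%N; clear; lia.
    by rewrite -modnDml e1 modn_small //; move: N0; clear; lia.
  case: Rny => [Fn nF]; split; first by rewrite iterD iterTK.
  move=> k kni Fk; have [ik|ki] := leqP i k.
    apply: (nF (k - i)%N); first by move: kni ik; clear; lia.
    by move: Fk; rewrite -{1}(subnK ik) iterD iterTK.
  apply: nV; exists (i - k)%N; first by rewrite /=; move: ki iN; clear; lia.
  move: Fk; rewrite -{1}(subnKC (ltnW ki)) iterD iterTK //.
have mnt : measurable (~` tower E N) by apply: measurableC; exact: measurable_tower.
have mnY : measurable (~` Y) by exact: measurableC.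
apply: (@le_lt_trans _ _ (mu (~` Y `|` V))).
  by apply: le_measure; rewrite ?inE //; exact: measurableU.
have nY0 : mu (~` Y) = 0%E by rewrite probability_setC // (hitting_full mF F0) subee.
have U2 : (mu (~` Y `|` V) <= mu (~` Y) + mu V)%E by exact: measureU2.
apply: (le_lt_trans U2); rewrite nY0 add0e.
have [a aE] := mu_fin mF.
apply: (@le_lt_trans _ _ ((N%:R * a)%:E)%E).
  apply: finite_union_bound.
    by move=> j; exact: measurable_preimage (measurable_iter j mTinv) mF.
  by move=> j _; rewrite mu_iterTinv // aE.
move: Fe; rewrite aE !lte_fin ltr_pdivlMr // mulrC; exact.
Qed.

Definition bsum (f : X -> R) n x : R := \sum_(i < n) f (iter i T x).

Lemma bsumD f m n x : bsum f (m + n) x = bsum f m x + bsum f n (iter m T x).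
Proof.
rewrite /bsum big_split_ord /=; congr (_ + _).
by apply: eq_bigr => i _; rewrite -iterD addnC.
Qed.

Lemma bsum1 f x : bsum f 1 x = f x.
Proof. by rewrite /bsum big_ord1. Qed.

Lemma measurable_bsum f n : measurable_fun setT f -> measurable_fun setT (bsum f n).
Proof.
move=> mf; elim: n => [|n IH].
  rewrite (_ : bsum f 0 = cst 0); first exact: measurable_cst.
  by apply/funext => x; rewrite /bsum big_ord0.
rewrite (_ : bsum f n.+1 = (bsum f n \+ (f \o iter n T))); last first.
  by apply/funext => x /=; rewrite /bsum big_ord_recr.
apply: measurable_funD => //; apply: (measurableT_comp mf); exact: measurable_iter.
Qed.

Lemma integral_bsum (f : X -> R) n : measurable_fun setT f -> (forall x, 0 <= f x) ->
  (\int[mu]_x (bsum f n x)%:E = n%:R%:E * \int[mu]_x (f x)%:E)%E.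
Proof.
move=> mf f0; elim: n => [|n IH].
  rewrite mul0e; under eq_integral do rewrite /bsum big_ord0.
  by rewrite integral0.
under eq_integral do rewrite /bsum big_ord_recr /= EFinD.
rewrite ge0_integralD //.
- rewrite [X in (X + _)%E]IH.
  rewrite (integral_iterT n (f := fun x => (f x)%:E)) //; last exact/measurable_EFinP.
  by rewrite -natr1 EFinD ge0_muleDl ?lee_fin // mul1e.
- by move=> x _; rewrite lee_fin sumr_ge0.
- by apply/measurable_EFinP; exact: (measurable_bsum n mf).
- by move=> x _; rewrite lee_fin.
- apply/measurable_EFinP; apply: (measurableT_comp mf); exact: measurable_iter.
Qed.

Section HalfBirkhoff.
Variables (f : X -> R) (K c : R).
Hypothesis mf : measurable_fun setT f.
Hypothesis f0 : forall x, 0 <= f x.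
Hypothesis fK : forall x, f x <= K.
Hypothesis cf : (\int[mu]_x (f x)%:E < c%:E)%E.

Let c_gt0 : 0 < c.
Proof.
rewrite -lte_fin; apply: le_lt_trans cf; apply: integral_ge0 => x _; by rewrite lee_fin.
Qed.

(** Halving the margin [e] pays for one term more or less in a Birkhoff sum. This makes [D], the set
    where the upper limit of the averages exceeds [c], exactly invariant. *)
Let often (e : R) x := forall n0, exists n, (n0 <= n)%N /\ (c + e) * n%:R <= bsum f n x.
Let D := [set x | exists j : nat, often j.+1%:R^-1 x].

Let oftenW e e' x : e' <= e -> often e x -> often e' x.
Proof.
move=> ee H n0; have [n [nn h]] := H n0; exists n; split=> //.
by apply: le_trans h; rewrite ler_wpM2r // lerD2l.
Qed.

Let D_often x : D x <-> exists2 e, 0 < e & often e x.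
Proof.
split=> [[j Hj]|[e e0 He]]; first by exists j.+1%:R^-1 => //; rewrite invr_gt0.
exists (Num.truncn e^-1); apply: oftenW He.
rewrite -[leRHS]invrK lef_pV2 ?posrE ?invr_gt0 //.
by rewrite ltW // truncnS_gt.
Qed.

Let DT : T @^-1` D = D.
Proof.
have E n x : bsum f n.+1 x = f x + bsum f n (T x) by rewrite -(add1n n) bsumD bsum1.
apply/seteqP; split => x; rewrite /preimage /= => /D_often[e e0 He]; apply/D_often;
  exists (e / 2); rewrite ?divr_gt0 // => n0.
  have [m Hm] := exists_nat_gt ((c + e / 2) / (e / 2)).
  have [n [nn h]] := He (n0 + m)%N; exists n.+1; split; first by move: nn; clear; lia.
  have mn : m%:R <= n%:R :> R by rewrite ler_nat; move: nn; clear; lia.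
  have := lt_le_trans Hm mn; rewrite ltr_pdivrMr ?divr_gt0 // => h2.
  by rewrite E -[n.+1%:R]natr1; have := f0 x; move: h h2; nra.
have [m Hm] := exists_nat_gt (K / (e / 2)).
have [[|n] [nn h]] := He (n0 + m).+1 => //; exists n; split; first by move: nn; clear; lia.
have mn : m%:R <= n%:R :> R by rewrite ler_nat; move: nn; clear; lia.
have := lt_le_trans Hm mn; rewrite ltr_pdivrMr ?divr_gt0 // => h2.
have := fK x; move: h; rewrite E -[n.+1%:R]natr1; have := c_gt0; move: h2 e0; nra.
Qed.

Let mB (a : R) n : measurable [set x | a <= bsum f n x].
Proof.
rewrite -[X in measurable X]setTI.
by apply: measurable_fun_le => //; exact: measurable_bsum.
Qed.

Let mD : measurable D.
Proof.
rewrite (_ : D = \bigcup_j \bigcap_n0 \bigcup_(n in [set n | (n0 <= n)%N])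
   [set x | (c + j.+1%:R^-1) * n%:R <= bsum f n x]).
  apply: bigcupT_measurable => j; apply: bigcapT_measurable => n0.
  by apply: bigcup_measurable => n _; exact: mB.
apply/seteqP; split => x /=.
  move=> [j Hj]; exists j => // n0 _; have [n [nn h]] := Hj n0; by exists n.
move=> [j _ Hj]; exists j => n0; have [n nn h] := Hj n0 I; by exists n.
Qed.

Let V N := [set x | exists n, (0 < n <= N)%N /\ c * n%:R <= bsum f n x].

Let mV N : measurable (V N).
Proof.
rewrite (_ : V N = \bigcup_(n in [set n | (0 < n <= N)%N]) [set x | c * n%:R <= bsum f n x]).
  by apply: bigcup_measurable => n _; exact: mB.
by apply/seteqP; split => x /=; [move=> [n [h1 h2]]; exists n|move=> [n h1 h2]; exists n].
Qed.

Let D0 : mu D = 0%E.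
Proof.
have fin : (\int[mu]_x (f x)%:E)%E \is a fin_num.
  rewrite ge0_fin_numE; last by apply: integral_ge0 => x _; rewrite lee_fin.
  by apply: lt_trans cf _; rewrite ltry.
pose a := fine (\int[mu]_x (f x)%:E)%E.
have aE : (\int[mu]_x (f x)%:E)%E = a%:E by rewrite fineK.
have ac : a < c by rewrite -lte_fin -aE.
case: (erg mD DT) => // D1; exfalso.
(* Adding [c] on a set of measure below [eta] raises the integral by less than [(c - a) / 2], so it
   remains below [c]. *)
pose eta := (c - a) / (2 * c).
have eta0 : 0 < eta by rewrite divr_gt0 ?subr_gt0 // mulr_gt0.
have [N HN] : exists N, (mu (~` V N) < eta%:E)%E.
  apply: small_compl => //.
    by move=> n x [m [/andP[m0 mn] h]]; exists m; rewrite m0 leqW.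
  apply/eqP; rewrite eq_le probability_le1 //=; last exact: bigcupT_measurable.
  rewrite -D1; apply: le_measure; rewrite ?inE //; first exact: bigcupT_measurable.
  move=> x [j Hj]; have [n [n1 h]] := Hj 1%N; exists n => //; exists n; split.
    by rewrite n1 leqnn.
  apply: le_trans h; rewrite ler_wpM2r // lerDl invr_ge0 //.
(* Katznelson-Weiss: adding c on the small set where no good time is at most N lets every orbit be
   cut into pieces of average at least c. *)
pose g x := f x + c * \1_(~` V N) x.
have mg : measurable_fun setT g.
  apply: measurable_funD => //; apply: measurable_funM; first exact: measurable_cst.
  by apply: measurable_indic; exact: measurableC.
have g0 x : 0 <= g x by rewrite addr_ge0 // mulr_ge0 // ?ltW // indicE.
have fg x : f x <= g x by rewrite lerDl mulr_ge0 // ?ltW // indicE.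
(* Complete pieces have average at least [c]; only the last incomplete one, of length at most [N],
   is lost. *)
have Sg L x : c * (L%:R - N%:R) <= bsum g L x.
  elim/ltn_ind: L x => L IH x.
  have S0 n y : 0 <= bsum g n y by apply: sumr_ge0 => i _.
  have [LN|NL] := leqP L N.
    apply: le_trans (S0 L x); rewrite pmulr_rle0 // subr_le0 ler_nat //.
  have [[n [/andP[n0 nN] h]]|nV] := pselect (V N x).
    have nL : (n <= L)%N by apply: leq_trans (ltnW NL).
    rewrite -(subnKC nL) bsumD natrD.
    have := IH (L - n)%N ltac:(move: n0 nL; clear; lia) (iter n T x).
    have : bsum f n x <= bsum g n x by apply: ler_sum => i _.
    by move: h; lra.
  case: L NL IH => // L NL IH; rewrite -add1n bsumD bsum1 natrD.
  have := IH L (ltnSn L) (T x).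
  have : c <= g x by rewrite /g indicE mem_set // mulr1 lerDr.
  by lra.
have ig : (\int[mu]_x (g x)%:E = a%:E + c%:E * mu (~` V N))%E.
  rewrite /g; under eq_integral do rewrite EFinD EFinM.
  rewrite ge0_integralD //.
  - rewrite aE ge0_integralZl //.
    + rewrite integral_indic ?setIT //; exact: measurableC.
    + apply/measurable_EFinP; apply: measurable_indic; exact: measurableC.
    + by rewrite lee_fin ltW.
  - by move=> x _; rewrite lee_fin.
  - exact/measurable_EFinP.
  - by move=> x _; rewrite mule_ge0 // lee_fin ?ltW // indicE.
  - apply/measurable_EFinP; apply: measurable_funM; first exact: measurable_cst.
    by apply: measurable_indic; exact: measurableC.
have [v vE] := mu_fin (measurableC (mV N)).
have v0 : 0 <= v by rewrite -lee_fin -vE.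
pose b := a + c * v.
have bc : b < c.
  have : v < eta by rewrite -lte_fin -vE.
  rewrite -(ltr_pM2l c_gt0) /b /eta.
  have -> : c * ((c - a) / (2 * c)) = (c - a) / 2 by field; exact: lt0r_neq0 c_gt0.
  by move: ac; lra.
have [L HL] := exists_nat_gt (c * N%:R / (c - b)).
have cb : 0 < c - b by rewrite subr_gt0.
rewrite ltr_pdivrMr // in HL.
have LN : (N <= L)%N.
  rewrite -(ler_nat R) -(ler_pM2l c_gt0).
  have b0 : 0 <= b.
    rewrite addr_ge0 //; first by rewrite -lee_fin -aE; apply: integral_ge0 => x _; rewrite lee_fin.
    by apply: mulr_ge0 => //; exact: ltW.
  have L0 : 0 <= L%:R :> R by [].
  by move: HL b0 L0; nra.
have : ((c * (L%:R - N%:R))%:E <= L%:R%:E * b%:E)%E.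
  have <- : (\int[mu]_x (g x)%:E = b%:E)%E.
    by rewrite ig vE /b EFinD EFinM.
  rewrite -integral_bsum //.
  have -> : ((c * (L%:R - N%:R))%:E = \int[mu]_x (cst (c * (L%:R - N%:R))%:E x))%E.
    by rewrite integral_const.
  apply: ge0_le_integral => //.
  - by move=> x _; rewrite lee_fin mulr_ge0 ?(ltW c_gt0) // subr_ge0 ler_nat.
  - by apply/measurable_EFinP; exact: measurable_bsum.
  - by move=> x _; rewrite lee_fin.
rewrite lee_fin; move: HL; lra.
Qed.

Lemma half_birkhoff : \forall x \ae mu, forall c2, c < c2 ->
  exists n0, forall n, (n0 <= n)%N -> bsum f n x <= c2 * n%:R.
Proof.
exists D; split => //; move=> x /= H; apply: contrapT => nD; apply: H => c2 cc2.
apply: contrapT => H; apply: nD; apply/D_often; exists (c2 - c); first by rewrite subr_gt0.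
move=> n0; apply: contrapT => H2; apply: H; exists n0 => n nn; rewrite leNgt; apply/negP => h.
by apply: H2; exists n; split=> //; rewrite addrC subrK ltW.
Qed.

End HalfBirkhoff.
End Ergodic.

(** * Rational perturbations and measurable choices among countably many *)

Section Selection.
Context {d : measure_display} {X : measurableType d} {R : realType}.

Lemma measurable_piecewise (f : X -> R) (F : nat -> set X) (a : nat -> R) :
  (forall k, measurable (F k)) -> (forall x, exists k, F k x) ->
  (forall k x, F k x -> f x = a k) -> measurable_fun setT f.
Proof.
move=> mF cov fa _ Y mY; rewrite setTI.
rewrite (_ : f @^-1` Y = \bigcup_(k in [set k | Y (a k)]) F k); first exact: bigcup_measurable.
apply/seteqP; split => x /=.
  by move=> Yx; have [k Fk] := cov x; exists k => //=; rewrite -(fa k x Fk).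
by move=> [k /= Yk Fk]; rewrite /preimage /= (fa k x Fk).
Qed.

Lemma rat_approx (r e : R) : 0 < e -> exists q : rat, `|ratr q - r| <= e.
Proof.
move=> e0; have [|q] := @rat_in_itvoo R (r - e) (r + e); first by lra.
rewrite in_itv /= => /andP[h1 h2]; exists q.
by rewrite ler_norml; apply/andP; split; lra.
Qed.

Definition ratseq (w : seq rat) (i : nat) : R := ratr (nth 0 w i).

(** Rational parameters leave countably many candidates to choose from. The approximation moves the
    product by at most 1, which is at most its own norm: hence a factor 2 for [fro] and 4 for
    [hs]. *)
Lemma rational_perturbation (S : nat -> 'M[R]_2) (rho H : R) (N : nat) (r : nat -> R) :
  0 < rho -> 1 <= H -> (forall i, \det (S i) = 1) -> (forall i, hs (S i) <= H) ->
  (forall j, `|r j| <= rho) ->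
  exists w : seq rat, (forall i, `|ratseq w i| <= 2 * rho) /\
    hs (mprod (rots S (ratseq w)) N) <= 4 * hs (mprod (rots S r) N).
Proof.
move=> rho0 H1 dS HS rle.
pose M := Num.sqrt H.
have M1 : 1 <= M by rewrite -sqrtr1 ler_wsqrtr.
have M0 : 0 < M by lra.
have froS i : fro (S i) <= M by rewrite ler_wsqrtr.
pose D := N.+1%:R * (2 * M ^+ N) * (4 * M).
have D0 : 0 < D by rewrite !mulr_gt0 ?exprn_gt0.
pose e := Num.min rho D^-1.
have e0 : 0 < e by rewrite lt_min rho0 invr_gt0.
have [q Hq] := choice (fun i => rat_approx (r i) e0).
pose w := mkseq q N.
have wq i : (i < N)%N -> ratseq w i = ratr (q i) by move=> iN; rewrite /ratseq nth_mkseq.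
exists w; split=> [i|].
  have [iN|Ni] := ltnP i N; last first.
    by rewrite /ratseq nth_default ?size_mkseq // raddf0 normr0 mulr_ge0 ?ltW.
  rewrite wq //.
  have -> : ratr (q i) = (ratr (q i) - r i) + r i by rewrite subrK.
  apply: (le_trans (ler_normD _ _)); have := Hq i; have := rle i.
  have : e <= rho by rewrite ge_min lexx.
  lra.
have dist : fro (mprod (rots S (ratseq w)) N - mprod (rots S r) N) <= 1.
  have := @mprod_dist R (rots S (ratseq w)) (rots S r) M (4 * e * M) N M1.
  move=> /(_ ltac:(by rewrite !mulr_ge0 // ltW)).
  have hyp : forall i, (i < N)%N -> [/\ fro (rots S (ratseq w) i) <= M, fro (rots S r i) <= M &
    fro (rots S (ratseq w) i - rots S r i) <= 4 * e * M].
    move=> i iN; rewrite /rots !fro_rot_mul; split => //.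
    rewrite -mulmxBl; apply: (le_trans (fro_mul _ _)).
    apply: ler_pM; rewrite ?fro_ge0 //; apply: (le_trans (fro_rot_sub _ _)).
    by rewrite ler_pM2l // wq.
  move=> /(_ hyp) h; apply: (le_trans h).
  have eD : e <= D^-1 by rewrite ge_min lexx orbT.
  have : e * D <= 1 by rewrite -ler_pdivlMr // div1r.
  have NN : N%:R * (2 * M ^+ N) * (4 * e * M) <= e * D.
    rewrite /D (_ : N%:R * (2 * M ^+ N) * (4 * e * M) = e * (N%:R * (2 * M ^+ N) * (4 * M))); last by ring.
    rewrite ler_pM2l // ler_pM2r ?mulr_gt0 // ler_pM2r ?mulr_gt0 ?exprn_gt0 // ler_nat //.
  lra.
have f1 : 1 <= fro (mprod (rots S r) N).
  by apply: fro_ge1; apply: det_mprod => i _; exact: det_rots.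
rewrite -!sqr_fro.
have h : fro (mprod (rots S (ratseq w)) N) <= 2 * fro (mprod (rots S r) N).
  have -> : mprod (rots S (ratseq w)) N =
     (mprod (rots S (ratseq w)) N - mprod (rots S r) N) + mprod (rots S r) N by rewrite subrK.
  apply: (le_trans (fro_triangle _ _)); lra.
have -> : 4 * fro (mprod (rots S r) N) ^+ 2 = (2 * fro (mprod (rots S r) N)) ^+ 2 by ring.
by rewrite ler_pXn2r // nnegrE ?fro_ge0 // mulr_ge0 ?fro_ge0.
Qed.

Lemma rcos_continuous : continuous (@rcos R).
Proof.
move=> r; rewrite /rcos; apply: cvgM.
  apply: cvgB; first exact: cvg_cst.
  exact: exprn_continuous.
apply: cvgV; first exact: lt0r_neq0 (den_gt0 r).
by apply: cvgD; [exact: cvg_cst|exact: exprn_continuous].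
Qed.

Lemma rsin_continuous : continuous (@rsin R).
Proof.
move=> r; rewrite /rsin; apply: cvgM.
  by apply: cvgM; [exact: cvg_cst|exact: cvg_id].
apply: cvgV; first exact: lt0r_neq0 (den_gt0 r).
by apply: cvgD; [exact: cvg_cst|exact: exprn_continuous].
Qed.

Lemma measM_rot (phi : X -> R) : measurable_fun setT phi -> measM (fun x => rot (phi x)).
Proof.
move=> mphi.
have mc : measurable_fun setT (fun x => rcos (phi x)).
  by apply: (measurableT_comp _ mphi); apply: continuous_measurable_fun; exact: rcos_continuous.
have ms : measurable_fun setT (fun x => rsin (phi x)).
  by apply: (measurableT_comp _ mphi); apply: continuous_measurable_fun; exact: rsin_continuous.
move=> i j; elim/ord2P: i; elim/ord2P: j; under eq_fun do rewrite /rot mx2E.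
- exact: mc.
- exact: measurable_funN.
- exact: ms.
- exact: mc.
Qed.

End Selection.

(** * Towers whose base meets a bad set rarely *)

Section Towers.
Context {d : measure_display} {X : measurableType d} {R : realType}.
Variables (mu : probability X R) (T Tinv : X -> X).
Hypothesis imp : invertible_mp mu T Tinv.
Hypothesis erg : ergodic mu T.
Hypothesis na : nonatomic mu.

Let mT : measurable_fun setT T. Proof. by case: imp. Qed.
Let mTinv : measurable_fun setT Tinv. Proof. by case: imp. Qed.
Let TK : cancel T Tinv. Proof. by case: imp. Qed.
Let TinvK : cancel Tinv T. Proof. by case: imp. Qed.

Definition separated (E : set X) N :=
  forall x, E x -> forall j, (0 < j < N)%N -> ~ E (iter j T x).

Lemma separated_uniq E N x i j : separated E N -> (i < N)%N -> (j < N)%N ->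
  E (iter i Tinv x) -> E (iter j Tinv x) -> i = j.
Proof.
move=> sep; wlog ij : i j / (i <= j)%N.
  move=> H iN jN Ei Ej; have [h|/ltnW h] := leqP i j; first exact: H.
  by apply/esym; exact: H.
move=> iN jN Ei Ej; apply/eqP; rewrite eqn_leq ij /= leqNgt; apply/negP => lt.
apply: (sep _ Ej (j - i)%N); first by rewrite subn_gt0 lt /= (leq_ltn_trans (leq_subr _ _)).
by rewrite (iter_cancel TinvK) ?leq_subr // subKn.
Qed.

Lemma tower_sum (E S : set X) N : separated E N -> measurable E -> measurable S ->
  (\sum_(i < N) mu ((iter i Tinv @^-1` E) `&` S) <= mu S)%E.
Proof.
move=> sep mE mS.
pose F i := if (i < N)%N then (iter i Tinv @^-1` E) `&` S else set0.
have mF i : measurable (F i).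
  rewrite /F; case: ifP => // _; apply: measurableI => //.
  exact: measurable_preimage (measurable_iter i mTinv) mE.
have tF : trivIset setT F.
  move=> i j _ _ [x []]; rewrite /F; case: ifP => // iN [Ei _]; case: ifP => // jN [Ej _].
  exact: (separated_uniq sep iN jN Ei Ej).
have -> : (\sum_(i < N) mu ((iter i Tinv @^-1` E) `&` S) = \sum_(i < N) mu (F i))%E.
  by apply: eq_bigr => i _; rewrite /F ltn_ord.
rewrite -measure_bigsetU //; apply: le_measure; rewrite ?inE //.
  exact: bigsetU_measurable.
by rewrite -bigcup_mkord => x [i _]; rewrite /F; case: ifP => // _ [_ Sx].
Qed.

(** The [N] levels are disjoint, so some level meets [Bad] in at most the average. Taking it as the
    base preserves the other properties, because [T] is invertible and preserves [mu]. *)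
Lemma good_tower (Bad : set X) (N : nat) (e : R) : measurable Bad -> (0 < N)%N -> 0 < e ->
  exists E, [/\ measurable E, separated E N, (mu (~` tower Tinv E N) < e%:E)%E,
    (N%:R%:E * mu E <= 1)%E & (N%:R%:E * mu (E `&` Bad) <= mu Bad)%E].
Proof.
move=> mBad N0 e0.
have [E [mE sep cov]] := rokhlin imp erg na N0 e0.
have [i [iN Hi]] : exists i, (i < N)%N /\
   (N%:R%:E * mu ((iter i Tinv @^-1` E) `&` Bad) <= mu Bad)%E.
  apply: contrapT => H.
  have mI i : measurable ((iter i Tinv @^-1` E) `&` Bad).
    apply: measurableI => //; exact: measurable_preimage (measurable_iter i mTinv) mE.
  have [a Ha] := choice (fun i => mu_fin mu (mI i)).
  have [b Hb] := mu_fin mu mBad.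
  have := tower_sum sep mE mBad; rewrite Hb.
  under eq_bigr do rewrite Ha.
  rewrite sumEFin lee_fin => h.
  have : \sum_(i < N) (b / N%:R) < \sum_(i < N) a i.
    apply: ltr_sum; first by apply/hasP; exists (Ordinal N0); rewrite ?mem_index_enum.
    move=> i _; rewrite ltr_pdivrMr ?ltr0n // ltNge; apply/negP => h2; apply: H.
    exists i; split; first exact: ltn_ord.
    by rewrite Ha Hb -EFinM lee_fin mulrC.
  rewrite sumr_const card_ord -[(b / _) *+ _]mulr_natr divfK ?pnatr_eq0 -?lt0n // => h2.
  by have := lt_le_trans h2 h; rewrite ltxx.
exists (iter i Tinv @^-1` E); split => //.
- exact: measurable_preimage (measurable_iter i mTinv) mE.
- move=> x Ex j jN; have := sep _ Ex j jN; rewrite /preimage /=.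
  suff -> : iter j T (iter i Tinv x) = iter i Tinv (iter j T x) by [].
  elim: (j) => // k IH; rewrite !iterS IH; elim: (i) (iter k T x) => // l IHl y.
  by rewrite iterS TinvK iterSr TK.
- rewrite -(mu_iterTinv imp i) in cov; last by apply: measurableC; exact: (measurable_tower imp).
  apply: le_lt_trans cov; rewrite le_eqVlt; apply/orP; left; apply/eqP; congr (mu _).
  apply/seteqP; split => x /= h [k [kN Ek]]; apply: h; exists k; split=> //; move: Ek;
    by rewrite /preimage /= -!iterD addnC.
- have := tower_sum sep mE measurableT; rewrite probability_setT.
  under eq_bigr do rewrite setIT (mu_iterTinv imp) //.
  have [a aE] := mu_fin mu mE.
  rewrite (mu_iterTinv imp) // aE sumEFin sumr_const card_ord -EFinM mulr_natl //.
Qed.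

End Towers.

(** * Perturbations of small growth *)

Section LogGrowth.
Context {d : measure_display} {X : measurableType d} {R : realType}.
Variables (T : X -> X) (B : X -> 'M[R]_2).
Hypothesis dB : forall x, \det (B x) = 1.

(* Twice the logarithm of the Hilbert-Schmidt norm. *)
Definition lh (n : nat) (x : X) : R := ln (hs (mprod (fwd T B x) n)).

Lemma det_cocycle n x : \det (mprod (fwd T B x) n) = 1.
Proof. by apply: det_mprod => i _; exact: dB. Qed.

Lemma hs_gt0 (M : 'M[R]_2) : \det M = 1 -> 0 < hs M.
Proof. by move=> /hs_det1; apply: lt_le_trans. Qed.

Lemma lh_ge0 n x : 0 <= lh n x.
Proof.
apply: ln_ge0; apply: le_trans (hs_det1 (det_cocycle n x)); by rewrite ler1n.
Qed.

Lemma fwd_iter m x i : fwd T B (iter m T x) i = fwd T B x (m + i)%N.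
Proof. by rewrite /fwd -iterD addnC. Qed.

Lemma mprod_fwdD m n x : mprod (fwd T B x) (m + n) =
  mprod (fwd T B (iter m T x)) n *m mprod (fwd T B x) m.
Proof.
by rewrite mprodD; congr (_ *m _); apply: mprod_ext => i _; rewrite fwd_iter.
Qed.

Lemma lh_sub m n x : lh (m + n) x <= lh m x + lh n (iter m T x).
Proof.
rewrite /lh mprod_fwdD addrC -lnM ?posrE ?hs_gt0 ?det_cocycle //.
by rewrite ler_ln ?posrE ?mulr_gt0 ?hs_gt0 ?det_mulmx ?det_cocycle ?mulr1 // hs_mul.
Qed.

(** The inverse of a determinant one matrix has the same [hs], so undoing the last [n] steps costs
    no more than performing them. *)
Lemma lh_sub_rev m n x : lh m x <= lh (m + n) x + lh n (iter m T x).
Proof.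
rewrite /lh mprod_fwdD -lnM ?posrE ?hs_gt0 ?det_mulmx ?det_cocycle ?mulr1 //.
rewrite ler_ln ?posrE ?mulr_gt0 ?hs_gt0 ?det_mulmx ?det_cocycle ?mulr1 //.
by rewrite mulrC hs_le_mulr // det_cocycle.
Qed.

Lemma lh_le H n x : 2 <= H -> (forall i, (i < n)%N -> hs (B (iter i T x)) <= H) ->
  lh n x <= ln 2 + n%:R * ln H.
Proof.
move=> H2 HB; have H0 : 0 < H by lra.
have -> : ln 2 + n%:R * ln H = ln (2 * H ^+ n).
  by rewrite lnM ?posrE ?exprn_gt0 // lnXn // mulr_natl.
rewrite ler_ln ?posrE ?mulr_gt0 ?exprn_gt0 ?hs_gt0 ?det_cocycle //.
by apply: hs_mprod.
Qed.

Lemma measurable_lh n : measurable_fun setT T -> measM B -> measurable_fun setT (lh n).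
Proof.
move=> mT mB; apply: measurable_lnhs; apply: measM_mprod => i.
by apply: measM_comp => //; exact: measurable_iter.
Qed.

End LogGrowth.

Section Perturbation.
Context {d : measure_display} {X : measurableType d} {R : realType}.
Variables (mu : probability X R) (T Tinv : X -> X).
Hypothesis imp : invertible_mp mu T Tinv.
Hypothesis erg : ergodic mu T.
Hypothesis na : nonatomic mu.

Let mT : measurable_fun setT T. Proof. by case: imp. Qed.
Let mTinv : measurable_fun setT Tinv. Proof. by case: imp. Qed.
Let TK : cancel T Tinv. Proof. by case: imp. Qed.

Lemma shift_fwd (A : X -> 'M[R]_2) k x : shift k (fwd T A x) = fwd T A (iter k T x).
Proof. by apply/funext => i; rewrite fwd_iter. Qed.

Lemma visit_every_window (Gam : set X) (J L : nat) x :
  (forall j, (j < J)%N -> exists k, (k < L)%N /\ Gam (iter k T (iter (j * L.+1) T x))) ->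
  forall k, (k + 2 * L.+1 <= J * L.+1)%N ->
  exists k', (k <= k' < k + 2 * L.+1)%N /\ Gam (iter k' T x).
Proof.
(* [j] is [k / L.+1] rounded up: it gives the first checkpoint not before [k]. *)
move=> vis k kN; pose j := ((k + L) %/ L.+1)%N.
have jE : (k + L = j * L.+1 + (k + L) %% L.+1)%N by exact: divn_eq.
have rL : ((k + L) %% L.+1 <= L)%N by rewrite -ltnS ltn_mod.
have jJ : (j < J)%N.
  rewrite -(ltn_pmul2r (ltn0Sn L)); move: jE rL kN.
  generalize (j * L.+1)%N (J * L.+1)%N ((k + L) %% L.+1)%N; clear; lia.
have [l [lL Gl]] := vis j jJ.
exists (l + j * L.+1)%N; split; last by rewrite iterD.
move: jE rL lL; generalize (j * L.+1)%N ((k + L) %% L.+1)%N; clear; lia.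
Qed.

(** [Bad] collects the points where no rational sequence works. By [balanced_perturbation] this
    requires that one of the [J] checkpoints of the block is not followed by a visit to [Gam] within
    the next [L] times. [J] is fixed before [L]: [ln K] is at most a constant times [L.+1], which
    the length [N = J * L.+1] absorbs. *)
Lemma block_selection (A : X -> 'M[R]_2) (H rho delta eta : R) (m : nat) (Gam : set X) :
  measM A -> (forall x, \det (A x) = 1) -> (forall x, hs (A x) <= H) -> 2 <= H ->
  0 < rho -> measurable Gam -> (0 < mu Gam)%E ->
  (forall x, Gam x -> flexible rho m (fwd T A x)) -> 0 < delta -> 0 < eta ->
  exists N (theta : nat -> X -> R) (Bad : set X) (K : R),
  [/\ (0 < N)%N, measurable Bad, (mu Bad <= eta%:E)%E,
      (forall i, measurable_fun setT (theta i)) & (forall i x, `|theta i x| <= 2 * rho)] /\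
  [/\ 1 <= K, ln K <= delta * N%:R &
      forall x, ~ Bad x -> hs (mprod (rots (fwd T A x) (theta^~ x)) N) <= K].
Proof.
move=> mA dA HA H2 rho0 mGam Gam0 flexG delta0 eta0.
have H0 : 0 < H by lra.
have H1 : 1 <= H by lra.
have h0 : 0 < ln H by rewrite ln_gt0 //; lra.
(* 4 is the loss of [rational_perturbation] and 256 the constant of [balanced_perturbation]. *)
have [c1 c11 c1E] : exists2 c1 : R, 1 <= c1 & 4 * 256 = c1.
  by exists (4 * 256) => //; rewrite -natrM ler1n.
have c10 : 0 < c1 := lt_le_trans ltr01 c11.
have lnc1 : 0 <= ln c1 by rewrite ln_ge0.
(* The exponent of [K] below is [2 + 4 L0 + 2 m], at most [(6 + 2 m) L0]. *)
pose cst := ln c1 + (6 + 2 * m%:R) * ln H.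
have cst0 : 0 < cst by rewrite ltr_wpDl // mulr_gt0 // ltr_wpDr // mulr_ge0.
have [J HJ] := exists_nat_gt (cst / delta).
have J0 : 0 < J%:R :> R by apply: lt_trans HJ; rewrite divr_gt0.
have [L HL] := hitting_time imp erg mGam Gam0 (divr_gt0 eta0 J0).
pose L0 := L.+1; pose N := (J * L0)%N.
pose K := c1 * H ^+ (2 + 2 * (2 * L0) + 2 * m).
pose w k := odflt [::] (unpickle k : option (seq rat)).
pose ok k := forall i, `|ratseq (w k) i : R| <= 2 * rho.
pose S k := [set x | ok k /\ hs (mprod (rots (fwd T A x) (ratseq (w k))) N) <= K].
have mS k : measurable (S k).
  have [okk|nok] := pselect (ok k); last first.
    by rewrite (_ : S k = set0) //; apply/seteqP; split => x // [].
  rewrite (_ : S k = setT `&` [set x | hs (mprod (rots (fwd T A x) (ratseq (w k))) N) <= K]).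
    apply: measurable_fun_le => //; apply: measurable_hs; apply: measM_mprod => i.
    apply: measM_mul; first exact: measM_cst.
    by apply: measM_comp => //; exact: measurable_iter.
  by apply/seteqP; split => x /=; [move=> []|move=> [_ h]; split].
pose Bad := \bigcap_k ~` S k.
have mBad : measurable Bad by apply: bigcapT_measurable => k; exact: measurableC.
(* A measurable partition: [F 0] is [Bad], and [F k.+1] holds the points for which candidate [k] is
   the first to succeed. *)
pose F k := if k is k'.+1 then S k' `&` \bigcap_(j in [set j | (j < k')%N]) ~` S j else Bad.
have mF k : measurable (F k).
  case: k => [//|k] /=; apply: measurableI => //.
  by apply: bigcap_measurableType => j _; exact: measurableC.
have cov x : exists k, F k x.
  have [[k Sk]|nS] := pselect (exists k, S k x); last first.
    by exists 0%N => k _ Sk; apply: nS; exists k.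
  have exk : exists k, `[< S k x >] by exists k; apply/asboolP.
  case: (ex_minnP exk) => n /asboolP Sn nmin; exists n.+1; split => // j /= jn Sj.
  by have := nmin j (asboolT Sj); rewrite leqNgt jn.
have Funiq k l x : F k x -> F l x -> k = l.
  wlog kl : k l / (k <= l)%N.
    move=> W Fk Fl; have [h|/ltnW h] := leqP k l; first exact: W.
    by apply/esym; exact: W.
  case: k l kl => [|k] [|l] //=; first by move=> _ h [Sl _]; case: (h l).
  rewrite ltnS leq_eqVlt => /predU1P[-> //|kl [Sk _] [_ /(_ k kl)]].
  by case.
have [idx Hidx] := choice cov.
pose a i k : R := if k is k'.+1 then ratseq (w k') i else 0.
exists N, (fun i x => a i (idx x)), Bad, K; split; split.
- by rewrite muln_gt0 -(ltr0n R) J0.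
- exact: mBad.
- pose Nv := ~` [set x | exists k, (k < L)%N /\ Gam (iter k T x)].
  have mNv : measurable Nv.
    apply: measurableC.
    rewrite (_ : [set x | _] = \bigcup_(k in [set k | (k < L)%N]) (iter k T @^-1` Gam)).
      apply: bigcup_measurable => k _; exact: measurable_preimage (measurable_iter k mT) mGam.
    by apply/seteqP; split => x /=; [move=> [k [kn Hk]]; exists k|move=> [k kn Hk]; exists k].
  pose Bad' := \bigcup_(j in [set j | (j < J)%N]) (iter (j * L0) T @^-1` Nv).
  have mpre j : measurable (iter (j * L0) T @^-1` Nv).
    exact: measurable_preimage (measurable_iter _ mT) mNv.
  have mBad' : measurable Bad' by apply: bigcup_measurable => j _.
  apply: (@le_trans _ _ (mu Bad')).
    apply: le_measure; rewrite ?inE // => x Badx; apply: contrapT => nB.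
    have vis j : (j < J)%N -> exists k, (k < L)%N /\ Gam (iter k T (iter (j * L.+1) T x)).
      by move=> jJ; apply: contrapT => h; apply: nB; exists j.
    have [|r rle rK] := @balanced_perturbation R rho H (fwd T A x) N (2 * L0) m (ltW rho0) H2
        (fun i => dA _) (fun i => HA _).
      move=> k kN; have [k' [kk' Gk']] := visit_every_window vis kN.
      by exists k'; split => //; rewrite shift_fwd; exact: flexG.
    have [q [qle qK]] := rational_perturbation N rho0 H1 (fun i => dA (iter i T x))
        (fun i => HA (iter i T x)) rle.
    apply: (Badx (pickle q)) => //; rewrite /S /= /ok /w pickleK /=; split => //.
    apply: (le_trans qK); rewrite /K.
    by rewrite -c1E -mulrA ler_pM2l.
  have := @finite_union_bound _ _ _ mu (fun j => iter (j * L0) T @^-1` Nv) (eta / J%:R) J mpre.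
  rewrite [J%:R * _]mulrC divfK ?lt0r_neq0 //; apply => j jJ.
  by rewrite (mu_iterT imp) // ltW.
- move=> i; apply: (@measurable_piecewise _ _ _ _ F (a i)) => //.
  by move=> k x Fk; rewrite (Funiq _ _ _ (Hidx x) Fk).
- move=> i x; have := Hidx x; rewrite /a; case: (idx x) => [_|k [[okk _] _]].
    by rewrite normr0 mulr_ge0 // ltW.
  exact: okk.
- by apply: mulr_ege1 => //; rewrite exprn_ege1.
- rewrite /K lnM ?posrE ?exprn_gt0 // lnXn // -[ln H *+ _]mulr_natl.
  apply: (@le_trans _ _ (L0%:R * cst)).
    have L1 : 1 <= L0%:R :> R by rewrite ler1n.
    rewrite /cst !natrD !natrM !mulrDr mulrA.
    have m0 : 0 <= m%:R * ln H by rewrite mulr_ge0 // ltW.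
    move: (ln c1) lnc1 => l1 l10.
    have t1 : 0 <= (L0%:R - 1) * l1 by rewrite mulr_ge0 // subr_ge0.
    have t2 : 0 <= (L0%:R - 1) * (m%:R * ln H) by rewrite mulr_ge0 // subr_ge0.
    have t3 : 0 <= (L0%:R - 1) * ln H by rewrite mulr_ge0 ?subr_ge0 // ltW.
    lra.
  rewrite /N natrM mulrA mulrC ler_wpM2r //.
  by move: HJ; rewrite ltr_pdivrMr // mulrC => /ltW.
- move=> x nB; have := Hidx x; case: (idx x) => [Bx|k [[okk hk] _]]; first by case: nB.
  exact: hk.
Qed.

Lemma measurable_bigsum N (f : nat -> X -> R) : (forall i, measurable_fun setT (f i)) ->
  measurable_fun setT (fun x => \sum_(i < N) f i x).
Proof.
move=> mf; elim: N => [|N IH].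
  by under eq_fun do rewrite big_ord0; exact: measurable_cst.
by under eq_fun do rewrite big_ord_recr /=; exact: measurable_funD.
Qed.

Lemma integral_scaled_indic (a : R) (S : set X) : 0 <= a -> measurable S ->
  (\int[mu]_x (a * \1_S x)%:E = a%:E * mu S)%E.
Proof.
move=> a0 mS; under eq_integral do rewrite EFinM.
rewrite ge0_integralZl //.
- by rewrite integral_indic ?setIT.
- by apply/measurable_EFinP; apply: measurable_indic.
Qed.

Lemma measurable_scaled_indic (a : R) (S : set X) : measurable S ->
  measurable_fun setT (fun x => a * \1_S x).
Proof.
move=> mS; apply: measurable_funM; first exact: measurable_cst.
exact: measurable_indic.
Qed.

(** The rotations chosen at a base point are copied along its tower block, so that the block product
    has [hs] at most [K] unless the base point is bad. Three costs remain: good blocks, bad blocks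
    and points off the tower. *)
Lemma perturbed_growth (A : X -> 'M[R]_2) (H rho delta : R) (m : nat) (Gam : set X) :
  measM A -> (forall x, \det (A x) = 1) -> (forall x, hs (A x) <= H) -> 2 <= H ->
  0 < rho -> measurable Gam -> (0 < mu Gam)%E ->
  (forall x, Gam x -> flexible rho m (fwd T A x)) -> 0 < delta ->
  exists B : X -> 'M[R]_2, [/\ measM B, (forall x, \det (B x) = 1),
    (forall x, hs (B x) <= H), (forall x, fro (B x - A x) <= 8 * rho * Num.sqrt H) &
    exists n, (0 < n)%N /\ (\int[mu]_x (lh T B n x)%:E < (n%:R * delta)%:E)%E].
Proof.
move=> mA dA HA H2 rho0 mGam Gam0 flexG delta0.
have H0 : 0 < H by lra.
have h0 : 0 < ln H by rewrite ln_gt0 //; lra.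
(* The budget is [delta / 2]: [delta / 12] for points off the tower, [delta / 4] for good blocks and
   [delta / 6] for bad ones, whose cost [C0] is at most [2 N ln H]. *)
pose eta := delta / (12 * ln H).
have eta0 : 0 < eta by rewrite divr_gt0 ?mulr_gt0.
have etaE : ln H * eta = delta / 12 by rewrite /eta; field; exact: lt0r_neq0.
have d4 : 0 < delta / 4 by rewrite divr_gt0.
have [N [theta [Bad [K [[N0 mBad Bade mth thle] [K1 lnK HK]]]]]] :=
  block_selection mA dA HA H2 rho0 mGam Gam0 flexG d4 eta0.
have [E [mE sep tE NE NEB]] := good_tower imp erg na mBad N0 eta0.
(* At most one indicator is nonzero, that of the level containing [y]; off the tower there is no
   rotation. *)
pose phi y := \sum_(i < N) \1_E (iter i Tinv y) * theta i (iter i Tinv y).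
have phi_at x j : E x -> (j < N)%N -> phi (iter j T x) = theta j x.
  move=> Ex jN; rewrite /phi (bigD1 (Ordinal jN)) //= (iterTinvK imp).
  rewrite indicE mem_set // mul1r big1 ?addr0 // => i ij.
  rewrite indicE memNset ?mul0r // => Ei; move/eqP: ij; apply; apply: val_inj => /=.
  apply: (separated_uniq imp sep (ltn_ord i) jN Ei).
  by rewrite (iterTinvK imp).
have phi_le y : `|phi y| <= 2 * rho.
  have [[i [iN Ei]]|nt] := pselect (tower Tinv E N y).
    by rewrite -(iterTK imp i y) phi_at.
  rewrite /phi big1 ?normr0 ?mulr_ge0 ?(ltW rho0) // => i _.
  rewrite indicE memNset ?mul0r // => Ei; apply: nt; exists i; split => //.
have mphi : measurable_fun setT phi.
  apply: (measurable_bigsum N (f := fun i y => \1_E (iter i Tinv y) * theta i (iter i Tinv y))) => i.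
  apply: measurable_funM.
    have mi : measurable_fun setT (\1_E : X -> R) by exact: measurable_indic.
    by apply: (measurableT_comp mi); exact: measurable_iter.
  by apply: (measurableT_comp (mth i)); exact: measurable_iter.
pose B y := rot (phi y) *m A y.
have dB x : \det (B x) = 1 by rewrite det_mulmx det_rot dA mulr1.
have HB x : hs (B x) <= H by rewrite hs_rot_mul.
have mB : measM B by apply: measM_mul => //; exact: measM_rot.
have BE x : E x -> mprod (fwd T B x) N = mprod (rots (fwd T A x) (theta^~ x)) N.
  by move=> Ex; apply: mprod_ext => i iN; rewrite /fwd /rots /B phi_at.
exists B; split => //.
  move=> x; apply: (le_trans (fro_rot_mul_sub _ _)).
  apply: ler_pM; rewrite ?fro_ge0 ?mulr_ge0 //; last by rewrite ler_wsqrtr.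
  have := phi_le x; lra.
pose C0 := ln 2 + N%:R * ln H.
have ln2 : 0 < ln 2 :> R by rewrite ln_gt0 // ltr1n.
have ln2H : ln 2 <= ln H by rewrite ler_ln ?posrE.
have NR : 1 <= N%:R :> R by rewrite ler1n.
have C00 : 0 < C0 by rewrite ltr_wpDr // mulr_ge0 // ltW.
have lnK0 : 0 <= ln K by rewrite ln_ge0.
have lhC n x : (n <= N)%N -> lh T B n x <= C0.
  move=> nN; apply: (le_trans (lh_le dB H2 (fun i _ => HB _))).
  by rewrite lerD2l ler_wpM2r ?ler_nat // ltW.
pose nt := ~` tower Tinv E N.
have mnt : measurable nt by apply: measurableC; exact: (measurable_tower imp).
(* Cutting an orbit into tower blocks and uncovered points, [hh] charges each block at its base
   and each uncovered point separately. *)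
pose hh x := ln H * \1_nt x + ln K * \1_E x + C0 * \1_(E `&` Bad) x.
have i0 (S : set X) x : 0 <= \1_S x :> R by rewrite indicE.
have p1 (S : set X) x (a : R) : 0 <= a -> 0 <= a * \1_S x by move=> a0; exact: mulr_ge0.
have hh0 x : 0 <= hh x by rewrite !addr_ge0 ?p1 // ltW.
have bs0 n x : 0 <= bsum T hh n x by apply: sumr_ge0.
have hhE x : E x -> lh T B N x <= hh x.
  move=> Ex; have [Bx|nBx] := pselect (Bad x).
    apply: (le_trans (lhC N x (leqnn N))); rewrite /hh [\1_(E `&` Bad) x]indicE mem_set // mulr1.
    by rewrite lerDr addr_ge0 ?p1 // ltW.
  have : lh T B N x <= ln K.
    by rewrite /lh BE // ler_ln ?posrE ?HK // ?(lt_le_trans ltr01 K1) // -BE // hs_gt0 // det_cocycle.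
  move/le_trans; apply; rewrite /hh [\1_E x]indicE mem_set // mulr1.
  by have := p1 nt x _ (ltW h0); have := p1 (E `&` Bad) x _ (ltW C00); lra.
have hhnt x : nt x -> ln H <= hh x.
  move=> ntx; rewrite /hh [\1_nt x]indicE mem_set // mulr1.
  by have := p1 E x _ lnK0; have := p1 (E `&` Bad) x _ (ltW C00); lra.
(* Places where an orbit may be cut. After a full block or an uncovered point the orbit is again at
   such a place. *)
pose al x := E x \/ nt x.
have alE x : E x -> al (iter N T x).
  move=> Ex; have [[i [iN Ei]]|?] := pselect (tower Tinv E N (iter N T x)); last by right.
  have e : iter i Tinv (iter N T x) = iter (N - i) T x.
    by rewrite -{1}(subnKC (ltnW iN)) iterD (iterTinvK imp).
  case: i iN Ei e => [|i] iN Ei e; first by left.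
  exfalso; apply: (sep x Ex (N - i.+1)%N); first by rewrite subn_gt0 iN /= ltn_subrL.
  by rewrite -e.
have alnt x : nt x -> al (T x).
  move=> ntx; have [[[|i] [iN Ei]]|?] := pselect (tower Tinv E N (T x)); last by right.
    by left.
  exfalso; apply: ntx; exists i; split; first exact: ltnW.
  by move: Ei; rewrite iterSr TK.
have claim1 n x : al x -> lh T B n x <= bsum T hh n x + C0.
  elim/ltn_ind: n x => n IH x alx.
  have [nN|Nn] := leqP n N.
    by apply: (le_trans (lhC n x nN)); rewrite lerDr.
  case: alx => [Ex|ntx].
    rewrite -(subnKC (ltnW Nn)) bsumD.
    have hb : hh x <= bsum T hh N x.
      rewrite -(prednK N0) -(add1n N.-1) bsumD bsum1 lerDl //.
    have := lh_sub T dB N (n - N) x; have := hhE x Ex.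
    have := IH (n - N)%N ltac:(by rewrite ltn_subrL N0 (leq_ltn_trans _ Nn)) _ (alE x Ex).
    lra.
  case: n IH Nn => // n IH Nn; rewrite -(add1n n) bsumD bsum1.
  have := lh_sub T dB 1 n x; have := hhnt x ntx; have := IH n (ltnSn n) _ (alnt x ntx).
  have : lh T B 1 x <= ln H.
    rewrite /lh /= mulmx1 ler_ln ?posrE //; try exact: HB; exact: (hs_gt0 (dB _)).
  rewrite /=; lra.
have claim2 x : exists s, (s <= N)%N /\ al (iter s T x).
  have [[i [iN Ei]]|ntx] := pselect (tower Tinv E N x); last by exists 0%N; split => //; right.
  exists (N - i)%N; split; first exact: leq_subr.
  have := alE _ Ei; rewrite -{1}(subnK (ltnW iN)) iterD (iterTK imp) //.
(* One [C0] pays for the last incomplete block, the other for the steps before the first cutting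
   place. *)
have claim3 n x : lh T B n x <= bsum T hh n x + (C0 + C0).
  have [s [sN als]] := claim2 x.
  have [ns|sn] := leqP n s.
    by have := lhC n x (leq_trans ns sN); have := bs0 n x; lra.
  rewrite -(subnKC (ltnW sn)) bsumD.
  have := lh_sub T dB s (n - s) x; have := lhC s x sN; have := claim1 (n - s)%N _ als.
  by have := bs0 s x; lra.
have mhh : measurable_fun setT hh.
  apply: measurable_funD; first apply: measurable_funD; apply: measurable_scaled_indic => //.
  exact: measurableI.
have ihh : (\int[mu]_x (hh x)%:E <= (delta / 2)%:E)%E.
  have mEB : measurable (E `&` Bad) by exact: measurableI.
  have [t tt] := mu_fin mu mnt; have [e ee] := mu_fin mu mE.
  have [b bb] := mu_fin mu mEB; have [b' bb'] := mu_fin mu mBad.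
  have -> : (\int[mu]_x (hh x)%:E = (ln H * t + ln K * e + C0 * b)%:E)%E.
    rewrite /hh; under eq_integral do rewrite EFinD EFinD.
    rewrite ge0_integralD //.
    - rewrite ge0_integralD //.
      + by rewrite !integral_scaled_indic // ?(ltW h0) ?(ltW C00) // tt ee bb !EFinD !EFinM.
      + by move=> x _; rewrite lee_fin p1 // ltW.
      + by apply/measurable_EFinP; exact: measurable_scaled_indic.
      + by move=> x _; rewrite lee_fin p1.
      + by apply/measurable_EFinP; exact: measurable_scaled_indic.
    - by move=> x _; rewrite -EFinD lee_fin addr_ge0 ?p1 // ltW.
    - apply/measurable_EFinP; apply: measurable_funD; exact: measurable_scaled_indic.
    - by move=> x _; rewrite lee_fin p1 // ltW.
    - by apply/measurable_EFinP; exact: measurable_scaled_indic.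
  rewrite lee_fin.
  move: tE NE NEB Bade; rewrite -/nt tt ee bb bb' -!EFinM lte_fin !lee_fin => t1 t2 t3 t4.
  have e0 : 0 <= e by rewrite -lee_fin -ee.
  have b0 : 0 <= b by rewrite -lee_fin -bb.
  have s1 : ln H * t <= delta / 12 by rewrite -etaE ler_wpM2l // ltW.
  have s2 : ln K * e <= delta / 4.
    have h := ler_wpM2l (ltW d4) t2; rewrite mulr1 mulrA in h.
    exact: le_trans (ler_wpM2r e0 lnK) h.
  have s3 : C0 * b <= delta / 6.
    have c0 : C0 <= 2 * ln H * N%:R by rewrite /C0; nra.
    apply: (le_trans (ler_wpM2r b0 c0)); rewrite -mulrA.
    have := ler_wpM2l (ltW h0) (le_trans t3 t4); rewrite etaE; lra.
  lra.
(* [n] is so large that the boundary cost [C0 + C0] is below the remaining [n * delta / 2]. *)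
have [n Hn] := exists_nat_gt (4 * C0 / delta).
have n0 : 0 < n%:R :> R by apply: lt_trans Hn; rewrite divr_gt0 ?mulr_gt0.
exists n; split; first by rewrite -(ltr0n R).
apply: (@le_lt_trans _ _ (\int[mu]_x ((bsum T hh n x)%:E + (C0 + C0)%:E))%E).
  apply: ge0_le_integral => //.
  - by move=> x _; rewrite lee_fin lh_ge0.
  - by apply/measurable_EFinP; exact: measurable_lh.
  - apply: emeasurable_funD => //.
    by apply/measurable_EFinP; exact: (measurable_bsum imp).
  - by move=> x _; rewrite -EFinD lee_fin.
rewrite ge0_integralD //; last 3 first.
- by move=> x _; rewrite lee_fin.
- by apply/measurable_EFinP; exact: (measurable_bsum imp).
- by move=> x _; rewrite lee_fin addr_ge0 // ltW.
rewrite (integral_bsum imp) // [X in (_ + X)%E](integral_const mu (C0 + C0)%:E).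
apply: (@le_lt_trans _ _ (n%:R%:E * (delta / 2)%:E + (C0 + C0)%:E)%E).
  by rewrite leeD2r // lee_wpmul2l // lee_fin.
rewrite -EFinM -EFinD lte_fin; move: Hn; rewrite ltr_pdivrMr //; lra.
Qed.

End Perturbation.

(** * The dichotomy *)

(** The smaller constant is at most 1/4 and the larger at least 1; they are the constants of
    [notfull_lyapforms]. *)
Lemma half_sine_bounds (R : realFieldType) (s H : R) : 0 < s -> s <= 1 -> 2 <= H ->
  0 < s / 2 / H < H / (2 * s).
Proof.
move=> s0 s1 H2; have H0 : 0 < H by lra.
have q1 : s / 2 / H <= 4^-1 by rewrite ler_pdivrMr //; lra.
apply/andP; split; first by apply: divr_gt0 => //; exact: divr_gt0.
apply: (le_lt_trans q1); rewrite ltr_pdivlMr; last exact: mulr_gt0.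
lra.
Qed.

Section Dichotomy.
Context {d : measure_display} {X : measurableType d} {R : realType}.
Variables (mu : probability X R) (T Tinv : X -> X).
Hypothesis imp : invertible_mp mu T Tinv.
Hypothesis erg : ergodic mu T.
Hypothesis na : nonatomic mu.

Let mT : measurable_fun setT T. Proof. by case: imp. Qed.
Let mTinv : measurable_fun setT Tinv. Proof. by case: imp. Qed.
Let TK : cancel T Tinv. Proof. by case: imp. Qed.
Let TinvK : cancel Tinv T. Proof. by case: imp. Qed.

Section Bounded.
Variables (A : X -> 'M[R]_2) (H : R).
Hypothesis mA : measM A.
Hypothesis dA : forall x, \det (A x) = 1.
Hypothesis HA : forall x, hs (A x) <= H.
Hypothesis H2 : 2 <= H.

Definition fullset (rho : R) (m : nat) : set X :=
  [set x | forall pq, netv pq != 0 :> 'cV[R]_2 -> full rho m (fwd T A x) (netv pq)].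

Lemma measurable_fullset rho m : measurable (fullset rho m).
Proof.
pose pq k := odflt (0, 0) (unpickle k : option (int * int)).
rewrite (_ : fullset rho m = \bigcap_k [set x | netv (pq k) != 0 :> 'cV[R]_2 ->
   full rho m (fwd T A x) (netv (pq k))]); last first.
  apply/seteqP; split => x /= h; first by move=> k _ h0; exact: h.
  by move=> q q0; have := h (pickle q) I; rewrite /pq /= pickleK; apply.
apply: bigcapT_measurable => k.
have [->|q0] := eqVneq (netv (pq k) : 'cV[R]_2) 0.
  by rewrite (_ : [set x | _] = setT) //; apply/seteqP; split.
rewrite (_ : [set x | _] = \bigcup_(i in [set i | (0 < i <= m)%N]) (setT `&`
   [set x | d2 (ua rho (fwd T A x) (netv (pq k)) i) (ub rho (fwd T A x) (netv (pq k)) i) <= 0])).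
  apply: bigcup_measurable => i _; apply: measurable_fun_le => //.
  apply: measurable_d2; apply: measM_mprod => j; apply: measM_mul; try exact: measM_cst.
    by apply: measM_comp => //; exact: measurable_iter.
  by apply: measM_comp => //; exact: measurable_iter.
apply/seteqP; split => x /=; first by move=> /(_ isT)[i [im h]]; exists i.
by move=> [i /= im [_ h]] _; exists i.
Qed.

Lemma rsin_le1 (r : R) : rsin r <= 1.
Proof.
by have := rcs1 r; have := sqr_ge0 (rcos r); nra.
Qed.

(** The net vector whose cone stays open may vary with the point and with [n]; only the constants
    must be uniform, and these depend on [rho] and [H] alone. *)
Lemma dichotomy (eps delta : R) : 0 < eps -> 0 < delta ->
  uniformly_hyperbolic T Tinv mu A \/
  exists B : X -> 'M[R]_2, [/\ measM B, (forall x, \det (B x) = 1),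
    (forall x, hs (B x) <= H), (forall x, fro (B x - A x) <= eps) &
    exists n, (0 < n)%N /\ (\int[mu]_x (lh T B n x)%:E < (n%:R * delta)%:E)%E].
Proof.
move=> eps0 delta0.
have H0 : 0 < H by apply: lt_le_trans H2.
have H1 : 1 <= H by apply: le_trans H2; rewrite ler1n.
have sH : 0 < Num.sqrt H by rewrite sqrtr_gt0.
(* [perturbed_growth] moves the cocycle by at most [8 * rho * Num.sqrt H]. *)
pose rho := Num.min 2^-1 (eps / (8 * Num.sqrt H)).
have rho0 : 0 < rho by rewrite lt_min invr_gt0 ltr0n /= divr_gt0 // mulr_gt0.
have rho1 : rho < 1 by rewrite gt_min invf_lt1 // ltr1n.
have rho01 : 0 < rho < 1 by rewrite rho0.
have [[m Hm]|null] := pselect (exists m, (0 < mu (fullset rho m))%E).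
  right.
  have flexG x : fullset rho m x -> flexible rho m (fwd T A x).
    by move=> fx; apply: full_flexible => // i; exact: dA.
  have [B [mB dB HB AB Bn]] := perturbed_growth imp erg na mA dA HA H2 rho0
    (measurable_fullset rho m) Hm flexG delta0.
  exists B; split => // x; apply: (le_trans (AB x)).
  have : rho <= eps / (8 * Num.sqrt H) by rewrite ge_min lexx orbT.
  by rewrite ler_pdivlMr ?mulr_gt0 // mulrCA mulrA.
left.
have null' m : mu (fullset rho m) = 0%E.
  apply/eqP; rewrite eq_le measure_ge0 andbT leNgt; apply/negP => h.
  by apply: null; exists m.
(* Whole orbits in both directions, so that [G] is preserved by [T] and [Tinv]. *)
pose G := [set x | forall k m, ~ fullset rho m (iter k T x) /\ ~ fullset rho m (iter k Tinv x)].
have mG : measurable G.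
  rewrite (_ : G = \bigcap_k \bigcap_m (~` (iter k T @^-1` fullset rho m) `&`
     ~` (iter k Tinv @^-1` fullset rho m))).
    apply: bigcapT_measurable => k; apply: bigcapT_measurable => m.
    apply: measurableI; apply: measurableC.
      exact: measurable_preimage (measurable_iter k mT) (measurable_fullset rho m).
    exact: measurable_preimage (measurable_iter k mTinv) (measurable_fullset rho m).
  by apply/seteqP; split => x /= h k; [move=> _ m _; exact: h|move=> m; exact: (h k I m I)].
have aeG : \forall x \ae mu, G x.
  have ae0 m : \forall x \ae mu, ~ fullset rho m x.
    exists (fullset rho m); split => //; first exact: measurable_fullset.
    by move=> x /= /contrapT.
  apply: ae_foralln => k; apply: ae_foralln => m.
  have h1 := ae_iterT imp k (ae0 m); have h2 := ae_iterTinv imp k (ae0 m).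
  by apply: filterS2 h1 h2 => x a b.
have GT x : G x -> G (T x).
  move=> Gx k m; split; first by have [] := Gx k.+1 m; rewrite iterSr.
  case: k => [|k]; first by have [] := Gx 1%N m.
  by rewrite iterSr TK; have [] := Gx k m.
have GTinv x : G x -> G (Tinv x).
  move=> Gx k m; split; last by have [_] := Gx k.+1 m; rewrite iterSr.
  case: k => [|k]; first by have [] := Gx 1%N m.
  by rewrite iterSr TinvK; have [] := Gx k m.
have s0 := rsin_gt0 rho01; have s1 := rsin_le1 rho.
have cC := half_sine_bounds s0 s1 H2.
apply: (forms_uniformly_hyperbolic TK TinvK mT mTinv mA dA HA H1 cC mG aeG GT GTinv).
move=> x Gx n.
(* [notfull_lyapforms] drops the first two matrices, so the cone is started at [iter 2 Tinv x]. *)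
have [nf _] : ~ fullset rho (n + 3) (iter 2 Tinv x) /\ True.
  by split => //; have [] := Gx 2%N (n + 3)%N.
have [pq [q0 nfull]] : exists pq, netv pq != 0 :> 'cV[R]_2 /\
    ~ full rho (n + 3) (fwd T A (iter 2 Tinv x)) (netv pq).
  apply: contrapT => h; apply: nf => pq q0; apply: contrapT => h2.
  by apply: h; exists pq.
have := notfull_lyapforms rho01 H1 (fun i => dA _) (fun i => HA _) q0 nfull.
by rewrite shift_fwd (iterTK imp 2).
Qed.

(* Averaging subadditivity over the n starting phases compares n lh_k with a Birkhoff sum of lh_n. *)
Lemma lyapunov_upper n (c : R) : (0 < n)%N ->
  (\int[mu]_x (lh T A n x)%:E < (n%:R * c)%:E)%E ->
  \forall x \ae mu, forall c2, c < c2 ->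
    exists k0, forall k, (k0 <= k)%N -> lh T A k x <= c2 * k%:R.
Proof.
move=> n0 intc.
have nR : 0 < n%:R :> R by rewrite ltr0n.
pose C1 := ln 2 + n%:R * ln H.
have lnH : 0 <= ln H by rewrite ln_ge0 // (le_trans _ H2) // ler1n.
have ln2 : 0 <= ln 2 :> R by rewrite ln_ge0 // ler1n.
have lhC i x : (i <= n)%N -> lh T A i x <= C1.
  move=> ni; apply: (le_trans (lh_le dA H2 (fun i _ => HA _))).
  by rewrite lerD2l ler_wpM2r ?ler_nat.
have C10 : 0 <= C1 by rewrite addr_ge0 // mulr_ge0.
have sub x k : n%:R * lh T A k x <= bsum T (lh T A n) k x + 2 * n%:R * C1.
  pose Phi k := \sum_(i < n) lh T A (k + i) x.
  have PhiS k' : Phi k'.+1 <= Phi k' + lh T A n (iter k' T x).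
    have e1 : Phi k' + lh T A (k' + n) x = lh T A k' x + Phi k'.+1.
      transitivity (\sum_(i < n.+1) lh T A (k' + i) x); first by rewrite big_ord_recr.
      rewrite big_ord_recl addn0; congr (_ + _).
      by apply: eq_bigr => i _; rewrite lift0 addnS addSn.
    by have := lh_sub T dA k' n x; lra.
  have PhiB k' : Phi k' <= Phi 0%N + bsum T (lh T A n) k' x.
    elim: k' => [|k' IH]; first by rewrite /bsum big_ord0 addr0.
    by rewrite /bsum big_ord_recr /= -/(bsum _ _ _ _); have := PhiS k'; lra.
  have Phi0 : Phi 0%N <= n%:R * C1.
    rewrite mulr_natl -[X in _ *+ X]card_ord -sumr_const; apply: ler_sum => i _.
    by rewrite add0n; apply: lhC; exact: ltnW.
  have Phik : n%:R * lh T A k x <= Phi k + n%:R * C1.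
    rewrite !mulr_natl -[X in _ *+ X <= _]card_ord -[X in _ <= _ + _ *+ X]card_ord.
    rewrite -!sumr_const -big_split /=; apply: ler_sum => i _.
    apply: (le_trans (lh_sub_rev T dA k i x)); rewrite lerD2l.
    by apply: lhC; exact: ltnW.
  by have := PhiB k; lra.
have := @half_birkhoff _ _ _ mu T Tinv imp erg (lh T A n) C1 (n%:R * c)
  (measurable_lh n mT mA) (lh_ge0 T dA n) (fun x => lhC n x (leqnn n)) intc.
apply: filterS => x Hx c2 cc2.
have [|k0 Hk0] := Hx (n%:R * ((c + c2) / 2)); first by rewrite ltr_pM2l //; lra.
have e0 : 0 < (c2 - c) / 2 by lra.
have [k1 Hk1] := exists_nat_gt (2 * C1 / ((c2 - c) / 2)).
exists (maxn k0 k1) => k; rewrite geq_max => /andP[k0k k1k].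
have := Hk0 k k0k; have := sub x k => h1 h2.
have kk : k1%:R <= k%:R :> R by rewrite ler_nat.
have := lt_le_trans Hk1 kk; rewrite ltr_pdivrMr // => h3.
rewrite -(ler_pM2l nR).
have := ler_wpM2l (ltW nR) (ltW h3); lra.
Qed.

End Bounded.

Section AlmostEverywhereZero.
Import HBNNSimple.

(** [f] is an arbitrary nonnegative function: its integral is the supremum over simple functions
    below it, and each of these vanishes almost everywhere. The lemma is meant for [lyap_top]. *)
Lemma integral_ae0 (f : X -> \bar R) : (forall x, 0 <= f x)%E ->
  (\forall x \ae mu, f x = 0%E) -> (\int[mu]_x f x = 0)%E.
Proof.
move=> f0 aef; apply/eqP; rewrite eq_le integral_ge0 ?andbT //.
rewrite ge0_integralTE //; apply: ge_ereal_sup => _ [h /= hf <-].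
rewrite -integralT_nnsfun (@ae_eq_integral _ _ _ mu setT (cst 0%E)) //.
- by rewrite integral0.
- by apply/measurable_EFinP; exact: measurable_funPT.
- apply: filterS aef => x fx _ /=; apply/eqP; rewrite eq_le.
  by apply/andP; split; [rewrite -fx; exact: hf|rewrite lee_fin].
Qed.

End AlmostEverywhereZero.

Lemma lyap_top_ge0 (A : X -> 'M[R]_2) x : (forall x, \det (A x) = 1) -> (0 <= lyap_top T A x)%E.
Proof.
move=> dA; rewrite /lyap_top limn_esup_lim; apply: lime_ge; first exact: is_cvg_esups.
apply: nearW => n.
apply: (@le_trans _ _ (n%:R^-1 * ln (opnorm (cocycle T A n x)))%:E).
  rewrite lee_fin mulr_ge0 ?invr_ge0 // ln_ge0 // opnorm_ge1 // cocycleE.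
  exact: det_cocycle.
by apply: ereal_sup_ubound; exists n => /=.
Qed.

(** [Linf_dist] uses the operator norm; [fro] exceeds it by a factor at most 2, which the radii
    below take into account. *)
Definition aeclose (A B : X -> 'M[R]_2) (e : R) := \forall x \ae mu, fro (A x - B x) <= e.

Lemma Linf_dist_aeclose A B (e : R) : (Linf_dist mu A B < e%:E)%E -> aeclose A B (2 * e).
Proof.
move=> /ltW/ess_supP; apply: filterS => x; rewrite lee_fin => h.
by apply: (le_trans (fro_le_opnorm _)); rewrite ler_pM2l.
Qed.

Lemma aeclose_Linf_dist A B (e : R) : aeclose A B e -> (Linf_dist mu A B <= e%:E)%E.
Proof.
move=> h; apply/ess_supP; apply: filterS h => x; rewrite lee_fin => h.
exact: (le_trans (opnorm_le_fro _)).
Qed.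

(** [lh] is twice the logarithm of the Hilbert-Schmidt norm; the factor 2 is harmless since [delta]
    will run through a sequence tending to 0. *)
Definition lowgrowth (delta : R) (A : X -> 'M[R]_2) := Linf_SL2 mu A /\
  exists n, (0 < n)%N /\ (\int[mu]_x (lh T A n x)%:E < (n%:R * delta)%:E)%E.

Lemma Linf_bound A : Linf_SL2 mu A -> exists2 M : R, 1 <= M & \forall x \ae mu, fro (A x) <= M.
Proof.
move=> [_ [_ [M HM]]]; exists (Num.max 1 (2 * M)); first by rewrite le_max lexx.
apply: filterS HM => x h; rewrite le_max; apply/orP; right.
by apply: (le_trans (fro_le_opnorm _)); rewrite ler_pM2l.
Qed.

(** For a fixed [n] the product depends continuously on the cocycle, uniformly along almost every
    orbit. Since [fro] is at least 1, the additive error becomes a factor [1 + D * e], and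
    [ln (1 + x) <= x]. *)
Lemma lowgrowth_open delta A : lowgrowth delta A -> exists2 e : R, 0 < e &
  forall B, Linf_SL2 mu B -> aeclose A B e -> lowgrowth delta B.
Proof.
move=> [LA [n [n0 intA]]].
have [M M1 HM] := Linf_bound LA.
have [mA [dA _]] := LA.
have fin : (\int[mu]_x (lh T A n x)%:E)%E \is a fin_num.
  rewrite ge0_fin_numE; last by apply: integral_ge0 => x _; rewrite lee_fin lh_ge0.
  by apply: lt_trans intA _; rewrite ltry.
pose a := fine (\int[mu]_x (lh T A n x)%:E)%E.
have aE : (\int[mu]_x (lh T A n x)%:E)%E = a%:E by rewrite fineK.
have an : a < n%:R * delta by rewrite -lte_fin -aE.
pose D := n%:R * (2 * (M + 1) ^+ n).
have M0 : 0 < M + 1 by lra.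
have D0 : 0 < D by rewrite !mulr_gt0 ?ltr0n ?exprn_gt0.
(* The bound 1 keeps [B] below [M + 1]; the other one makes the error [2 * (D * e)] at most half of
   the available gap. *)
pose e := Num.min 1 ((n%:R * delta - a) / (4 * D)).
have q0 : 0 < (n%:R * delta - a) / (4 * D).
  by apply: divr_gt0; [rewrite subr_gt0|apply: mulr_gt0].
have e0 : 0 < e by rewrite lt_min ltr01.
exists e => // B LB AB; split => //; exists n; split => //.
have [mB [dB _]] := LB.
have De0 : 0 < 2 * (D * e) by apply: mulr_gt0 => //; exact: mulr_gt0.
have key : \forall x \ae mu, lh T B n x <= lh T A n x + 2 * (D * e).
  have h1 : \forall x \ae mu, forall k, fro (A (iter k T x)) <= M.
    by apply: ae_foralln => k; exact: (ae_iterT imp k HM).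
  have h2 : \forall x \ae mu, forall k, fro (A (iter k T x) - B (iter k T x)) <= e.
    by apply: ae_foralln => k; exact: (ae_iterT imp k AB).
  apply: filterS2 h1 h2 => x hA hAB.
  have e1 : e <= 1 by rewrite ge_min lexx.
  have := @mprod_dist R (fwd T B x) (fwd T A x) (M + 1) e n ltac:(lra) (ltW e0).
  have hyp : forall i, (i < n)%N -> [/\ fro (fwd T B x i) <= M + 1, fro (fwd T A x i) <= M + 1 &
     fro (fwd T B x i - fwd T A x i) <= e].
    move=> i _; rewrite /fwd; have hAi := hA i; have hABi := hAB i; split.
    - have -> : B (iter i T x) = (B (iter i T x) - A (iter i T x)) + A (iter i T x) by rewrite subrK.
      by apply: (le_trans (fro_triangle _ _)); rewrite fro_distC; lra.
    - lra.
    - by rewrite fro_distC.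
  move=> /(_ hyp); rewrite -/D => dist.
  have fA := fro_ge1 (det_cocycle T dA n x).
  have fB : fro (mprod (fwd T B x) n) <= fro (mprod (fwd T A x) n) * (1 + D * e).
    have -> : mprod (fwd T B x) n = (mprod (fwd T B x) n - mprod (fwd T A x) n) + mprod (fwd T A x) n.
      by rewrite subrK.
    apply: (le_trans (fro_triangle _ _)).
    have De : 0 <= D * e by rewrite mulr_ge0 // ltW.
    have := ler_wpM2r De fA; lra.
  have De : 0 < 1 + D * e by rewrite addr_gt0 // mulr_gt0.
  have hsB : hs (mprod (fwd T B x) n) <= hs (mprod (fwd T A x) n) * (1 + D * e) ^+ 2.
    rewrite -!sqr_fro -exprMn ler_pXn2r // nnegrE ?fro_ge0 // mulr_ge0 ?fro_ge0 // ltW //.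
  have gA := hs_gt0 (det_cocycle T dA n x); have gB := hs_gt0 (det_cocycle T dB n x).
  apply: (@le_trans _ _ (ln (hs (mprod (fwd T A x) n) * (1 + D * e) ^+ 2))).
    by rewrite ler_ln ?posrE ?mulr_gt0 ?exprn_gt0.
  rewrite lnM ?posrE ?exprn_gt0 // lnXn // lerD2l mulr_natl lerMn2r /=.
  by apply: le_ln1Dx; rewrite (lt_trans (ltrN10 R)) // mulr_gt0.
apply: (@le_lt_trans _ _ (\int[mu]_x ((lh T A n x)%:E + (2 * (D * e))%:E))%E).
  apply: ae_ge0_le_integral => //.
  - by move=> x _; rewrite lee_fin lh_ge0.
  - by apply/measurable_EFinP; exact: measurable_lh.
  - by move=> x _; rewrite -EFinD lee_fin addr_ge0 ?lh_ge0 // ltW.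
  - apply: emeasurable_funD; last exact: measurable_cst.
    by apply/measurable_EFinP; exact: measurable_lh.
  - by apply: filterS key => x h _; rewrite -EFinD lee_fin.
rewrite ge0_integralD //; last 3 first.
- by move=> x _; rewrite lee_fin lh_ge0.
- by apply/measurable_EFinP; exact: measurable_lh.
- by move=> x _; rewrite lee_fin ltW.
rewrite aE [X in (_ + X)%E](integral_const mu (2 * (D * e))%:E) -EFinD lte_fin.
have : e <= (n%:R * delta - a) / (4 * D) by rewrite ge_min lexx orbT.
rewrite ler_pdivlMr; last exact: mulr_gt0.
lra.
Qed.

(** Cocycles are only essentially bounded, while the arguments above use a bound at every point. For
    a suitable [H] the identity is put on a null set only. *)
Definition truncated (H : R) (A : X -> 'M[R]_2) x := if hs (A x) <= H then A x else 1%:M.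

Lemma truncated_spec A : Linf_SL2 mu A -> exists H, [/\ 2 <= H, measM (truncated H A),
  (forall x, \det (truncated H A x) = 1), (forall x, hs (truncated H A x) <= H) &
  \forall x \ae mu, truncated H A x = A x].
Proof.
move=> LA; have [M M1 HM] := Linf_bound LA; have [mA [dA _]] := LA.
exists (Num.max 2 (M ^+ 2)); set H := Num.max _ _.
have H2 : 2 <= H by rewrite le_max lexx.
split => //.
- move=> i j.
  have -> : (fun x => truncated H A x i j) = fun x => if hs (A x) <= H then A x i j else (1%:M : 'M[R]_2) i j.
    by apply/funext => x; rewrite /truncated; case: ifP.
  apply: measurable_fun_ifT => //.
  apply: (@measurable_fun_bool _ _ _ _ true).
  rewrite (_ : _ @^-1` _ = [set x | hs (A x) <= H]) //.
  by apply: measurable_fun_le => //; exact: measurable_hs.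
- by move=> x; rewrite /truncated; case: ifP => // _; rewrite det1.
- by move=> x; rewrite /truncated; case: ifP => // _; rewrite hs1.
- apply: filterS HM => x h; rewrite /truncated ifT // -sqr_fro le_max; apply/orP; right.
  by rewrite ler_pXn2r // nnegrE ?fro_ge0 //; lra.
Qed.

Lemma ae_lh_eq (A B : X -> 'M[R]_2) : (\forall x \ae mu, A x = B x) ->
  \forall x \ae mu, forall n, lh T A n x = lh T B n x.
Proof.
move=> AB.
have : \forall x \ae mu, forall k, A (iter k T x) = B (iter k T x).
  by apply: ae_foralln => k; exact: (ae_iterT imp k AB).
apply: filterS => x h n; rewrite /lh; congr (ln (hs _)); apply: mprod_ext => i _; exact: h.
Qed.

Lemma integral_lh_eq (A B : X -> 'M[R]_2) n : measM A -> measM B -> (\forall x \ae mu, A x = B x) ->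
  (\int[mu]_x (lh T A n x)%:E = \int[mu]_x (lh T B n x)%:E)%E.
Proof.
move=> mA mB AB; apply: ae_eq_integral => //.
- by apply/measurable_EFinP; exact: measurable_lh.
- by apply/measurable_EFinP; exact: measurable_lh.
- by apply: filterS (ae_lh_eq AB) => x h _; rewrite h.
Qed.

Lemma UH_ae_eq A B : (\forall x \ae mu, A x = B x) ->
  uniformly_hyperbolic T Tinv mu A -> uniformly_hyperbolic T Tinv mu B.
Proof.
move=> AB [Eu [Es [mEu [mEs [C [tau [C0 [tau01 hyp]]]]]]]].
exists Eu, Es; split => //; split => //; exists C, tau; split => //; split => //.
have h1 : \forall x \ae mu, forall k, A (iter k T x) = B (iter k T x).
  by apply: ae_foralln => k; exact: (ae_iterT imp k AB).
have h2 : \forall x \ae mu, forall k, A (iter k Tinv x) = B (iter k Tinv x).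
  by apply: ae_foralln => k; exact: (ae_iterTinv imp k AB).
apply: filterS3 hyp h1 h2 => x [sp [iu [is_ [cs cu]]]] e1 e2.
have ef n : cocycle T A n x = cocycle T B n x by elim: n => //= n ->; rewrite e1.
have eb n : cocycle_neg Tinv A n x = cocycle_neg Tinv B n x.
  by elim: n => //= n ->; rewrite -iterS e2.
split => //; split; first by rewrite -iu (e1 0%N).
split; first by rewrite -is_ (e1 0%N).
by split=> n v Ev; [rewrite -ef; exact: cs|rewrite -eb; exact: cu].
Qed.

(** Each [lowgrowth] hypothesis bounds the upper growth rate almost everywhere, and there are
    countably many of them; the bound from below is determinant one. *)
Lemma LE_lowgrowth A : (forall k : nat, lowgrowth k.+1%:R^-1 A) -> LE T mu A = 0%E.
Proof.
move=> low; have [LA _] := low 0%N; have [mA [dA _]] := LA.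
apply: integral_ae0; first by move=> x; exact: lyap_top_ge0.
have [H [H2 mA' dA' HA' AA']] := truncated_spec LA.
have upper (j : nat) : \forall x \ae mu, exists k0, forall k, (k0 <= k)%N ->
    lh T A k x <= 2 * j.+1%:R^-1 * k%:R.
  have [_ [n [n0 intn]]] := low j.
  have AA'' : \forall x \ae mu, A x = truncated H A x by apply: filterS AA' => x ->.
  rewrite (integral_lh_eq n mA mA' AA'') in intn.
  have up := lyapunov_upper mA' dA' HA' H2 n0 intn.
  apply: filterS2 up (ae_lh_eq AA'') => x h1 h2.
  have j0 : 0 < j.+1%:R^-1 :> R by rewrite invr_gt0.
  have [|k0 Hk0] := h1 (2 * j.+1%:R^-1); first by rewrite ltr_pMl // ltr1n.
  by exists k0 => k kk; rewrite h2; exact: Hk0.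
have aeU := ae_foralln upper.
apply: filterS aeU => x Hx; rewrite /lyap_top.
set u := fun n : nat => _.
suff cu : u @ \oo --> (0%:E : \bar R) by have [_ ->] := cvg_limn_einf_sup cu.
have ge1 n : 1 <= opnorm (cocycle T A n x).
  by rewrite opnorm_ge1 // cocycleE; exact: det_cocycle.
apply: cvg_EFin; first exact: nearW.
apply/cvgrPdist_le => e e0.
have [j Hj] := exists_nat_gt (2 / e).
have [k0 Hk0] := Hx j.
exists (maxn 1 k0) => // k /=; rewrite geq_max => /andP[k1 k0k].
have kR : 0 < k%:R :> R by rewrite ltr0n.
rewrite sub0r normrN ger0_norm; last by rewrite mulr_ge0 ?invr_ge0 // ln_ge0.
rewrite mulrC ler_pdivrMr //.
have le1 : ln (opnorm (cocycle T A k x)) <= lh T A k x.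
  rewrite /lh -cocycleE ler_ln ?posrE; last by rewrite cocycleE hs_gt0 // det_cocycle.
    apply: (le_trans (opnorm_le_fro _)); rewrite -sqr_fro expr2 ler_peMl ?fro_ge0 //.
    by rewrite fro_ge1 // cocycleE det_cocycle.
  exact: lt_le_trans (ge1 k).
apply: (le_trans le1); apply: (le_trans (Hk0 k k0k)); rewrite ler_pM2r //.
rewrite ler_pdivrMr //; move: Hj; rewrite ltr_pdivrMr // => Hj.
have : j%:R <= j.+1%:R :> R by rewrite ler_nat.
by move=> h; have := ler_wpM2r (ltW e0) h; lra.
Qed.

Definition exterior (delta : R) (A : X -> 'M[R]_2) := Linf_SL2 mu A /\
  exists2 e : R, 0 < e & forall B, Linf_SL2 mu B -> aeclose A B e -> ~ lowgrowth delta B.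

(** The other alternative of [dichotomy] would be a cocycle of low growth inside the excluded
    ball. *)
Lemma exterior_UH delta A : 0 < delta -> exterior delta A -> uniformly_hyperbolic T Tinv mu A.
Proof.
move=> delta0 [LA [e e0 far]].
have [H [H2 mA' dA' HA' AA']] := truncated_spec LA.
have [UH|[B [mB dB HB AB Bn]]] := dichotomy mA' dA' HA' H2 e0 delta0.
  exact: UH_ae_eq AA' UH.
exfalso.
have LB : Linf_SL2 mu B.
  split => //; split => //; exists (Num.sqrt H); apply: aeW => x.
  by apply: (le_trans (opnorm_le_fro _)); rewrite ler_wsqrtr.
apply: (far B LB); last by split.
by apply: filterS AA' => x <-; rewrite fro_distC.
Qed.

Lemma aeclose_trans A B C e1 e2 : aeclose A B e1 -> aeclose B C e2 -> aeclose A C (e1 + e2).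
Proof.
apply: filterS2 => x h1 h2.
have -> : A x - C x = (A x - B x) + (B x - C x) by rewrite addrA subrK.
by apply: (le_trans (fro_triangle _ _)); exact: lerD.
Qed.

Lemma residual_dichotomy : exists Rs : set (X -> 'M[R]_2),
  Linf_residual mu Rs /\
  forall A, Rs A -> uniformly_hyperbolic T Tinv mu A \/ LE T mu A = 0%E.
Proof.
pose U (k : nat) : set (X -> 'M[R]_2) :=
  [set A | lowgrowth k.+1%:R^-1 A \/ exterior k.+1%:R^-1 A].
exists (\bigcap_k U k); split; first split.
- by move=> A /(_ 0%N I) [[]|[]].
- exists U; split => // k; split; first split.
  + by move=> A [[]|[]].
  + move=> A [low|[LA [e e0 far]]].
      have [e e0 He] := lowgrowth_open low.
      exists (e / 2); first by rewrite divr_gt0.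
      move=> B LB /Linf_dist_aeclose; rewrite mulrC divfK // => AB.
      by left; exact: He.
    (* Passing to [aeclose] doubles the radius, which leaves a ball of radius [e / 2] free around
       [B]. *)
    exists (e / 4); first by rewrite divr_gt0.
    move=> B LB /Linf_dist_aeclose AB; right; split => //.
    exists (e / 2); first by rewrite divr_gt0.
    move=> C LC BC; apply: far => //.
    have -> : e = 2 * (e / 4) + e / 2 by field.
    exact: aeclose_trans AB BC.
  + move=> A LA e e0.
    have e2 : 0 < e / 2 by rewrite divr_gt0.
    have lt : ((e / 2)%:E < e%:E)%E by rewrite lte_fin; lra.
    have [[B [lowB AB]]|none] := pselect (exists B, lowgrowth k.+1%:R^-1 B /\ aeclose A B (e / 2)).
      exists B; first by left.
      exact: (le_lt_trans (aeclose_Linf_dist AB)).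
    exists A.
      right; split => //; exists (e / 2) => // B LB AB lowB; apply: none; by exists B.
    apply: (le_lt_trans _ lt); apply: aeclose_Linf_dist; apply: aeW => x.
    by rewrite subrr /fro /hs !mxE expr0n /= !addr0 sqrtr0 ltW.
move=> A RA.
have [low|/existsNP[k nlow]] := pselect (forall k : nat, lowgrowth k.+1%:R^-1 A).
  by right; exact: LE_lowgrowth.
left; have [//|ext] := RA k I.
by apply: exterior_UH ext; rewrite invr_gt0.
Qed.

End Dichotomy.

Theorem theoremB (d : measure_display) (X : measurableType d) (R : realType)
  (mu : probability X R) (T Tinv : X -> X) :
  nonatomic mu -> invertible_mp mu T Tinv -> ergodic mu T ->
  exists Rs : set (X -> 'M[R]_2),
    Linf_residual mu Rs /\
    forall A, Rs A ->
      uniformly_hyperbolic T Tinv mu A \/ LE T mu A = 0%E.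
Proof. by move=> na imp erg; exact: residual_dichotomy imp erg na. Qed.
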